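(* Let $n\in\mathbb N$, $p\ge2$, $\theta\in\mathbb R$, and consider the Heisenberg group $\mathbb H^n$ with $Q=2n+2$. (1) For the Korányi norm $\rho(z,t)=(|z|^4+t^2)^{1/4}$, \[ c(\rho,p,\theta)\ge\begin{cases}\left|\frac{Q-p\theta}{p}\right|^p\left|\frac{Q-2}{Q}\right|^p & \text{if } p\theta\in\left[\left(1-\sqrt{\tfrac32}\right)Q,\left(1+\sqrt{\tfrac32}\right)Q\right],\\[1ex] \left(\frac32\right)^{p/2}\frac{\left(3p\theta(p\theta-2Q)\right)^{p/4}}{|p\theta-Q|^{p/2}}\left|\frac{Q-2}{p}\right|^p & \text{otherwise.}\end{cases} \] (2) For the Carnot–Carathéodory norm $\delta_{cc}$, \[ c(\delta_{cc},p,\theta)\ge\begin{cases}\left(\frac{Q-2}{Q}\right)^p\left|\frac{Q-p\theta}{p}\right|^p & \text{if } \theta\ge0 \text{ and } Q\ge\frac{4p\theta}{12-\pi^2},\\[1ex] \frac{1}{\|g\|_\infty^{p/2}}\left|\frac{Q-p\theta}{p}\right|^p & \text{otherwise,}\end{cases} \] where $g:[-2\pi,2\pi]\to(0,\infty)$ is \[ g(\nu)=2\left(\frac{Q}{Q-2}\right)^2\frac{1-\cos\nu}{\nu^2}+\left(\frac{2p\theta}{Q-2}\right)^2\left(\frac{\nu-\sin\nu}{\nu^2}\right)^2-\frac{4p\theta Q}{(Q-2)^2}\,\frac{\nu-\sin\nu}{\nu^2}\,\frac{1-\cos\nu}{\nu} \] (extended continuously at $\nu=0$), and $\|g\|_\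infty=\sup_{[-2\pi,2\pi]}g$.
   Context: The Heisenberg group $\mathbb H^n$ is $\mathbb R^{2n}\times\mathbb R$ with coordinates $(z,t)$, $z=(z_1,\dots,z_{2n})$, group law $(z,t)\circ(\eta,\tau)=(z+\eta,t+\tau+\tfrac12\langle Bz,\eta\rangle)$ where $B=\mathrm{diag}\left(\begin{pmatrix}0&4\\-4&0\end{pmatrix},\dots,\begin{pmatrix}0&4\\-4&0\end{pmatrix}\right)$, dilations $\delta_\gamma(z,t)=(\gamma z,\gamma^2t)$, homogeneous dimension $Q=2n+2$. Horizontal vector fields: $X_{2i-1}=\partial_{z_{2i-1}}+2z_{2i}\partial_t$, $X_{2i}=\partial_{z_{2i}}-2z_{2i-1}\partial_t$, $i=1,\dots,n$; $\nabla_{\mathbb H}u=(X_1u,\dots,X_{2n}u)$ with Euclidean norm. $\delta_{cc}(z,t)$ is the Carnot–Carathéodory distance from $(z,t)$ to the origin: the infimum of $\int_0^1|h(s)|\,ds$ over absolutely continuous curves $\gamma:[0,1]\to\mathbb H^n$ from $0$ to $(z,t)$ with $\gamma'(s)=\sum_i h_i(s)X_i(\gamma(s))$ a.e. For a positive homogeneous function $d$ (continuous, $d(\delta_\lambda(z,t))=\lambda d(z,t)$, $d>0$ off the origin), $p\ge2$, $\theta\in\mathbb R$, \[ c(d,p,\theta)=\sup\Big\{c\ge0:\int_{\mathbb H^n}\frac{|\nabla_{\mathbb H}u|^p}{d^{p(\theta-1)}}dz\,dt\ge c\int_{\mathbb H^n}\frac{|u|^p}{d^{p\theta}}dz\,dt\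 \ \forall u\in C_c^\infty(\mathbb H^n\setminus\{0\})\Big\}. \] *)

(* Defs.v *)
From HB Require Import structures.
From mathcomp Require Import all_boot all_order all_algebra.
From mathcomp Require Import all_classical all_reals all_analysis.
Set Implicit Arguments. Unset Strict Implicit. Unset Printing Implicit Defensive.
Import Order.TTheory GRing.Theory Num.Theory.
Import numFieldNormedType.Exports.
Local Open Scope classical_set_scope.
Local Open Scope ring_scope.

Section Heisenberg.
Variable R : realType.
Variable n : nat.

(* A point (z_0,...,z_{2n-1},t) of H^n = R^{2n} x R, 0-indexed:
   coordinate k (k < 2n) is z_k, coordinate 2n is t. *)
Definition pt := 'rV[R]_(n.*2.+1).

Definition coord (x : pt) (k : nat) : R := x ord0 (inord k).
Definition tcoord (x : pt) : R := x ord0 ord_max.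

Definition zsq (x : pt) : R := \sum_(j < n.*2) (coord x j) ^+ 2.

Definition pd (k : 'I_(n.*2.+1)) (f : pt -> R) : pt -> R :=
  fun x => 'D_(delta_mx 0 k) f x.

Definition iter_pd (ks : seq 'I_(n.*2.+1)) (f : pt -> R) : pt -> R :=
  foldr pd f ks.

Definition smooth (f : pt -> R) : Prop :=
  forall ks : seq 'I_(n.*2.+1),
    continuous (iter_pd ks f) /\
    forall (k : 'I_(n.*2.+1)) (x : pt), derivable (iter_pd ks f) x (delta_mx 0 k).

Definition supp (u : pt -> R) : set pt := closure [set x | u x != 0].

Definition test_fun (u : pt -> R) : Prop :=
  smooth u /\ compact (supp u) /\ ~ supp u 0.

(* t-component of the horizontal field X_j (0-indexed, j < 2n):
   X_j = d_{z_j} + 2 z_{j+1} d_t  if j even,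
   X_j = d_{z_j} - 2 z_{j-1} d_t  if j odd. *)
Definition tcoef (x : pt) (j : nat) : R :=
  if odd j then - (2 * coord x j.-1) else 2 * coord x j.+1.

Definition Xfield (j : nat) (u : pt -> R) : pt -> R :=
  fun x => pd (inord j) u x + tcoef x j * pd ord_max u x.

Definition Xvec (j : nat) (x : pt) : pt :=
  delta_mx 0 (inord j) + tcoef x j *: delta_mx 0 ord_max.

Definition hgrad_norm (u : pt -> R) (x : pt) : R :=
  Num.sqrt (\sum_(j < n.*2) (Xfield j u x) ^+ 2).

(* Iterated one-dimensional Lebesgue integrals; for the nonnegative
   (measurable) integrands used below this is the Lebesgue integral on
   R^m by Tonelli. *)
Definition upd (v : nat -> R) (m : nat) (y : R) : nat -> R :=
  fun k => if k == m then y else v k.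

Fixpoint iint (m : nat) (f : (nat -> R) -> \bar R) : \bar R :=
  match m with
  | 0 => f (fun _ => 0)
  | m'.+1 => (\int[@lebesgue_measure R]_y iint m' (fun v => f (upd v m' y)))%E
  end.

Definition integral_H (F : pt -> \bar R) : \bar R :=
  iint n.*2.+1 (fun v => F (\row_(i < n.*2.+1) v i)).

(* c(d,p,theta), as an extended real (it could a priori be +oo) *)
Definition hardy_const (d : pt -> R) (p theta : R) : \bar R :=
  ereal_sup [set c%:E | c in [set c : R | 0 <= c /\
    forall u, test_fun u ->
      (c%:E * integral_H (fun x => ((`|u x| `^ p) / (d x `^ (p * theta)))%:E)
       <= integral_H (fun x => ((hgrad_norm u x `^ p) / (d x `^ (p * (theta - 1))))%:E))%E]].

Definition koranyi (x : pt) : R := ((zsq x) ^+ 2 + (tcoord x) ^+ 2) `^ (4^-1).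

Definition abs_cont01 (f : R -> R) : Prop :=
  forall e : R, 0 < e -> exists2 d : R, 0 < d &
    forall (k : nat) (a b : 'I_k -> R),
      (forall i, 0 <= a i /\ a i < b i /\ b i <= 1) ->
      (forall i j, i != j -> b i <= a j \/ b j <= a i) ->
      \sum_(i < k) (b i - a i) < d ->
      \sum_(i < k) `|f (b i) - f (a i)| < e.

Definition horizontal_curve (x : pt) (gamma : R -> pt) (h : 'I_(n.*2) -> R -> R) : Prop :=
  gamma 0 = 0 /\ gamma 1 = x /\
  (forall k : 'I_(n.*2.+1), abs_cont01 (fun s => gamma s ord0 k)) /\
  (forall i, measurable_fun (`[0%R, 1%R] : set R) (h i)) /\
  {ae @lebesgue_measure R, forall s : R, 0 < s < 1 ->
     is_derive s 1 gamma (\sum_(i < n.*2) h i s *: Xvec i (gamma s))}.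

Definition control_length (h : 'I_(n.*2) -> R -> R) : \bar R :=
  (\int[@lebesgue_measure R]_(s in `[0%R, 1%R]) (Num.sqrt (\sum_(i < n.*2) (h i s) ^+ 2))%:E)%E.

(* Carnot-Caratheodory distance to the origin (finite by Chow's theorem) *)
Definition cc_dist (x : pt) : R :=
  fine (ereal_inf [set L | exists gamma h, horizontal_curve x gamma h /\ L = control_length h]).

Definition Qdim : R := (n.*2.+2)%:R.

(* the function g of part (2), extended continuously at 0 by (Q/(Q-2))^2 *)
Definition gfun (p theta nu : R) : R :=
  let Q := Qdim in
  if nu == 0 then (Q / (Q - 2)) ^+ 2 else
  2 * (Q / (Q - 2)) ^+ 2 * ((1 - cos nu) / nu ^+ 2)
  + (2 * p * theta / (Q - 2)) ^+ 2 * ((nu - sin nu) / nu ^+ 2) ^+ 2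
  - 4 * p * theta * Q / (Q - 2) ^+ 2 * ((nu - sin nu) / nu ^+ 2) * ((1 - cos nu) / nu).

Definition gsup (p theta : R) : R :=
  sup [set gfun p theta nu | nu in `[- (2 * pi), 2 * pi]%classic].

End Heisenberg.

(* Main.v *)
Require Import Defs.
From HB Require Import structures.
From mathcomp Require Import all_boot all_order all_algebra.
From mathcomp Require Import all_classical all_reals all_analysis.
From mathcomp Require Import measurable_realfun.
From mathcomp Require Import ring lra.
Import Order.TTheory GRing.Theory Num.Theory.
Import numFieldNormedType.Exports.
Local Open Scope classical_set_scope.
Local Open Scope ring_scope.

(* Write [m = p theta] and [d (z, t) = |z| h (y)] with [y = t / |z|^2].  The
   horizontal field [F = a z + b Jz] with
     [a = |z|^(-m) h^(-m-1) (Q h - 2 m y h')],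
     [b = |z|^(-m) m y h^(-m-1) (h - 2 y h')]
   satisfies [div_H F = (Q - 2) (Q - m) d^(-m)].  If
     [(Q h - 2 m y h')^2 + m^2 y^2 (h - 2 y h')^2 <= K^2 (Q - 2)^2 h^4]
   then [|F| <= K (Q - 2) d^(1-m)], and integrating [div_H F] against
   [|u|^p] and applying Young's inequality gives
   [c (d, p, theta) >= (|Q - m| / (p K))^p].  Since [d] need not be smooth on the
   axis [z = 0], this is done with [|z|^2 + e] in place of [|z|^2], and then
   [e -> 0].

   For the Koranyi norm [h = (1 + y^2)^(1/4)] and the best [K] comes from
   maximising a cubic polynomial.  For the Carnot-Caratheodory distance
   [h = cos c + y sin c], where [c], half the opening angle of the circular arc
   under the geodesic, solves [y sin^2 c = c - sin c cos c]; then the left-hand side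
   above equals [(Q - 2)^2 g (2 c) h^4].  That this is the distance follows from
   explicit circular arcs (upper bound) and from a calibration of the form
   [kap t + C (l) |z|^2 - l], nonincreasing along every horizontal curve whose
   length so far is [l] (lower bound). *)

(** * Iterated integrals *)

(** The field comes from homogeneity. The dilation field [z . grad_z + 2 t d_t] produces the factor
    [Q - m], but it is not horizontal. Put [w = d^(-m)]. For coefficients depending on [|z|] and [t]
    only, [div_H (a z) = (Q - 2) a + z . grad_z a] and [div_H (b Jz) = 2 |z|^2 d_t b], so a rotation
    can stand in for the vertical part: with [a = Q w + 2 t d_t w] and
    [b = - (t / |z|^2) z . grad_z w] the mixed second derivatives cancel, and what remains is
    [Q - 2] times [Q w + 2 t d_t w + z . grad_z w], that is [(Q - 2) (Q - m) w]. These are the [a]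
    and [b] above. A second obstacle is that integrals are iterated one-variable integrals, while
    continuity or measurability of the weight [d] is not at hand. Linearity and integration by parts
    are therefore proved for continuous integrands of compact support, which the regularised weights
    provide; integrals containing [d] are reached by monotonicity alone, the ratio of the two
    weights being pinched near 1 on the support of [u]. *)

Lemma MVT_dist {R : realType} (F dF : R -> R) :
  (forall y : R, is_derive y 1 F (dF y)) ->
  forall a b, exists2 c, `|c - a| <= `|b - a| & F b - F a = dF c * (b - a).
Proof.
move=> dF1 a b.
have cF : continuous F.
  move=> y; apply/differentiable_continuous/derivable1_diffP.
  exact: ex_derive.
have [ab|/ltW ba] := leP a b.
  have [|c] := MVT_segment ab (fun x _ => dF1 x); first exact: continuous_subspaceT.
  rewrite in_itv/= => /andP[ac cb] E; exists c => //.
  by rewrite !ger0_norm; lra.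
have [|c] := MVT_segment ba (fun x _ => dF1 x); first exact: continuous_subspaceT.
rewrite in_itv/= => /andP[ac cb] E; exists c.
  by rewrite !ler0_norm; lra.
by rewrite -opprB E; ring.
Qed.

Section IteratedIntegral.
Context {R : realType}.
Notation mu := (@lebesgue_measure R).
Implicit Types (m : nat) (M e y : R) (v w : nat -> R) (f g : (nat -> R) -> R).

(** The integral of a nonnegative function is a supremum over simple functions below it, so
    monotonicity extends to inner iterated integrals whose measurability is not established. *)
Lemma ge0_integral_mono (f1 f2 : R -> \bar R) :
  (forall x, 0 <= f1 x)%E -> (forall x, f1 x <= f2 x)%E ->
  (\int[mu]_x f1 x <= \int[mu]_x f2 x)%E.
Proof.
move=> f10 f12.
have f20 x : (0 <= f2 x)%E by exact: le_trans (f12 x).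
rewrite !ge0_integralTE//.
apply: le_ereal_sup => _ [h /= hf1 <-]; exists h => //= x.
exact: le_trans (f12 x).
Qed.

Lemma iint_ge0 m (F : (nat -> R) -> \bar R) :
  (forall v, 0 <= F v)%E -> (0 <= iint m F)%E.
Proof.
elim: m F => [|m IH] F F0 /=; first exact: F0.
by apply: integral_ge0 => y _; exact: IH.
Qed.

Lemma le_iint m (F G : (nat -> R) -> \bar R) :
  (forall v, 0 <= F v)%E -> (forall v, F v <= G v)%E ->
  (iint m F <= iint m G)%E.
Proof.
elim: m F G => [|m IH] F G F0 FG /=; first exact: FG.
apply: ge0_integral_mono => y; last exact: IH.
exact: iint_ge0.
Qed.

Definition uc_supp m M f :=
  (forall v, (exists2 i, (i < m)%N & M < `|v i|) -> f v = 0) /\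
  (forall e, 0 < e -> exists2 d, 0 < d & forall v w,
     (forall i, (i < m)%N -> `|v i - w i| < d) -> `|f v - f w| < e).

Definition slice m f y := fun v => f (upd v m y).

Fixpoint rint m f : R :=
  match m with
  | 0 => f (fun _ => 0)
  | m'.+1 => \int[mu]_y rint m' (slice m' f y)
  end.

Lemma upd_neq v m y i : (i < m)%N -> upd v m y i = v i.
Proof. by rewrite /upd => im; rewrite ltn_eqF. Qed.

Lemma upd_eq v m y : upd v m y m = y.
Proof. by rewrite /upd eqxx. Qed.

Lemma uc_supp_slice m M f y : uc_supp m.+1 M f -> uc_supp m M (slice m f y).
Proof.
move=> [f0 fuc]; split.
  move=> v [i im Mv]; apply: f0; exists i; first exact: ltnW.
  by rewrite upd_neq.
move=> e /fuc[d d0 H]; exists d => // v w vw; apply: H => i.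
rewrite ltnS leq_eqVlt => /predU1P[->|im].
  by rewrite !upd_eq subrr normr0.
by rewrite !upd_neq// vw.
Qed.

Lemma uc_suppD m M f g c : uc_supp m M f -> uc_supp m M g ->
  uc_supp m M (fun v => f v + c * g v).
Proof.
move=> [f0 fuc] [g0 guc]; split.
  by move=> v vM; rewrite f0// g0// mulr0 addr0.
move=> e e0.
have c1 : 0 < `|c| + 1 by rewrite ltr_wpDl.
have [d1 d10 H1] := fuc (e / 2) ltac:(lra).
have [d2 d20 H2] := guc (e / 2 / (`|c| + 1)) ltac:(by rewrite !divr_gt0).
exists (Num.min d1 d2); first by rewrite lt_min d10.
move=> v w vw.
have -> : f v + c * g v - (f w + c * g w) = (f v - f w) + c * (g v - g w) by ring.
apply: le_lt_trans (ler_normD _ _) _.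
have A : `|f v - f w| < e / 2.
  by apply: H1 => i /vw; rewrite lt_min => /andP[].
have B : `|g v - g w| < e / 2 / (`|c| + 1).
  by apply: H2 => i /vw; rewrite lt_min => /andP[].
have C : `|c * (g v - g w)| <= e / 2.
  rewrite normrM; apply: (@le_trans _ _ ((`|c| + 1) * (e / 2 / (`|c| + 1)))).
    by apply: ler_pM => //; [rewrite lerDl|exact: ltW].
  by rewrite mulrC divfK// gt_eqF.
by rewrite (splitr e); exact: ltr_leD.
Qed.

Section OneVariable.
Variables (M : R) (g : R -> R).
Hypothesis M0 : 0 < M.
Hypothesis cg : continuous g.
Hypothesis gM : forall y, M < `|y| -> g y = 0.

Let restr : g = g \_ `[- M, M].
Proof.
apply/funext => y; rewrite /patch; case: ifPn => // yM.
apply: gM; rewrite ltNge; apply: contra yM => yM.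
by rewrite inE/= in_itv/= -ler_norml.
Qed.

Let int_seg : mu.-integrable `[- M, M] (EFin \o g).
Proof.
apply: continuous_compact_integrable; first exact: segment_compact.
exact: continuous_subspaceT.
Qed.

Lemma cont_supp_integrable : mu.-integrable setT (EFin \o g).
Proof.
rewrite restr -restrict_EFin; apply/integrable_restrict => //=.
by rewrite setTI.
Qed.

Lemma Rintegral_supp : \int[mu]_y g y = \int[mu]_(y in `[- M, M]) g y.
Proof. by rewrite [RHS]Rintegral_mkcond -restr. Qed.

Lemma Rintegral_supp_bound e : (forall y, `|g y| <= e) ->
  `|\int[mu]_y g y| <= 2 * M * e.
Proof.
move=> ge; rewrite Rintegral_supp; have M0' := M0.
apply: le_trans; first exact: le_normr_Rintegral.
apply: (@le_trans _ _ (\int[mu]_(y in `[- M, M]) e)).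
  apply: le_Rintegral => //=.
    by have := int_seg => /integrable_norm.
  apply: continuous_compact_integrable; first exact: segment_compact.
  by apply: continuous_subspaceT => ?; exact: cvg_cst.
rewrite Rintegral_cst//= lebesgue_measure_itv/= lte_fin.
have -> : - M < M by lra.
by rewrite /= opprK mulrC; apply: ler_wpM2r; [exact: le_trans (normr_ge0 _) (ge 0)|lra].
Qed.

Lemma Rintegral_deriv0 (G : R -> R) :
  (forall y, is_derive y 1 G (g y)) -> (forall y, M < `|y| -> G y = 0) ->
  \int[mu]_y g y = 0.
Proof.
move=> dG GM; have M0' := M0.
have dG' y : derivable G y 1 by apply: ex_derive.
have cG : continuous G.
  by move=> y; apply/differentiable_continuous/derivable1_diffP.
(* [G] is known to vanish only where [M < |y|], so the endpoints are moved outwards to make both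
   boundary terms zero. *)
have supp1 : \int[mu]_y g y = \int[mu]_(y in `[- (M + 1), M + 1]) g y.
  rewrite [RHS]Rintegral_mkcond; congr (fine _); apply: eq_integral => y _.
  rewrite /patch; case: ifPn => // yM; congr EFin.
  apply: gM; apply: (@lt_trans _ _ (M + 1)); first lra.
  rewrite ltNge; apply: contra yM => yM.
  by rewrite inE/= in_itv/= -ler_norml.
rewrite supp1 /Rintegral (@continuous_FTC2 _ g G)//; first last.
- by move=> y _; rewrite derive1E; apply: derive_val.
- split.
  + by move=> y _; exact: dG'.
  + exact/cvg_at_right_filter/cG.
  + exact/cvg_at_left_filter/cG.
- exact: continuous_subspaceT.
- lra.
have A : M < `|M + 1| by rewrite ger0_norm; lra.
by rewrite !GM ?normrN// sube0.
Qed.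

End OneVariable.

Lemma rint0 m : rint m (fun=> 0) = 0.
Proof.
elim: m => [//|m IH] /=.
rewrite (_ : (fun y => _) = fun=> 0); last by apply/funext => y; rewrite -[RHS]IH.
by rewrite /Rintegral integral0.
Qed.

Lemma rint_ge0 m f : (forall v, 0 <= f v) -> 0 <= rint m f.
Proof.
elim: m f => [|m IH] f f0 //=; apply: Rintegral_ge0 => y _.
by apply: IH => v; exact: f0.
Qed.

(** One induction for the three facts: integrability in the next variable requires continuity of the
    slice integral, and that continuity rests on linearity and the sup bound in one dimension
    less. *)
Lemma rint_props m M : 0 < M ->
  (forall f g c, uc_supp m M f -> uc_supp m M g ->
     rint m (fun v => f v + c * g v) = rint m f + c * rint m g) /\
  (forall f e, uc_supp m M f -> (forall v, `|f v| <= e) ->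
     `|rint m f| <= (2 * M) ^+ m * e) /\
  (forall f, uc_supp m M f -> iint m (fun v => (f v)%:E) = (rint m f)%:E).
Proof.
move=> M0; elim: m => [|m [IHl [IHb IHe]]].
  by split=> [//|]; split=> // f e _ fe; rewrite expr0 mul1r; exact: fe.
have slc f : uc_supp m.+1 M f ->
    continuous (fun y => rint m (slice m f y)) /\
    (forall y, M < `|y| -> rint m (slice m f y) = 0).
  move=> fC; split; last first.
    move=> y yM; rewrite -[RHS](rint0 m); congr rint; apply/funext => v.
    by apply: (fC.1); exists m => //; rewrite upd_eq.
  move=> y; apply/cvgrPdist_lt => e e0.
  have K0 : 0 < (2 * M) ^+ m by apply: exprn_gt0; lra.
  have [d d0 fd] := fC.2 (e / 2 / (2 * M) ^+ m) ltac:(by rewrite !divr_gt0).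
  near=> z.
  have -> : rint m (slice m f y) - rint m (slice m f z) =
      rint m (fun v => slice m f y v + (-1) * slice m f z v).
    by rewrite IHl ?mulN1r//; exact: uc_supp_slice.
  apply: (@le_lt_trans _ _ (e / 2)); last lra.
  rewrite -[leRHS](divfK (lt0r_neq0 K0)) mulrC.
  apply: IHb.
    by apply: uc_suppD; exact: uc_supp_slice.
  move=> v; rewrite mulN1r; apply/ltW/fd => i.
  rewrite ltnS leq_eqVlt => /predU1P[->|im]; last first.
    by rewrite !upd_neq// subrr normr0.
  rewrite !upd_eq; near: z.
  by apply/nbhs_ballP; exists d => //= z; rewrite /ball/=.
split; [|split].
- move=> f g c fC gC /=.
  have [cf f0] := slc _ fC; have [cg g0] := slc _ gC.
  rewrite -(@RintegralZl _ _ _ _ setT)//; last exact: (cont_supp_integrable M).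
  rewrite -RintegralD//; first last.
  + apply: (cont_supp_integrable M) => //.
      by move=> y; apply: cvgM; [exact: cvg_cst|exact: cg].
    by move=> y /g0 ->; rewrite mulr0.
  + exact: (cont_supp_integrable M).
  apply: eq_Rintegral => y _.
  by rewrite -IHl//; exact: uc_supp_slice.
- move=> f e fC fe /=.
  have [cf f0] := slc _ fC.
  rewrite exprS -mulrA; apply: (Rintegral_supp_bound M) => // y.
  by apply: IHb; [exact: uc_supp_slice|move=> v; exact: fe].
- move=> f fC /=.
  have [cf f0] := slc _ fC.
  transitivity (\int[mu]_y (rint m (slice m f y))%:E)%E.
    by apply: eq_integral => y _; rewrite -IHe//; exact: uc_supp_slice.
  rewrite /Rintegral fineK//.
  apply: integrable_fin_num => //.
  exact: (cont_supp_integrable M).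
Unshelve. all: by end_near. Qed.

Lemma rintD m M f g c : 0 < M -> uc_supp m M f -> uc_supp m M g ->
  rint m (fun v => f v + c * g v) = rint m f + c * rint m g.
Proof. by move=> M0; exact: (rint_props m M M0).1. Qed.

Lemma rint_bound m M f e : 0 < M -> uc_supp m M f -> (forall v, `|f v| <= e) ->
  `|rint m f| <= (2 * M) ^+ m * e.
Proof. by move=> M0; exact: (rint_props m M M0).2.1. Qed.

Lemma iint_rint m M f : 0 < M -> uc_supp m M f ->
  iint m (fun v => (f v)%:E) = (rint m f)%:E.
Proof. by move=> M0; exact: (rint_props m M M0).2.2. Qed.

Lemma le_rint m M f g : 0 < M -> uc_supp m M f -> uc_supp m M g ->
  (forall v, f v <= g v) -> rint m f <= rint m g.
Proof.
move=> M0 fC gC fg; rewrite -subr_ge0 -mulN1r -(@rintD m M)//.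
by apply: rint_ge0 => v; rewrite mulN1r subr_ge0.
Qed.

(* Differentiation under the integral sign followed by the fundamental theorem
   of calculus in the k-th variable, which avoids exchanging integrals. *)
Lemma rint_deriv0 m M k f g : 0 < M -> (k < m)%N ->
  uc_supp m M f -> uc_supp m M g ->
  (forall v y, is_derive y 1 (fun s => f (upd v k s)) (g (upd v k y))) ->
  rint m g = 0.
Proof.
move=> M0; elim: m f g => [//|m IH] f g.
rewrite ltnS leq_eqVlt => /predU1P[->|km] fC gC dfg /=; last first.
  rewrite (_ : (fun y => _) = fun=> 0); first by rewrite /Rintegral integral0.
  apply/funext => y; apply: (IH (slice m f y)) => //; try exact: uc_supp_slice.
  move=> v z; have := dfg (upd v m y) z.
  have E (s : R) : upd (upd v m y) k s = upd (upd v k s) m y.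
    apply/funext => i; rewrite /upd; case: (eqVneq i k) => // ->.
    by rewrite ltn_eqF.
  by rewrite /slice (_ : (fun s => _) = (fun s => f (upd (upd v k s) m y)));
    [rewrite E|apply/funext => s; rewrite E].
have K0 : 0 < (2 * M) ^+ m by apply: exprn_gt0; lra.
have zero (h : (nat -> R) -> R) : uc_supp m.+1 M h ->
    forall y, M < `|y| -> rint m (slice m h y) = 0.
  move=> hC y yM; rewrite -[RHS](rint0 m); congr rint; apply/funext => v.
  by apply: (hC.1); exists m => //; rewrite upd_eq.
have contg : continuous (fun y => rint m (slice m g y)).
  move=> y; apply/cvgrPdist_lt => e e0.
  have [d d0 fd] := gC.2 (e / 2 / (2 * M) ^+ m) ltac:(by rewrite !divr_gt0).
  near=> z.
  have -> : rint m (slice m g y) - rint m (slice m g z) =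
      rint m (fun v => slice m g y v + (-1) * slice m g z v).
    by rewrite (@rintD _ M) ?mulN1r//; exact: uc_supp_slice.
  apply: (@le_lt_trans _ _ (e / 2)); last lra.
  rewrite -[leRHS](divfK (lt0r_neq0 K0)) mulrC.
  apply: (rint_bound _ M) => //.
    by apply: uc_suppD; exact: uc_supp_slice.
  move=> v; rewrite mulN1r; apply/ltW/fd => i.
  rewrite ltnS leq_eqVlt => /predU1P[->|im]; last first.
    by rewrite !upd_neq// subrr normr0.
  rewrite !upd_eq; near: z.
  by apply/nbhs_ballP; exists d => //= z; rewrite /ball/=.
apply: (@Rintegral_deriv0 M _ _ _ _ (fun y => rint m (slice m f y))) => //;
  try exact: zero.
move=> y.
have cvD : h^-1 *: (rint m (slice m f (h *: 1 + y)) - rint m (slice m f y))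
    @[h --> 0^'] --> rint m (slice m g y).
  apply/cvgrPdist_lt => e e0.
  have [d d0 gd] := gC.2 (e / 2 / (2 * M) ^+ m) ltac:(by rewrite !divr_gt0).
  near=> h.
  have h0 : h != 0 by near: h; exact: nbhs_dnbhs_neq.
  have -> : rint m (slice m g y) -
      h^-1 *: (rint m (slice m f (h *: 1 + y)) - rint m (slice m f y)) =
      rint m (fun v => slice m g y v + (- h^-1) *
        (slice m f (h *: 1 + y) v + (-1) * slice m f y v)).
    rewrite !(@rintD _ M) ?mulN1r ?mulNr//; try exact: uc_supp_slice.
    by apply: uc_suppD; exact: uc_supp_slice.
  apply: (@le_lt_trans _ _ (e / 2)); last lra.
  rewrite -[leRHS](divfK (lt0r_neq0 K0)) mulrC.
  apply: (rint_bound _ M) => //.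
    by do 2 (apply: uc_suppD; try exact: uc_supp_slice).
  move=> v; rewrite mulN1r mulNr /slice.
  (* The difference quotient is the value of [g] at a point within [|h|] of [y], so uniform
     continuity of [g] makes the convergence uniform in the remaining variables. *)
  have [c cy ->] := MVT_dist _ _ (dfg v) y (h *: 1 + y).
  have -> : h *: 1 = h by rewrite /GRing.scale/= mulr1.
  rewrite addrK [_ * h]mulrC mulKf//.
  apply/ltW/gd => i.
  rewrite ltnS leq_eqVlt => /predU1P[->|im]; last first.
    by rewrite !upd_neq// subrr normr0.
  rewrite !upd_eq distrC; apply: le_lt_trans cy _.
  rewrite addrK /GRing.scale/= mulr1; near: h.
  by apply: dnbhs0_lt.
apply: DeriveDef; last exact/cvg_lim.
by apply/cvg_ex; exists (rint m (slice m g y)).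
Unshelve. all: by end_near. Qed.

End IteratedIntegral.

(** * Integrals of continuous compactly supported functions on the group *)

Section PointFunctions.
Context {R : realType} {n : nat}.
Notation pt := (@pt R n).
Notation N := (n.*2.+1).
Implicit Types (f g : pt -> R) (M c : R) (x : pt).

Definition mkpt (v : nat -> R) : pt := \row_(i < N) v i.

Definition cont_supp M f :=
  continuous f /\ forall x, (exists i, M < `|x ord0 i|) -> f x = 0.

Lemma normr_coord x (i : 'I_N) : `|x ord0 i| <= `|x|.
Proof.
rewrite [leRHS]/Num.Def.normr/= mx_normrE.
exact: (le_bigmax _ (fun k : 'I_1 * 'I_N => `|x k.1 k.2|) (ord0, i)).
Qed.

Lemma normr_lt_coord x (e : R) : 0 < e -> (forall i, `|x ord0 i| < e) -> `|x| < e.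
Proof.
move=> e0 xe; rewrite /Num.Def.normr/= mx_normrE.
by apply/bigmax_ltP; split => // -[i j] _ /=; rewrite ord1.
Qed.

Lemma compact_box M : compact [set x : pt | forall i, `|x ord0 i| <= M].
Proof.
have := @rV_compact R N (fun=> `[- M, M]%classic) (fun=> @segment_compact _ _ _).
congr compact; apply/seteqP; split=> x /= H i; have := H i;
  by rewrite in_itv/= ler_norml.
Qed.

Lemma cont_supp_uc M f : cont_supp M f -> uc_supp N M (fun v => f (mkpt v)).
Proof.
move=> [cf f0]; split.
  move=> v [i iN Mv]; apply: f0; exists (Ordinal iN).
  by rewrite mxE.
move=> e e0.
(* The margin 1 serves the case of a point outside [K]: any point within distance 1 of it is still
   outside the support, and both values are 0. *)
pose K := [set x : pt | forall i, `|x ord0 i| <= M + 1].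
have cK : compact K by exact: compact_box.
(* Compactness in its near-covering form turns the radii of continuity at the points of [K] into a
   single one. *)
have := (compact_near_coveringP K).1 cK R (0^'+)
  (fun d x => forall y, `|x - y| < d -> `|f x - f y| < e) _.
case=> [x Kx|d d0 Hd].
  have : \forall y \near x, `|f x - f y| < e / 2.
    have := cf x; move/cvgrPdist_lt; apply; lra.
  case/nbhs_ballP => r /= r0 Hr.
  exists (ball x (r / 2), [set d | d < r / 2]).
    split; first by apply: nbhsx_ballx; lra.
    by apply: nbhs_right_lt; lra.
  move=> [x' d] [/= xx' dr] y yd.
  have xr : ball x r x'.
    by apply: le_ball xx'; lra.
  have yr : ball x r y.
    rewrite -ball_normE/= (_ : x - y = (x - x') + (x' - y)).
      apply: le_lt_trans (ler_normD _ _) _.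
      by move: xx'; rewrite -ball_normE/=; lra.
    by rewrite addrA subrK.
  have A := Hr _ xr; have B := Hr _ yr.
  have -> : f x' - f y = - (f x - f x') + (f x - f y) by ring.
  apply: le_lt_trans (ler_normD _ _) _; rewrite normrN.
  by rewrite (splitr e); exact: ltrD.
move: Hd => /=.
set d1 := Num.min (d / 2) 1 => Hd.
have d10 : 0 < d1 by rewrite lt_min ltr01 andbT; rewrite /= in d0; lra.
exists d1 => // v w vw.
have vwd : `|mkpt v - mkpt w| < d1.
  by apply: normr_lt_coord => // i; rewrite !mxE; exact: vw.
have [Kv|] := pselect (K (mkpt v)).
  apply: (Hd d1) => //=; rewrite sub0r normrN gtr0_norm// gt_min.
  by apply/orP; left; rewrite /= in d0; lra.
move=> /existsNP[i /negP]; rewrite -ltNge => Mv.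
rewrite !f0 ?subrr ?normr0//; exists i; last by apply: lt_trans Mv; lra.
have : `|mkpt v ord0 i - mkpt w ord0 i| < 1.
  rewrite !mxE; apply: lt_le_trans (vw _ (ltn_ord i)) _.
  by rewrite ge_min lexx orbT.
have := ler_normD (mkpt v ord0 i - mkpt w ord0 i) (mkpt w ord0 i).
rewrite subrK; lra.
Qed.

Definition intH f : R := rint N (fun v => f (mkpt v)).

Lemma integral_HE M f : 0 < M -> cont_supp M f ->
  integral_H (fun x => (f x)%:E) = (intH f)%:E.
Proof. by move=> M0 /cont_supp_uc; exact: iint_rint. Qed.

Lemma intHD M f g c : 0 < M -> cont_supp M f -> cont_supp M g ->
  intH (fun x => f x + c * g x) = intH f + c * intH g.
Proof.
by move=> M0 /cont_supp_uc fC /cont_supp_uc gC; exact: (rintD N M).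
Qed.

Lemma le_intH M f g : 0 < M -> cont_supp M f -> cont_supp M g ->
  (forall x, f x <= g x) -> intH f <= intH g.
Proof.
move=> M0 /cont_supp_uc fC /cont_supp_uc gC fg.
by apply: (le_rint N M) => //.
Qed.

Lemma mkpt_upd v (k : 'I_N) s :
  mkpt (upd v k s) = s *: delta_mx 0 k + mkpt (upd v k 0).
Proof.
apply/rowP => i; rewrite !mxE /upd eqxx/=.
case: (eqVneq i k) => [->|ik]; first by rewrite eqxx mulr1 addr0.
rewrite mulr0 add0r; case: eqP => // /val_inj ik'.
by rewrite ik' eqxx in ik.
Qed.

Lemma is_derive_upd (G g : pt -> R) (k : 'I_N) :
  (forall x, is_derive x (delta_mx 0 k) G (g x)) ->
  forall v (y : R), is_derive y 1 (fun s => G (mkpt (upd v k s))) (g (mkpt (upd v k y))).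
Proof.
move=> dG v y; have [dG1 dG2] := dG (mkpt (upd v k y)).
have E : (fun h : R => h^-1 *: (G (h *: delta_mx 0 k + mkpt (upd v k y)) -
       G (mkpt (upd v k y)))) =
    (fun h : R => h^-1 *: ((fun s => G (mkpt (upd v k s))) (h *: 1 + y) -
       (fun s : R => G (mkpt (upd v k s))) y)).
  apply/funext => h; rewrite {1}mkpt_upd (mkpt_upd v k (h *: 1 + y)).
  by rewrite scalerDl addrA /GRing.scale/= mulr1.
by split; move: dG1 dG2; rewrite /derivable /derive E.
Qed.

Lemma intH_deriv0 M (k : 'I_N) (G g : pt -> R) : 0 < M ->
  cont_supp M G -> cont_supp M g ->
  (forall x, is_derive x (delta_mx 0 k) G (g x)) -> intH g = 0.
Proof.
move=> M0 /cont_supp_uc GC /cont_supp_uc gC dG.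
apply: (rint_deriv0 N M k _ _ M0 (ltn_ord k) GC gC) => v y.
exact: (is_derive_upd _ _ _ dG).
Qed.

Lemma cont_suppD M f g c : cont_supp M f -> cont_supp M g ->
  cont_supp M (fun x => f x + c * g x).
Proof.
move=> [cf f0] [cg g0]; split; last by move=> x xM; rewrite f0// g0// mulr0 addr0.
move=> x; apply: (@continuousD _ _ _ f (fun x => c * g x)); first exact: cf.
by apply: (@continuousM _ _ (fun=> c) g); [exact: cst_continuous|exact: cg].
Qed.

Lemma cont_supp0 M : cont_supp M (fun=> 0).
Proof. by split=> // x; exact: cst_continuous. Qed.

Lemma cont_supp_sum M (I : Type) (s : seq I) (F : I -> pt -> R) :
  (forall i, cont_supp M (F i)) -> cont_supp M (fun x => \sum_(i <- s) F i x).
Proof.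
move=> CF; elim: s => [|i s IH].
  rewrite (_ : (fun=> _) = fun=> 0); first exact: cont_supp0.
  by apply/funext => x; rewrite big_nil.
rewrite (_ : (fun=> _) = fun x => F i x + 1 * \sum_(j <- s) F j x).
  exact: cont_suppD.
by apply/funext => x; rewrite big_cons mul1r.
Qed.

Lemma intH_sum0 M (I : Type) (s : seq I) (F : I -> pt -> R) : 0 < M ->
  (forall i, cont_supp M (F i)) -> (forall i, intH (F i) = 0) ->
  intH (fun x => \sum_(i <- s) F i x) = 0.
Proof.
move=> M0 CF F0; elim: s => [|i s IH].
  rewrite (_ : (fun=> _) = fun=> 0); first exact: rint0.
  by apply/funext => x; rewrite big_nil.
rewrite (_ : (fun=> _) = fun x => F i x + 1 * \sum_(j <- s) F j x).
  by rewrite (intHD M)// ?F0 ?IH ?mul1r ?addr0//; exact: cont_supp_sum.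
by apply/funext => x; rewrite big_cons mul1r.
Qed.

End PointFunctions.

(** * Calculus *)

Section Calculus.
Context {R : realType}.

Lemma is_derive_line {V : normedModType R} (G : V -> R) (x e : V) (g : R) :
  is_derive x e G g <-> @is_derive R R R 0 1 (fun s : R => G (s *: e + x)) g.
Proof.
have E : (fun h : R => h^-1 *: (G (h *: e + x) - G x)) =
    (fun h : R => h^-1 *: ((fun s => G (s *: e + x)) (h *: 1 + 0) -
       (fun s : R => G (s *: e + x)) 0)).
  apply/funext => h; rewrite scale0r add0r addr0.
  by rewrite /GRing.scale/= mulr1.
by split=> -[dG Gg]; split; move: dG Gg; rewrite /derivable /derive E.
Qed.


Section Rules.
Context {V : normedModType R}.
Implicit Types (f g : V -> R) (x v : V).

Lemma dcst (c : R) x v : is_derive x v (fun=> c) 0.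
Proof. exact: is_derive_cst. Qed.

(** The rules take the derivative [l] together with an equation, so that the goal dictates its form
    and the equation is left to [ring] or [field]. *)
Lemma dD {f g x v} {df dg l : R} : is_derive x v f df -> is_derive x v g dg ->
  l = df + dg -> is_derive x v (fun x => f x + g x) l.
Proof. by move=> ? ? ->; exact: is_deriveD. Qed.

Lemma dB {f g x v} {df dg l : R} : is_derive x v f df -> is_derive x v g dg ->
  l = df - dg -> is_derive x v (fun x => f x - g x) l.
Proof. by move=> ? ? ->; exact: is_deriveB. Qed.

Lemma dN {f x v} {df l : R} : is_derive x v f df ->
  l = - df -> is_derive x v (fun x => - f x) l.
Proof. by move=> ? ->; exact: is_deriveN. Qed.

Lemma dM {f g x v} {df dg l : R} : is_derive x v f df -> is_derive x v g dg ->
  l = df * g x + f x * dg -> is_derive x v (fun x => f x * g x) l.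
Proof.
move=> df1 dg1 ->; have H : is_derive x v (f * g) _ := is_deriveM df1 dg1.
apply: (is_derive_eq H).
by rewrite /GRing.scale/= addrC [df * _]mulrC.
Qed.

(** Restriction to the line through [x] in direction [v] reduces this to the one-variable chain
    rule; a directional derivative of [g] suffices. *)
Lemma dcomp {F : R -> R} {g x v} {dF dg l : R} :
  is_derive x v g dg -> is_derive (g x) 1 F dF ->
  l = dF * dg -> is_derive x v (fun x => F (g x)) l.
Proof.
move=> /is_derive_line dg1 dF1 ->; apply/is_derive_line.
apply: (@is_derive1_comp _ F (fun s : R => g (s *: v + x))) => //.
by rewrite scale0r add0r.
Qed.

Lemma dV {g x v} {dg l : R} : g x != 0 -> is_derive x v g dg ->
  l = - dg / (g x) ^+ 2 -> is_derive x v (fun x => (g x)^-1) l.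
Proof.
move=> g0 dg1 ->; apply: (dcomp dg1).
  apply: (@is_deriveV _ id (g x) 1 1) => //; exact: is_derive_id.
by rewrite /GRing.scale/= mulr1 mulNr mulrC mulNr.
Qed.

Lemma dX {f x v} {df l : R} (k : nat) : is_derive x v f df ->
  l = k.+1%:R * (f x) ^+ k * df -> is_derive x v (fun x => (f x) ^+ k.+1) l.
Proof.
move=> df1 ->; have H : is_derive x v (f ^+ k.+1) _ := is_deriveX k.+1 df1.
rewrite (_ : (fun x => _) = f ^+ k.+1); first exact: (is_derive_eq H).
by apply/funext => y; rewrite exprfctE.
Qed.

Lemma dsum (k : nat) (f : 'I_k -> V -> R) x v (df : 'I_k -> R) :
  (forall i, is_derive x v (f i) (df i)) ->
  is_derive x v (fun y => \sum_(i < k) f i y) (\sum_(i < k) df i).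
Proof.
move=> dfi; rewrite (_ : (fun y => _) = \sum_(i < k) f i).
  exact: is_derive_sum.
by apply/funext => y; rewrite fct_sumE.
Qed.

End Rules.

Lemma dpow (q x l : R) : 0 < x -> l = q * x `^ (q - 1) ->
  is_derive x 1 (fun s : R => s `^ q) l.
Proof. by move=> x0 ->; exact: is_derive1_powR. Qed.

Section Cont.
Context {T : topologicalType}.
Implicit Types f g : T -> R.

Lemma ccst (c : R) : continuous (fun _ : T => c).
Proof. exact: cst_continuous. Qed.

Lemma cD {f g} : continuous f -> continuous g -> continuous (fun x => f x + g x).
Proof. by move=> cf cg x; apply: (@continuousD _ _ _ f g); [exact: cf|exact: cg]. Qed.

Lemma cB {f g} : continuous f -> continuous g -> continuous (fun x => f x - g x).
Proof. by move=> cf cg x; apply: (@continuousB _ _ _ f g); [exact: cf|exact: cg]. Qed.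

Lemma cM {f g} : continuous f -> continuous g -> continuous (fun x => f x * g x).
Proof. by move=> cf cg x; apply: (@continuousM _ _ f g); [exact: cf|exact: cg]. Qed.

Lemma cV {f} : continuous f -> (forall x, f x != 0) -> continuous (fun x => (f x)^-1).
Proof. by move=> cf f0 x; apply: (@continuousV _ _ f) => //; exact: cf. Qed.

Lemma cX {f} k : continuous f -> continuous (fun x => (f x) ^+ k).
Proof.
move=> cf; elim: k => [|k IH]; first exact: ccst.
rewrite (_ : (fun x => _) = fun x => f x * f x ^+ k); first exact: cM.
by apply/funext => x; rewrite exprS.
Qed.

Lemma ccomp {F : R -> R} {f} : continuous f -> continuous F ->
  continuous (fun x => F (f x)).
Proof. by move=> cf cF x; apply: (@continuous_comp _ _ _ f F); [exact: cf|exact: cF]. Qed.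

Lemma csum (k : nat) (f : 'I_k -> T -> R) : (forall i, continuous (f i)) ->
  continuous (fun x => \sum_(i < k) f i x).
Proof.
move=> cf; elim: k f cf => [|k IH] f cf.
  rewrite (_ : (fun=> _) = fun=> 0); first exact: ccst.
  by apply/funext => x; rewrite big_ord0.
rewrite (_ : (fun=> _) = fun x => \sum_(i < k) f (widen_ord (leqnSn k) i) x + f ord_max x).
  by apply: cD => //; exact: IH.
by apply/funext => x; rewrite big_ord_recr.
Qed.

End Cont.

Lemma derive_cont (f df : R -> R) : (forall x : R, is_derive x 1 f (df x)) ->
  continuous f.
Proof.
move=> dfx x; apply/differentiable_continuous/derivable1_diffP.
exact: ex_derive.
Qed.

Lemma derive_cont1 (f : R -> R) (x l : R) : is_derive x 1 f l ->
  {for x, continuous f}.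
Proof.
move=> dfx; apply/differentiable_continuous/derivable1_diffP.
exact: ex_derive.
Qed.

Lemma cpow {T : topologicalType} (f : T -> R) (q : R) : continuous f ->
  (forall x, 0 < f x) -> continuous (fun x => f x `^ q).
Proof.
move=> cf f0 x; apply: (@continuous_comp _ _ _ f (fun s => s `^ q)); first exact: cf.
by apply: derive_cont1; exact: dpow.
Qed.

Lemma cont_powR_norm (q : R) : 0 < q -> continuous (fun s : R => `|s| `^ q).
Proof.
move=> q0 s; have [->|s0] := eqVneq s 0.
  apply/cvgrPdist_lt => e e0; near=> t.
  rewrite normr0 powR0 ?gt_eqF// sub0r normrN ger0_norm ?powR_ge0//.
  rewrite -[ltRHS](powRr1 (ltW e0)) -(mulVf (lt0r_neq0 q0)) powRrM.
  apply: gt0_ltr_powR => //; rewrite ?nnegrE ?powR_ge0//.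
  near: t; have e1 : 0 < e `^ q^-1 by exact: powR_gt0.
  by apply/nbhs_ballP; exists (e `^ q^-1) => //= t; rewrite /ball/= sub0r normrN.
have := @continuous_comp R R R (fun t : R => `|t|) (fun t : R => t `^ q) s; apply.
  exact: norm_continuous.
by apply: derive_cont1; apply: dpow; rewrite ?normr_gt0.
Unshelve. all: by end_near. Qed.

Lemma powR_pred (p x : R) : 0 < x -> x `^ (p - 1) = x `^ (p - 2) * x.
Proof.
move=> x0; have -> : p - 1 = p - 2 + 1 by ring.
rewrite powRD ?powRr1 ?(ltW x0)//; apply/implyP => _; exact: lt0r_neq0.
Qed.

(** Away from 0 this is the power rule on a half-line. At 0 the difference quotient has modulus
    [|h|^(p - 1)], which tends to 0 because [p > 1]. *)
Lemma derive_powR_norm (p s : R) : 1 < p ->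
  is_derive s 1 (fun s : R => `|s| `^ p) (p * (`|s| `^ (p - 2) * s)).
Proof.
move=> p1; have [s0|s0|->] := ltgtP s 0.
- have E : \forall t \near s, (- t) `^ p = `|t| `^ p.
    near=> t; have t0 : t < 0 by near: t; exact: lt_nbhsl.
    by rewrite ltr0_norm.
  apply: (near_eq_is_derive E).
  + apply: (dcomp (F := fun t => t `^ p) (g := fun t : R => - t) (dg := -1)).
    * by apply: dpow => //; rewrite oppr_gt0.
    * by rewrite ltr0_norm// powR_pred ?oppr_gt0//; ring.
- have E : \forall t \near s, t `^ p = `|t| `^ p.
    near=> t; have t0 : 0 < t by near: t; exact: lt_nbhsr.
    by rewrite gtr0_norm.
  apply: (near_eq_is_derive E).
  + apply: dpow => //; rewrite gtr0_norm//.
    by rewrite powR_pred.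
- have p10 : 0 < p - 1 by rewrite subr_gt0.
  have cvD : h^-1 *: (`|h *: 1 + 0 : R| `^ p - `|0 : R| `^ p) @[h --> 0^'] --> (0 : R).
    apply/cvgrPdist_lt => e e0.
    have := cont_powR_norm (p - 1) p10 0; move/cvgrPdist_lt => /(_ e e0).
    rewrite normr0 powR0 ?gt_eqF// => H.
    near=> h.
    have h0 : h != 0 by near: h; exact: nbhs_dnbhs_neq.
    rewrite addr0 powR0 ?gt_eqF//; last by lra.
    rewrite subr0 sub0r normrN.
    have -> : h *: 1 = h by rewrite /GRing.scale/= mulr1.
    rewrite /GRing.scale/= normrM normfV.
    have -> : `|h|^-1 * `| `|h| `^ p| = `|h| `^ (p - 1).
      rewrite [X in _ * X]ger0_norm ?powR_ge0// powRB; last by apply/implyP => _; rewrite normr_eq0.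
      by rewrite powRr1// mulrC.
    have : `|0 - `|h| `^ (p - 1)| < e by near: h; exact: nbhs_dnbhs.
    by rewrite sub0r normrN [X in X < _]ger0_norm ?powR_ge0.
  rewrite mulr0 mulr0.
  apply: DeriveDef; last exact/cvg_lim.
  by apply/cvg_ex; exists 0.
Unshelve. all: by end_near. Qed.

Lemma cont_powR_sgn (p : R) : 1 < p ->
  continuous (fun s : R => `|s| `^ (p - 2) * s).
Proof.
move=> p1 s; have [->|s0] := eqVneq s 0.
  rewrite /continuous_at mulr0.
  have p10 : 0 < p - 1 by rewrite subr_gt0.
  apply/cvgrPdist_lt => e e0.
  have := cont_powR_norm (p - 1) p10 0; move/cvgrPdist_lt => /(_ e e0).
  rewrite normr0 powR0 ?gt_eqF// => H.
  near=> t; rewrite sub0r normrN normrM ger0_norm ?powR_ge0//.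
  have [->|t0] := eqVneq t 0; first by rewrite normr0 mulr0.
  rewrite -powR_pred ?normr_gt0//.
  have : `|0 - `|t| `^ (p - 1)| < e by near: t.
  by rewrite sub0r normrN [X in X < _]ger0_norm ?powR_ge0.
apply: (@continuousM _ _ (fun t : R => `|t| `^ (p - 2)) id); last exact: cvg_id.
have := @continuous_comp R R R (fun t : R => `|t|) (fun t : R => t `^ (p - 2)) s; apply.
  exact: norm_continuous.
by apply: derive_cont1; apply: dpow; rewrite ?normr_gt0.
Unshelve. all: by end_near. Qed.

(** Young's inequality for the exponents [p / (p - 1)] and [p], with a free weight [L] that gives
    equality at [Y = L X]. The best [L] is chosen in [hardy_const_ge_field]. *)
Lemma young_powR (p L X Y : R) : 1 < p -> 0 < L -> 0 <= X -> 0 <= Y ->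
  p * X `^ (p - 1) * Y <= (p - 1) * L * X `^ p + L `^ (1 - p) * Y `^ p.
Proof.
move=> p1 L0 X0 Y0.
have p0 : 0 < p by lra.
have q0 : 0 < p - 1 by lra.
have p00 : p != 0 by rewrite gt_eqF.
have q00 : p - 1 != 0 by rewrite gt_eqF.
have := @conjugate_powR R (L `^ ((p - 1) / p) * X `^ (p - 1))
  (L `^ (- ((p - 1) / p)) * Y) (p / (p - 1)) p.
have -> : (p / (p - 1))^-1 + p^-1 = 1 by field; rewrite p00 q00.
move=> /(_ _ _ _ p0 erefl).
rewrite !mulr_ge0 ?powR_ge0// divr_gt0// => /(_ isT isT isT).
rewrite mulrACA -powRD ?subrr ?powRr0 ?mul1r; last by apply/implyP => _; exact: lt0r_neq0.
rewrite !powRM ?powR_ge0// -!powRrM.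
have -> : (p - 1) / p * (p / (p - 1)) = 1 by field; rewrite p00 q00.
have -> : (p - 1) * (p / (p - 1)) = p by field; rewrite q00.
have -> : - ((p - 1) / p) * p = 1 - p by field; rewrite p00.
rewrite (powRr1 (ltW L0)) => H.
have := ler_wpM2l (ltW p0) H.
rewrite mulrA; move=> /le_trans; apply.
rewrite le_eqVlt; apply/orP; left; apply/eqP; field.
by rewrite p00 q00.
Qed.

End Calculus.

(** * The Hardy inequality for radial weights *)

Section Fields.
Context {R : realType} {n : nat}.
Notation pt := (@pt R n).
Notation N := (n.*2.+1).
Notation coord := (@Defs.coord R n).
Implicit Types (x : pt) (j : nat).

(** The components of [Jz], the rotation of [z] by a right angle in each coordinate plane:
    orthogonal to [z], of the same length, and such that [X_j] is [d_j] plus twice [zperp x j] times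
    [d_t]. *)
Definition zperp x j : R := tcoef x j / 2.

Lemma tcoefE x j : tcoef x j = 2 * zperp x j.
Proof. by rewrite /zperp mulrC divfK. Qed.

Lemma big_double (F : nat -> R) :
  \sum_(j < n.*2) F j = \sum_(i < n) (F i.*2 + F i.*2.+1).
Proof.
elim: n => [|k IH]; first by rewrite !big_ord0.
by rewrite doubleS !big_ord_recr/= IH addrA.
Qed.

Lemma sum_coord_zperp x : \sum_(j < n.*2) coord x j * zperp x j = 0.
Proof.
rewrite (big_double (fun j => coord x j * zperp x j)) big1// => i _.
by rewrite /zperp /tcoef /= odd_double /=; field.
Qed.

Lemma sum_zperp2 x : \sum_(j < n.*2) zperp x j ^+ 2 = zsq x.
Proof.
rewrite /zsq (big_double (fun j => zperp x j ^+ 2)).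
rewrite (big_double (fun j => coord x j ^+ 2)); apply: eq_bigr => i _.
by rewrite /zperp /tcoef /= odd_double /=; field.
Qed.

Lemma d_entry x (i k : 'I_N) :
  is_derive x (delta_mx 0 k) (fun y : pt => y ord0 i) (i == k)%:R.
Proof.
apply/is_derive_line.
rewrite (_ : (fun s => _) = fun s : R => s * (i == k)%:R + x ord0 i); last first.
  by apply/funext => s; rewrite !mxE eqxx.
apply: (dD (df := (i == k)%:R) (dg := 0)); last by rewrite addr0.
apply: (dM (df := 1) (dg := 0)); last by rewrite mul1r mulr0 addr0.
Qed.

Lemma inord_eq j (k : nat) : (j < N)%N -> (k < N)%N ->
  ((inord j : 'I_N) == inord k) = (j == k).
Proof. by move=> jN kN; rewrite -val_eqE/= !inordK. Qed.

Lemma ltN j : (j < n.*2)%N -> (j < N)%N.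
Proof. by move=> /ltnW. Qed.

Lemma inord_max j : (j < n.*2)%N -> (inord j == ord_max :> 'I_N) = false.
Proof. by move=> jn; rewrite -val_eqE/= inordK ?ltn_eqF// ltN. Qed.

Lemma d_coord x j k : (j < n.*2)%N -> (k < n.*2)%N ->
  is_derive x (delta_mx 0 (inord k)) (fun y : pt => coord y j) (j == k)%:R.
Proof. by move=> jn kn; have := d_entry x (inord j) (inord k); rewrite inord_eq ?ltN. Qed.

Lemma d_coord_t x j : (j < n.*2)%N ->
  is_derive x (delta_mx 0 ord_max) (fun y : pt => coord y j) 0.
Proof. by move=> jn; have := d_entry x (inord j) ord_max; rewrite inord_max. Qed.

Lemma d_tcoord x j : (j < n.*2)%N ->
  is_derive x (delta_mx 0 (inord j)) (@tcoord R n) 0.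
Proof. by move=> jn; have := d_entry x ord_max (inord j); rewrite eq_sym inord_max. Qed.

Lemma d_tcoord_t x : is_derive x (delta_mx 0 ord_max) (@tcoord R n) 1.
Proof. by have := d_entry x ord_max ord_max; rewrite eqxx. Qed.

Lemma d_zsq x j : (j < n.*2)%N ->
  is_derive x (delta_mx 0 (inord j)) (@zsq R n) (2 * coord x j).
Proof.
move=> jn.
have -> : 2 * coord x j = \sum_(i < n.*2) 2 * coord x i ^+ 1 * ((i : nat) == j)%:R.
  rewrite (bigD1 (Ordinal jn))//= eqxx mulr1 expr1 big1 ?addr0// => i ij.
  by rewrite -val_eqE/= in ij; rewrite (negbTE ij) mulr0.
apply: dsum => i; apply: dX; last reflexivity.
exact: d_coord.
Qed.

Lemma d_zsq_t x : is_derive x (delta_mx 0 ord_max) (@zsq R n) 0.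
Proof.
have -> : 0 = \sum_(i < n.*2) 2 * coord x i ^+ 1 * (0 : R).
  by rewrite big1// => i _; rewrite mulr0.
apply: dsum => i; apply: dX; last reflexivity.
exact: d_coord_t.
Qed.

Lemma d_zperp x j : (j < n.*2)%N ->
  is_derive x (delta_mx 0 (inord j)) (fun y : pt => zperp y j) 0.
Proof.
move=> jn; rewrite /zperp /tcoef; case: (boolP (odd j)) => jo.
  have j0 : (0 < j)%N by case: (j) jo.
  apply: (dM (df := 0) (dg := 0)); last by rewrite mul0r mulr0 addr0.
  apply: (dN (df := 0)); last by rewrite oppr0.
  apply: (dM (df := 0) (dg := 0)); last by rewrite mul0r mulr0 addr0.
  have jj : (j.-1 == j) = false by rewrite ltn_eqF// prednK.
  by have := d_coord x j.-1 j; rewrite jj; apply => //; case: (j) jn => // k /ltnW.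
have j1 : (j.+1 < n.*2)%N.
  rewrite ltn_neqAle jn andbT; apply/eqP => E.
  by have := odd_double n; rewrite -E/= jo.
apply: (dM (df := 0) (dg := 0)); last by rewrite mul0r mulr0 addr0.
apply: (dM (df := 0) (dg := 0)); last by rewrite mul0r mulr0 addr0.
by have := d_coord x j.+1 j j1 jn; rewrite gtn_eqF.
Qed.

Lemma cont_coord j : continuous (fun y : pt => coord y j).
Proof. exact: coord_continuous. Qed.

Lemma cont_tcoord : continuous (@tcoord R n).
Proof. exact: coord_continuous. Qed.

Lemma cont_zsq : continuous (@zsq R n).
Proof. by apply: csum => i; apply: cX; exact: cont_coord. Qed.

Lemma cont_tcoef j : continuous (fun x : pt => tcoef x j).
Proof.
rewrite /tcoef; case: (odd j) => x.
  apply: (@continuousN _ _ _ (fun x : pt => 2 * coord x j.-1)).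
  by apply: cM; [exact: ccst|exact: cont_coord].
by apply: cM; [exact: ccst|exact: cont_coord].
Qed.

Lemma zsq_ge0 x : 0 <= zsq x.
Proof. by apply: sumr_ge0 => i _; exact: sqr_ge0. Qed.

Lemma cauchy_schwarz (I : Type) (s : seq I) (a b : I -> R) :
  (\sum_(i <- s) a i * b i) ^+ 2 <= (\sum_(i <- s) a i ^+ 2) * (\sum_(i <- s) b i ^+ 2).
Proof.
elim: s => [|i s IH]; first by rewrite !big_nil mul0r expr0n.
rewrite !big_cons.
set T := \sum_(j <- s) _ in IH *; set S := \sum_(j <- s) a j ^+ 2 in IH *.
set U := \sum_(j <- s) b j ^+ 2 in IH *.
have S0 : 0 <= S by apply: sumr_ge0 => j _; exact: sqr_ge0.
have U0 : 0 <= U by apply: sumr_ge0 => j _; exact: sqr_ge0.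
have H : 2 * (a i * b i) * T <= a i ^+ 2 * U + b i ^+ 2 * S.
  apply: le_trans (ler_norm _) _.
  have P1 : 0 <= a i ^+ 2 * U by apply: mulr_ge0 => //; exact: sqr_ge0.
  have P2 : 0 <= b i ^+ 2 * S by apply: mulr_ge0 => //; exact: sqr_ge0.
  rewrite -(@ler_pXn2r _ 2) ?nnegrE ?addr_ge0//.
  rewrite real_normK ?num_real//.
  have A : (2 * (a i * b i) * T) ^+ 2 <= 4 * (a i * b i) ^+ 2 * (S * U).
    rewrite (_ : (_ * T) ^+ 2 = 4 * (a i * b i) ^+ 2 * T ^+ 2); last by ring.
    by apply: ler_wpM2l => //; apply: mulr_ge0 => //; exact: sqr_ge0.
  apply: le_trans A _; rewrite -subr_ge0.
  by rewrite (_ : _ - _ = (a i ^+ 2 * U - b i ^+ 2 * S) ^+ 2) ?sqr_ge0//; ring.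
move: IH H; rewrite -subr_ge0 => IH; rewrite -subr_ge0 => H; rewrite -subr_ge0.
rewrite (_ : _ - _ = (S * U - T ^+ 2) + (a i ^+ 2 * U + b i ^+ 2 * S - 2 * (a i * b i) * T)).
  exact: addr_ge0.
by ring.
Qed.

Lemma powR_predM (q x : R) : 0 < x -> x `^ q = x `^ (q - 1) * x.
Proof.
move=> x0.
have H : (q - 1 + 1 == 0) ==> (x != 0) by apply/implyP => _; exact: lt0r_neq0.
by rewrite -[in LHS](subrK 1 q) (powRD H) (powRr1 (ltW x0)).
Qed.

(* [e > 0] keeps the weight smooth across the centre [z = 0]. *)
Definition radial (e q : R) (F : R -> R) (x : pt) : R :=
  (zsq x + e) `^ q * F (tcoord x / (zsq x + e)).

Lemma zsqD_gt0 x (e : R) : 0 < e -> 0 < zsq x + e.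
Proof. by move=> e0; rewrite ltr_wpDl// zsq_ge0. Qed.

Lemma cont_radial (e q : R) (F : R -> R) : 0 < e -> continuous F ->
  continuous (radial e q F).
Proof.
move=> e0 cF.
have cw : continuous (fun x : pt => zsq x + e) by apply: cD; [exact: cont_zsq|exact: ccst].
apply: cM; first by apply: cpow => // x; exact: zsqD_gt0.
apply: (ccomp (F := F)) => //; apply: cM; first exact: cont_tcoord.
by apply: cV => // x; rewrite gt_eqF// zsqD_gt0.
Qed.

Lemma d_radial (e q : R) (F dF : R -> R) (x v : pt) (dw dt : R) : 0 < e ->
  (forall y : R, is_derive y 1 F (dF y)) ->
  is_derive x v (@zsq R n) dw -> is_derive x v (@tcoord R n) dt ->
  is_derive x v (radial e q F)
    (radial e (q - 1) (fun y => q * F y - y * dF y) x * dw +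
     radial e (q - 1) dF x * dt).
Proof.
move=> e0 dF1 dw1 dt1; have w0 := zsqD_gt0 x e e0.
have d1 : is_derive x v (fun x : pt => zsq x + e) dw.
  by apply: (dD (dg := 0)); rewrite ?addr0.
have wn0 : zsq x + e != 0 by rewrite gt_eqF.
have d2 : is_derive x v (fun x : pt => (zsq x + e)^-1) (- dw / (zsq x + e) ^+ 2).
  exact: dV.
have d3 : is_derive x v (fun x : pt => tcoord x / (zsq x + e))
    (dt * (zsq x + e)^-1 + tcoord x * (- dw / (zsq x + e) ^+ 2)).
  exact: dM.
have d4 := dcomp (F := F) d3 (dF1 _) erefl.
have d5 : is_derive x v (fun x : pt => (zsq x + e) `^ q)
    (q * (zsq x + e) `^ (q - 1) * dw).
  by apply: (dcomp (F := fun s => s `^ q) d1 (dpow q _ _ w0 erefl)).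
apply: (dM d5 d4); rewrite /radial.
rewrite (powR_predM q _ w0); field.
by rewrite wn0.
Qed.
End Fields.

(** * The divergence and the size of the regularised field *)

Section RegularizedHardy.
Context {R : realType} {n : nat}.
Notation pt := (@pt R n).
Notation N := (n.*2.+1).
Notation coord := (@Defs.coord R n).
Notation Q := (@Qdim R n).
Implicit Types (x : pt) (j : nat).

Lemma QdimE : Q - 2 = (n.*2)%:R.
Proof. by rewrite /Qdim -addn2 natrD addrK. Qed.

(** The product rule for the divergence of [f (A z + B Jz)], where [c U] is the gradient of [f]. As
    a Euclidean field [sum_j F_j X_j] has [t]-component [2 B |z|^2], hence the separate last term on
    the left. Orthogonality of [z] and [Jz] removes the [B1] and [c Ut A] terms. *)
Lemma divergence_sum x (U : nat -> R) (Ut A B A1 B1 Bt c f : R) :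
  \sum_(j < n.*2) (c * U j * (A * coord x j + B * zperp x j) +
     f * (A1 * (2 * coord x j) * coord x j + A +
          B1 * (2 * coord x j) * zperp x j)) +
  (c * Ut * (2 * B * zsq x) + f * (2 * zsq x * Bt)) =
  f * ((Q - 2) * A + 2 * zsq x * A1 + 2 * zsq x * Bt) +
  c * \sum_(j < n.*2) (A * coord x j + B * zperp x j) * (U j + tcoef x j * Ut).
Proof.
rewrite mulr_sumr.
have -> : \sum_(j < n.*2) (c * U j * (A * coord x j + B * zperp x j) +
     f * (A1 * (2 * coord x j) * coord x j + A +
          B1 * (2 * coord x j) * zperp x j)) =
  \sum_(j < n.*2) (c * ((A * coord x j + B * zperp x j) * (U j + tcoef x j * Ut))
   + ((f * A + (2 * f * A1) * coord x j ^+ 2) +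
     ((2 * f * B1 - 2 * c * Ut * A) * (coord x j * zperp x j) +
      (- 2 * c * Ut * B) * zperp x j ^+ 2))).
  by apply: eq_bigr => j _; rewrite tcoefE; ring.
rewrite !big_split/= -!mulr_sumr sum_coord_zperp sum_zperp2 -/(zsq x).
rewrite sumr_const card_ord.
have -> : A *+ n.*2 = (Q - 2) * A by rewrite QdimE mulr_natl.
by ring.
Qed.

Lemma sum_field2 x (A B : R) :
  \sum_(j < n.*2) (A * coord x j + B * zperp x j) ^+ 2 = (A ^+ 2 + B ^+ 2) * zsq x.
Proof.
have -> : \sum_(j < n.*2) (A * coord x j + B * zperp x j) ^+ 2 =
   \sum_(j < n.*2) (A ^+ 2 * coord x j ^+ 2 + (2 * A * B * (coord x j * zperp x j) +
    B ^+ 2 * zperp x j ^+ 2)).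
  by apply: eq_bigr => j _; ring.
by rewrite !big_split/= -!mulr_sumr sum_coord_zperp sum_zperp2 -/(zsq x); ring.
Qed.

Lemma radial_powR (e r : R) (h : R -> R) x : 0 < e -> (forall y, 0 < h y) ->
  radial e 2^-1 h x `^ r = radial e (r / 2) (fun y => h y `^ r) x.
Proof.
move=> e0 h0; rewrite /radial powRM ?powR_ge0 ?(ltW (h0 _))//.
by rewrite -powRrM [2^-1 * r]mulrC.
Qed.

Lemma radial_gt0 (e q : R) (h : R -> R) x : 0 < e -> (forall y, 0 < h y) ->
  0 < radial e q h x.
Proof. by move=> e0 h0; rewrite mulr_gt0// powR_gt0// zsqD_gt0. Qed.

Section Pointwise.
Variables (m K e : R) (h al dal be dbe : R -> R).
Hypothesis e0 : 0 < e.
Hypothesis h0 : forall y, 0 < h y.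
Notation om := (radial e 2^-1 h).
Notation q := (- m / 2).

(** The hypothesis is the divergence identity written in the variable [y]. Regularisation replaces
    [|z|^2] by [|z|^2 + e] in the coefficients but not in the factors produced by differentiation;
    the difference is the term in [e]. *)
Lemma divergence_radial x :
  (forall y, - m * al y - 2 * y * dal y + 2 * dbe y =
     (Q - 2) * (Q - m) * h y `^ (- m) - (Q - 2) * al y) ->
  (Q - 2) * radial e q al x
  + 2 * zsq x * radial e (q - 1) (fun y => q * al y - y * dal y) x
  + 2 * zsq x * radial e (q - 1) dbe x =
  (Q - 2) * ((Q - m) * om x `^ (- m) +
    e * radial e (q - 1) (fun y => al y - (Q - m) * h y `^ (- m)) x).
Proof.
move=> id; rewrite radial_powR// /radial.
set w := zsq x + e; have w0 : 0 < w by exact: zsqD_gt0.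
have -> : zsq x = w - e by rewrite /w addrK.
rewrite (powR_predM q w w0).
set y := tcoord x / w; have E := id y.
set W := w `^ (q - 1).
transitivity (W * ((Q - 2) * w * al y + (w - e) *
   (- m * al y - 2 * y * dal y + 2 * dbe y))).
  by field.
by rewrite E; ring.
Qed.

(** One factor [sqrt e] is kept and the other is bounded by [sqrt (|z|^2 + e)], so the error is the
    principal term times a multiple of [sqrt e / om]. *)
Lemma divergence_error x :
  (forall y, `|al y - (Q - m) * h y `^ (- m)| <= `|m| * h y `^ (- m - 1)) ->
  `|e * radial e (q - 1) (fun y => al y - (Q - m) * h y `^ (- m)) x| <=
  `|m| * Num.sqrt e / om x * om x `^ (- m).
Proof.
move=> err; have e0' := e0; rewrite radial_powR// /radial powR12_sqrt; last first.
  by apply/ltW/zsqD_gt0.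
set w := zsq x + e; have w0 : 0 < w by exact: zsqD_gt0.
set y := tcoord x / w.
rewrite (powR_predM q w w0) (powR_predM (- m) (h y) (h0 y)).
set W := w `^ (q - 1); set H := h y `^ (- m - 1).
have W0 : 0 < W by exact: powR_gt0.
have hy := h0 y.
rewrite normrM (gtr0_norm e0) normrM (gtr0_norm W0).
have sw0 : 0 < Num.sqrt w by rewrite sqrtr_gt0.
have -> : `|m| * Num.sqrt e / (Num.sqrt w * h y) * (W * w * (H * h y)) =
    (Num.sqrt e * Num.sqrt w) * (W * (`|m| * H)).
  rewrite -{2}(sqr_sqrtr (ltW w0)); field.
  by rewrite !gt_eqF.
rewrite mulrA; apply: (@le_trans _ _ (e * W * (`|m| * H))).
  by apply: ler_wpM2l; [rewrite mulr_ge0// ltW|rewrite -powR_predM//; exact: err].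
rewrite -mulrA; apply: ler_wpM2r.
  by rewrite !mulr_ge0 ?powR_ge0// ltW.
rewrite -{1}(sqr_sqrtr (ltW e0')) expr2 ler_wpM2l ?sqrtr_ge0//.
by rewrite ler_sqrt ?(ltW w0)// /w lerDr zsq_ge0.
Qed.

Lemma field_bound x : 0 <= K ->
  (forall y, al y ^+ 2 + be y ^+ 2 <= (K * (Q - 2)) ^+ 2 * h y `^ (2 - 2 * m)) ->
  Num.sqrt ((radial e q al x ^+ 2 + radial e q be x ^+ 2) * zsq x) <=
  K * (Q - 2) * om x `^ (1 - m).
Proof.
move=> K0 bd.
have Q2 : 0 <= Q - 2 by rewrite QdimE ler0n.
have rhs0 : 0 <= K * (Q - 2) * om x `^ (1 - m) by rewrite !mulr_ge0 ?powR_ge0.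
rewrite -(ger0_norm rhs0) -sqrtr_sqr ler_sqrt ?sqr_ge0//.
rewrite radial_powR// /radial.
set w := zsq x + e; have w0 : 0 < w by exact: zsqD_gt0.
set y := tcoord x / w.
have e0' := e0.
have zw : zsq x <= w by rewrite /w; lra.
have -> : (w `^ q * al y) ^+ 2 + (w `^ q * be y) ^+ 2 =
    (w `^ q) ^+ 2 * (al y ^+ 2 + be y ^+ 2) by ring.
have -> : (K * (Q - 2) * (w `^ ((1 - m) / 2) * h y `^ (1 - m))) ^+ 2 =
   (w `^ q) ^+ 2 * ((K * (Q - 2)) ^+ 2 * h y `^ (2 - 2 * m)) * w.
  have hh : h y `^ (2 - 2 * m) = (h y `^ (1 - m)) ^+ 2.
    by rewrite -powR_mulrn ?powR_ge0// -powRrM; congr powR; ring.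
  have ww : (w `^ ((1 - m) / 2)) ^+ 2 = (w `^ q) ^+ 2 * w.
    rewrite -!powR_mulrn ?powR_ge0// -!powRrM (powR_predM _ w w0).
    by congr (w `^ _ * w); field.
  by rewrite hh !exprMn ww; ring.
apply: ler_pM => //.
- by rewrite mulr_ge0 ?addr_ge0 ?sqr_ge0.
- exact: zsq_ge0.
- by apply: ler_wpM2l; [exact: sqr_ge0|exact: bd].
Qed.

End Pointwise.
End RegularizedHardy.

(** * The Hardy inequality for regularised weights *)

Section RegularizedHardyIntegral.
Context {R : realType} {n : nat}.
Notation pt := (@pt R n).
Notation N := (n.*2.+1).
Notation coord := (@Defs.coord R n).
Notation Q := (@Qdim R n).
Implicit Types (x : pt) (j : nat).

Lemma cont_hgrad_norm (u : pt -> R) : (forall k, continuous (pd k u)) ->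
  continuous (hgrad_norm u).
Proof.
move=> cpd; apply: (ccomp (F := Num.sqrt)); last exact: sqrt_continuous.
apply: csum => j; apply: cX; apply: cD; first exact: cpd.
by apply: cM; [exact: cont_tcoef|exact: cpd].
Qed.

Lemma hgrad_norm_ge0 (u : pt -> R) x : 0 <= hgrad_norm u x.
Proof. exact: sqrtr_ge0. Qed.

Lemma cont_supp_weight (p r e M : R) (h : R -> R) (u : pt -> R) :
  0 < p -> 0 < e -> (forall y, 0 < h y) -> continuous h -> continuous u ->
  (forall x, (exists i, M < `|x ord0 i|) -> u x = 0) ->
  cont_supp M (fun x => `|u x| `^ p * radial e 2^-1 h x `^ r).
Proof.
move=> p0 e0 h0 ch cu u0; split.
  apply: cM.
    by apply: (ccomp (F := fun s => `|s| `^ p)) => //; exact: cont_powR_norm.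
  by apply: cpow; [exact: cont_radial|move=> x; exact: radial_gt0].
by move=> x /u0 ->; rewrite normr0 powR0 ?mul0r// gt_eqF.
Qed.

(** The derivative in [z_j] of the [j]-th component of [|u|^p F]. With [flow_deriv_t], the
    derivative in [t] of the vertical component, it is arranged so that each term is a pure partial
    derivative and integrates to 0 by itself. *)
Definition flow_deriv (p q e : R) (al dal be dbe : R -> R) (u : pt -> R) j x : R :=
  p * (`|u x| `^ (p - 2) * u x) * pd (inord j) u x *
    (radial e q al x * coord x j + radial e q be x * zperp x j) +
  `|u x| `^ p *
    (radial e (q - 1) (fun y => q * al y - y * dal y) x * (2 * coord x j) * coord x j
     + radial e q al x +
     radial e (q - 1) (fun y => q * be y - y * dbe y) x * (2 * coord x j) * zperp x j).

Definition flow_deriv_t (p q e : R) (be dbe : R -> R) (u : pt -> R) x : R :=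
  p * (`|u x| `^ (p - 2) * u x) * pd ord_max u x * (2 * radial e q be x * zsq x) +
  `|u x| `^ p * (2 * zsq x * radial e (q - 1) dbe x).

Lemma flow_intH0 (p q e M : R) (al dal be dbe : R -> R) (u : pt -> R) :
  1 < p -> 0 < e -> 0 < M ->
  (forall y : R, is_derive y 1 al (dal y)) -> continuous dal ->
  (forall y : R, is_derive y 1 be (dbe y)) -> continuous dbe ->
  continuous u -> (forall k x, is_derive x (delta_mx 0 k) u (pd k u x)) ->
  (forall k, continuous (pd k u)) ->
  (forall x, (exists i, M < `|x ord0 i|) -> u x = 0 /\ forall k, pd k u x = 0) ->
  let D := fun x => \sum_(j < n.*2) flow_deriv p q e al dal be dbe u j x +
    1 * flow_deriv_t p q e be dbe u x in
  cont_supp M D /\ intH D = 0.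
Proof.
move=> p1 e0 M0 dal1 cdal dbe1 cdbe cu du cpd u0 D.
have p0 : 0 < p by lra.
have cal := derive_cont _ _ dal1; have cbe := derive_cont _ _ dbe1.
have cphi : continuous (fun x => `|u x| `^ p).
  by apply: (ccomp (F := fun s => `|s| `^ p)) => //; exact: cont_powR_norm.
have cdphi : continuous (fun x => p * (`|u x| `^ (p - 2) * u x)).
  apply: cM; first exact: ccst.
  by apply: (ccomp (F := fun s => `|s| `^ (p - 2) * s)) => //; exact: cont_powR_sgn.
have dphi k x : is_derive x (delta_mx 0 k) (fun x => `|u x| `^ p)
    (p * (`|u x| `^ (p - 2) * u x) * pd k u x).
  by apply: (dcomp (F := fun s => `|s| `^ p) (du k x) (derive_powR_norm _ _ p1)).
have czp j : continuous (fun x => zperp x j).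
  by apply: cM; [exact: cont_tcoef|exact: ccst].
have ccst2 (c : R) : continuous (fun _ : pt => c) by exact: ccst.
have cco := @cont_coord R n; have czs := @cont_zsq R n.
have cal_r := @cont_radial R n e q al e0 cal; have cbe_r := @cont_radial R n e q be e0 cbe.
have cvar (F dF : R -> R) : continuous F -> continuous dF ->
    continuous (fun y => q * F y - y * dF y).
  move=> cF cdF; apply: cB; first by apply: cM => //; exact: ccst.
  by apply: cM => // y; exact: cvg_id.
have cA1 := @cont_radial R n e (q - 1) _ e0 (cvar al dal cal cdal).
have cB1 := @cont_radial R n e (q - 1) _ e0 (cvar be dbe cbe cdbe).
have cBt := @cont_radial R n e (q - 1) dbe e0 cdbe.
have phi0 x : (exists i, M < `|x ord0 i|) -> `|u x| `^ p = 0.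
  by move=> /u0[-> _]; rewrite normr0 powR0// gt_eqF.
have cs j : cont_supp M (flow_deriv p q e al dal be dbe u j).
  split; last first.
    by move=> x xM; rewrite /flow_deriv phi0// (u0 _ xM).2 !(mulr0, mul0r) addr0.
  have c2z := cM (ccst2 2) (cco j).
  have c1 := cM (cM cdphi (cpd (inord j))) (cD (cM cal_r (cco j)) (cM cbe_r (czp j))).
  exact: (cD c1 (cM cphi (cD (cD (cM (cM cA1 c2z) (cco j)) cal_r)
    (cM (cM cB1 c2z) (czp j))))).
have cst : cont_supp M (flow_deriv_t p q e be dbe u).
  split; last first.
    by move=> x xM; rewrite /flow_deriv_t phi0// (u0 _ xM).2 !(mulr0, mul0r) addr0.
  have c1 := cM (cM cdphi (cpd ord_max)) (cM (cM (ccst2 2) cbe_r) czs).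
  exact: (cD c1 (cM cphi (cM (cM (ccst2 2) czs) cBt))).
have i0 j : (j < n.*2)%N -> intH (flow_deriv p q e al dal be dbe u j) = 0.
  move=> jn.
  apply: (intH_deriv0 M (inord j) (fun x => `|u x| `^ p *
    (radial e q al x * coord x j + radial e q be x * zperp x j))) => //.
    split; last by move=> x /phi0 ->; rewrite mul0r.
    exact: (cM cphi (cD (cM cal_r (cco j)) (cM cbe_r (czp j)))).
  move=> x; apply: (dM (dphi _ x)).
    apply: dD; last reflexivity.
      apply: dM; last reflexivity.
        exact: (d_radial e q al dal _ _ _ _ e0 dal1 (d_zsq x j jn) (d_tcoord x j jn)).
      exact: (d_coord x j j jn jn).
    apply: dM; last reflexivity.
      exact: (d_radial e q be dbe _ _ _ _ e0 dbe1 (d_zsq x j jn) (d_tcoord x j jn)).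
    exact: (d_zperp x j jn).
  by rewrite /flow_deriv eqxx /= mulr1n !mulr0 !addr0 mulr1.
have it0 : intH (flow_deriv_t p q e be dbe u) = 0.
  apply: (intH_deriv0 M ord_max (fun x => `|u x| `^ p *
    (2 * radial e q be x * zsq x))) => //.
    split; last by move=> x /phi0 ->; rewrite mul0r.
    exact: (cM cphi (cM (cM (ccst2 2) cbe_r) czs)).
  move=> x; apply: (dM (dphi _ x)).
    apply: dM; last reflexivity.
      apply: dM; last reflexivity.
      exact: (d_radial e q be dbe _ _ _ _ e0 dbe1 (d_zsq_t x) (d_tcoord_t x)).
    exact: d_zsq_t.
  by rewrite /flow_deriv_t; ring.
have csum0 : cont_supp M
    (fun x => \sum_(j < n.*2) flow_deriv p q e al dal be dbe u j x).
  by apply: cont_supp_sum => j; exact: cs.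
split; first by apply: cont_suppD.
rewrite (intHD M _ _ _ M0 csum0 cst) it0 mulr0 addr0.
by apply: (intH_sum0 M) => // j; exact: i0.
Qed.

Lemma hardy_regularized (p m K L e M c0 : R) (h al dal be dbe : R -> R) (u : pt -> R) :
  1 < p -> 0 <= K -> 0 < L -> 0 < e -> 0 < M -> 0 < c0 -> (0 < n)%N ->
  (forall y : R, is_derive y 1 al (dal y)) -> continuous dal ->
  (forall y : R, is_derive y 1 be (dbe y)) -> continuous dbe ->
  continuous h -> (forall y, 0 < h y) ->
  (forall y, - m * al y - 2 * y * dal y + 2 * dbe y =
     (Q - 2) * (Q - m) * h y `^ (- m) - (Q - 2) * al y) ->
  (forall y, `|al y - (Q - m) * h y `^ (- m)| <= `|m| * h y `^ (- m - 1)) ->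
  (forall y, al y ^+ 2 + be y ^+ 2 <= (K * (Q - 2)) ^+ 2 * h y `^ (2 - 2 * m)) ->
  continuous u -> (forall k x, is_derive x (delta_mx 0 k) u (pd k u x)) ->
  (forall k, continuous (pd k u)) ->
  (forall x, (exists i, M < `|x ord0 i|) -> u x = 0 /\ forall k, pd k u x = 0) ->
  let om := radial e 2^-1 h in
  (forall x, u x != 0 -> c0 <= om x) ->
  (`|Q - m| - `|m| * Num.sqrt e / c0 - K * (p - 1) * L) *
     intH (fun x => `|u x| `^ p * om x `^ (- m)) <=
  K * L `^ (1 - p) * intH (fun x => `|hgrad_norm u x| `^ p * om x `^ (p - m)).
Proof.
move=> p1 K0 L0 e0 M0 c00 n0 dal1 cdal dbe1 cdbe ch h0 id err bd cu du cpd u0 om omc.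
set eta := `|m| * Num.sqrt e / c0.
have p0 : 0 < p by lra.
have [CD D0] := flow_intH0 p (- m / 2) e M al dal be dbe u p1 e0 M0 dal1 cdal dbe1 cdbe
  cu du cpd u0.
set D := fun x => _ in CD D0.
have CI : cont_supp M (fun x => `|u x| `^ p * om x `^ (- m)).
  by apply: cont_supp_weight => // x /u0[].
have CJ : cont_supp M (fun x => `|hgrad_norm u x| `^ p * om x `^ (p - m)).
  apply: cont_supp_weight => //; first exact: cont_hgrad_norm.
  move=> x /u0[_ pd0]; rewrite /hgrad_norm big1 ?sqrtr0// => j _.
  by rewrite /Xfield !pd0 mulr0 addr0 expr0n.
set I := fun x => `|u x| `^ p * om x `^ (- m) in CI *.
set J := fun x => `|hgrad_norm u x| `^ p * om x `^ (p - m) in CJ *.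
have Q2 : 0 < Q - 2 by rewrite QdimE ltr0n double_gt0.
pose s : R := Num.sg (Q - m).
(* [D] integrates to 0, so a multiple of it may be added to reduce the claim to a pointwise
   inequality; the sign [s] makes the coefficient [|Q - m|] appear. The summands 0 put both sides in
   the form [f + c g] of [intHD]. *)
suff pw x : 0 + (`|Q - m| - eta - K * (p - 1) * L) * I x <=
    (0 + s / (Q - 2) * D x) + K * L `^ (1 - p) * J x.
  have C0 := @cont_supp0 R n M.
  have CD' := cont_suppD M _ _ (s / (Q - 2)) C0 CD.
  have := le_intH M _ _ M0 (cont_suppD M _ _ (`|Q - m| - eta - K * (p - 1) * L) C0 CI)
    (cont_suppD M _ _ (K * L `^ (1 - p)) CD' CJ) pw.
  rewrite (intHD M _ _ _ M0 C0 CI) (intHD M _ _ _ M0 CD' CJ) (intHD M _ _ _ M0 C0 CD).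
  by rewrite D0 mulr0 [intH (fun=> 0)]rint0 !add0r.
rewrite !add0r.
set H := hgrad_norm u x; have H0 : 0 <= H by exact: hgrad_norm_ge0.
set X := `|u x|; have X0 : 0 <= X by exact: normr_ge0.
have om0 : 0 < om x by exact: radial_gt0.
pose c := p * (X `^ (p - 2) * u x).
pose F := \sum_(j < n.*2) (radial e (- m / 2) al x * coord x j +
   radial e (- m / 2) be x * zperp x j) * Xfield j u x.
pose E := e * radial e (- m / 2 - 1) (fun y => al y - (Q - m) * h y `^ (- m)) x.
have DE : D x = X `^ p * ((Q - 2) * ((Q - m) * om x `^ (- m) + E)) + c * F.
  rewrite /D mul1r /flow_deriv /flow_deriv_t.
  rewrite (divergence_sum x (fun j => pd (inord j) u x) (pd ord_max u x)
    (radial e (- m / 2) al x) (radial e (- m / 2) be x) _ _ _ c (X `^ p)).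
  by rewrite (divergence_radial m e h al dal dbe e0 h0 x id).
have cX : `|c| <= p * X `^ (p - 1).
  rewrite normrM (gtr0_norm p0) normrM (ger0_norm (powR_ge0 _ _)) -/X.
  have [X00|Xn0] := eqVneq X 0; first by rewrite X00 mulr0 mulr0 mulr_ge0 ?powR_ge0// ltW.
  by rewrite powR_pred// lt_def Xn0.
have Fle : `|F| <= K * (Q - 2) * om x `^ (1 - m) * H.
  apply: (@le_trans _ _ (Num.sqrt ((radial e (- m / 2) al x ^+ 2 +
      radial e (- m / 2) be x ^+ 2) * zsq x) * H)); last first.
    by apply: ler_wpM2r => //; exact: (field_bound m K e h al be e0 h0 x K0 bd).
  rewrite -sum_field2 /H /hgrad_norm -sqrtrM; last by apply: sumr_ge0 => j _; exact: sqr_ge0.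
  rewrite -sqrtr_sqr; apply: ler_wsqrtr.
  exact: cauchy_schwarz.
have Y := young_powR p L X (om x * H) p1 L0 X0 (mulr_ge0 (ltW om0) H0).
have powM : (om x * H) `^ p = om x `^ p * H `^ p by rewrite powRM// ltW.
have pow1 : om x `^ (1 - m) = om x `^ (- m) * om x.
  by rewrite (powR_predM (1 - m) _ om0); congr (_ `^ _ * _); ring.
have pow2 : om x `^ (p - m) = om x `^ (- m) * om x `^ p.
  by rewrite -powRD ?(lt0r_neq0 om0) ?implybT//; congr powR; ring.
have T1 : - (s / (Q - 2) * (c * F)) <=
    K * ((p - 1) * L * I x + L `^ (1 - p) * J x).
  apply: (@le_trans _ _ ((Q - 2)^-1 * (p * X `^ (p - 1) *
     (K * (Q - 2) * om x `^ (1 - m) * H)))).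
    apply: le_trans (ler_norm _) _; rewrite normrN normrM normrM.
    apply: ler_pM => //; last by rewrite normrM; exact: ler_pM.
    rewrite normfV (gtr0_norm Q2) ler_piMl ?invr_ge0 ?(ltW Q2)//.
    by rewrite normr_sg; case: (_ != _).
  rewrite pow1 (_ : _^-1 * _ = K * (om x `^ (- m) * (p * X `^ (p - 1) * (om x * H)))); last first.
    by field; rewrite addrAC subrr add0r -QdimE gt_eqF.
  apply: ler_wpM2l => //.
  apply: le_trans (ler_wpM2l (powR_ge0 _ _) Y) _.
  by rewrite /I /J -/X -/H (ger0_norm H0) powM pow2 le_eqVlt; apply/orP; left; apply/eqP; ring.
have T2 : - (s * (X `^ p * E)) <= eta * I x.
  have [ux0|ux0] := eqVneq (u x) 0.
    by rewrite /I /X ux0 normr0 powR0 ?gt_eqF// !(mul0r, mulr0) oppr0.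
  apply: le_trans (ler_norm _) _; rewrite normrN normrM normrM (ger0_norm (powR_ge0 _ _)).
  have E1 : `|E| <= eta * om x `^ (- m).
    apply: le_trans (divergence_error m e h al e0 h0 x err) _.
    apply: ler_wpM2r; first exact: powR_ge0.
    apply: ler_wpM2l; first by rewrite mulr_ge0 ?sqrtr_ge0.
    by rewrite lef_pV2 ?posrE// omc.
  apply: (@le_trans _ _ (X `^ p * `|E|)).
    rewrite ler_piMl ?mulr_ge0 ?powR_ge0//.
    by rewrite normr_sg; case: (_ != _).
  rewrite /I -/X (_ : eta * _ = X `^ p * (eta * om x `^ (- m))); last by ring.
  by apply: ler_wpM2l => //; exact: powR_ge0.
have T3 : s / (Q - 2) * D x = `|Q - m| * I x + s * (X `^ p * E) + s / (Q - 2) * (c * F).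
  rewrite DE /I -/X normrEsg -/s; field.
  by rewrite addrAC subrr add0r -QdimE gt_eqF.
rewrite T3; move: T1 T2.
set a1 := I x; set a2 := J x; set a3 := s / _ * _; set a4 := s * _ => T1 T2.
have : `|Q - m| * a1 - eta * a1 - K * (p - 1) * L * a1 <=
  `|Q - m| * a1 + a4 + a3 + K * L `^ (1 - p) * a2.
  have -> : K * (p - 1) * L * a1 = K * ((p - 1) * L * a1 + L `^ (1 - p) * a2) -
     K * L `^ (1 - p) * a2 by ring.
  lra.
by apply: le_trans; rewrite le_eqVlt; apply/orP; left; apply/eqP; ring.
Qed.

End RegularizedHardyIntegral.

(** * Removing the regularisation *)

Section HardyLimit.
Context {R : realType} {n : nat}.
Notation pt := (@pt R n).
Notation N := (n.*2.+1).
Notation coord := (@Defs.coord R n).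
Notation Q := (@Qdim R n).
Implicit Types (x : pt) (u : pt -> R).

Lemma koranyi4_gt0 x : x != 0 -> 0 < zsq x ^+ 2 + tcoord x ^+ 2.
Proof.
move=> x0; rewrite lt_def addr_ge0 ?sqr_ge0// andbT.
apply: contraNneq x0 => /eqP; rewrite paddr_eq0 ?sqr_ge0// !sqrf_eq0.
rewrite psumr_eq0; last by move=> i _; exact: sqr_ge0.
move=> /andP[/allP z0 /eqP t0]; apply/eqP/rowP => i; rewrite mxE.
have [ilt|] := ltnP i n.*2; last first.
  move=> ige; have -> : i = ord_max by apply/val_inj/eqP; rewrite /= eqn_leq ige -ltnS ltn_ord.
  exact: t0.
have := z0 (Ordinal ilt) (mem_index_enum _).
by rewrite /= sqrf_eq0 /Defs.coord/= inord_val => /eqP.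
Qed.

Lemma notin_supp u x : ~ supp u x -> u x = 0 /\ forall k, pd k u x = 0.
Proof.
move=> nx.
have nb : \forall y \near x, u y = 0.
  have : open (~` supp u) by apply: closed_openC; exact: closed_closure.
  rewrite openE => /(_ x nx); apply: filterS => y /= ny.
  by apply/eqP; apply: contra_notT ny => uy; exact: subset_closure.
split; first exact: nbhs_singleton nb.
move=> k; rewrite /pd (@near_eq_derive _ _ _ _ (cst 0))//.
by rewrite derive_cst.
Qed.

Lemma supp_bounds u : test_fun u -> exists M k0 : R,
  [/\ 0 < M, 0 < k0,
      forall x, (exists i, M < `|x ord0 i|) -> ~ supp u x &
      forall x, supp u x -> k0 <= koranyi x].
Proof.
move=> [_ [cs s0]].
have [M [Mr HM]] := compact_bounded cs.
have cK : continuous (fun x : pt => zsq x ^+ 2 + tcoord x ^+ 2).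
  by apply: cD; apply: cX; [exact: cont_zsq|exact: cont_tcoord].
have [k k0 Hk] : exists2 k : R, 0 < k & forall x, supp u x -> k <= zsq x ^+ 2 + tcoord x ^+ 2.
  have [->|/set0P ne] := eqVneq (supp u) set0; first by exists 1.
  have [c cin Hc] := EVT_min_rV ne cs (continuous_subspaceT cK).
  exists (zsq c ^+ 2 + tcoord c ^+ 2); last by move=> x /mem_set; exact: Hc.
  apply: koranyi4_gt0; apply: contra_notN s0 => /eqP <-; exact: set_mem cin.
exists (`|M| + 1), (k `^ 4^-1); split.
- by rewrite ltr_wpDl.
- exact: powR_gt0.
- move=> x [i xi] sx.
  have M1 : M < `|M| + 1 by rewrite (le_lt_trans (ler_norm _))// ltrDl.
  have := lt_le_trans xi (normr_coord x i).
  by rewrite ltNge (HM _ M1 x sx).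
- move=> x /Hk kx; rewrite /koranyi; apply: ge0_ler_powR => //.
  + by rewrite nnegrE ltW.
  + by rewrite nnegrE addr_ge0 ?sqr_ge0.
Qed.

(** Since [s] is pinched on both sides, one bound with the exponent [- |r|] serves powers of either
    sign. *)
Lemma powR_ratio (t s r : R) : 0 < t -> t <= 1 -> t <= s -> s <= t^-1 ->
  s `^ r <= t `^ (- `|r|).
Proof.
move=> t0 t1 ts st; have s0 : 0 < s by exact: lt_le_trans ts.
have ti : 0 < t^-1 by rewrite invr_gt0.
rewrite powRN -powR_inv1 ?powR_ge0// -powRrM mulrN1 powRN.
have -> : (t `^ `|r|)^-1 = t^-1 `^ `|r|.
  by rewrite -(powR_inv1 (ltW t0)) -powRrM mulN1r powRN.
have [r0|r0] := leP 0 r.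
  by rewrite ger0_norm//; apply: ge0_ler_powR => //; rewrite nnegrE ltW.
rewrite ltr0_norm//.
have -> : s `^ r = s^-1 `^ (- r).
  by rewrite -(powR_inv1 (ltW s0)) -powRrM mulN1r opprK.
apply: ge0_ler_powR; rewrite ?nnegrE ?invr_ge0 ?oppr_ge0 ?(ltW r0) ?(ltW s0) ?(ltW t0)//.
by rewrite lef_pV2 ?posrE.
Qed.

(** On the support of [u] the weight [d] is bounded below, and [om] is within [C sqrt e] of it, so
    [om / d] lies between [rho] and its inverse. Integrals with [d] and with [om] are then compared
    up to powers of [rho], which tend to 1. *)
Lemma hardy_const_ge_field (d : pt -> R) (p theta K C c1 : R)
    (h al dal be dbe : R -> R) :
  let m := p * theta in
  1 < p -> 0 < K -> 0 <= C -> 0 < c1 -> (0 < n)%N ->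
  (forall y : R, is_derive y 1 al (dal y)) -> continuous dal ->
  (forall y : R, is_derive y 1 be (dbe y)) -> continuous dbe ->
  continuous h -> (forall y, 0 < h y) ->
  (forall y, - m * al y - 2 * y * dal y + 2 * dbe y =
     (Q - 2) * (Q - m) * h y `^ (- m) - (Q - 2) * al y) ->
  (forall y, `|al y - (Q - m) * h y `^ (- m)| <= `|m| * h y `^ (- m - 1)) ->
  (forall y, al y ^+ 2 + be y ^+ 2 <= (K * (Q - 2)) ^+ 2 * h y `^ (2 - 2 * m)) ->
  (forall x e, 0 < e -> `|radial e 2^-1 h x - d x| <= C * Num.sqrt e) ->
  (forall x, c1 * koranyi x <= d x) ->
  (((`|Q - m| / (p * K)) `^ p)%:E <= hardy_const d p theta)%E.
Proof.
move=> m p1 K0 C0 c10 n0 dal1 cdal dbe1 cdbe ch h0 id err bd dlim dkor.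
have p0 : 0 < p by lra.
apply: ereal_sup_ubound; exists ((`|Q - m| / (p * K)) `^ p) => //.
split; first exact: powR_ge0.
move=> u utest.
set Jd := integral_H (fun x => (_ / (d x `^ (p * (theta - 1))))%:E).
set Id := integral_H _.
have Jd0 : (0 <= Jd)%E.
  by apply: iint_ge0 => v; rewrite lee_fin divr_ge0 ?powR_ge0.
have Id0 : (0 <= Id)%E.
  by apply: iint_ge0 => v; rewrite lee_fin divr_ge0 ?powR_ge0.
(* The constant is 0 here, and 0 times a possibly infinite integral is 0; below, [L] has to be
   positive. *)
have [Qm|Qm] := eqVneq (Q - m) 0.
  by rewrite Qm normr0 mul0r (powR0 (lt0r_neq0 p0)) mul0e; exact: Jd0.
(* This [L] maximises [L^(p - 1) (|Q - m| / K - (p - 1) L)], the constant that Young's inequality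
   yields when [e = 0]; the maximum is [L^p]. *)
have [L LE] : {L : R | `|Q - m| / (p * K) = L} by exists (`|Q - m| / (p * K)).
rewrite LE.
have L0 : 0 < L by rewrite -LE divr_gt0 ?mulr_gt0 ?normr_gt0.
have [M [k0 [M0 k00 uM uk]]] := supp_bounds u utest.
(* Half the lower bound of [d] on the support, so that [om] stays above [c0] as soon as
   [C sqrt e <= c0]. *)
pose c0 := c1 * k0 / 2.
have c00 : 0 < c0 by rewrite !mulr_gt0.
have dc0 x : supp u x -> 2 * c0 <= d x.
  move=> /uk kx; apply: le_trans (dkor x); rewrite /c0 mulrC divfK//.
  by rewrite ler_pM2l.
have [sm _] := utest.
have cu : continuous u := (sm [::]).1.
have cpd k : continuous (pd k u) := (sm [:: k]).1.
have du (k : 'I_N) x : is_derive x (delta_mx 0 k) u (pd k u x).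
  by have := (sm [::]).2 k x; exact: derivableP.
have uM0 x : (exists i, M < `|x ord0 i|) -> u x = 0 /\ forall k, pd k u x = 0.
  by move=> /uM /notin_supp.
pose Ie e := intH (fun x => `|u x| `^ p * radial e 2^-1 h x `^ (- m)).
pose Je e := intH (fun x => `|hgrad_norm u x| `^ p * radial e 2^-1 h x `^ (p - m)).
pose rho (s : R) := 1 - C * s / (2 * c0).
pose r := `|m| + `|p - m|.
pose kap := `|m| * L `^ (p - 1) / (K * c0).
have main s : 0 < s -> C * s <= c0 ->
  [/\ 0 < rho s, (Id <= (rho s `^ (- `|m|) * Ie (s ^+ 2))%:E)%E,
   ((rho s `^ `|p - m| * Je (s ^+ 2))%:E <= Jd)%E &
   (L `^ p - kap * s) * Ie (s ^+ 2) <= Je (s ^+ 2)].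
  move=> s0 Cs.
  have e0 : 0 < s ^+ 2 by rewrite exprn_gt0.
  have se : Num.sqrt (s ^+ 2) = s by rewrite sqrtr_sqr gtr0_norm.
  have Cs0 : 0 <= C * s by rewrite mulr_ge0// ltW.
  have rhoE : rho s * (2 * c0) = 2 * c0 - C * s.
    by rewrite /rho; field; rewrite gt_eqF.
  have rho0 : 0 < rho s.
    rewrite -(pmulr_lgt0 _ (_ : 0 < 2 * c0)) ?rhoE; last by rewrite mulr_gt0.
    by lra.
  have rho1 : rho s <= 1.
    by rewrite /rho gerBl divr_ge0// mulr_ge0// ltW.
  have closeP x : supp u x -> [/\ 0 < d x, c0 <= radial (s ^+ 2) 2^-1 h x,
      rho s <= radial (s ^+ 2) 2^-1 h x / d x &
      radial (s ^+ 2) 2^-1 h x / d x <= (rho s)^-1].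
    move=> /dc0 dx.
    have dx0 : 0 < d x by lra.
    have := dlim x _ e0; rewrite se; set o := radial _ _ _ _.
    move=> /ler_normlP [q1 q2].
    have H : rho s * d x <= d x - C * s.
      rewrite /rho mulrBl mul1r lerD2l lerN2 mulrAC ler_pdivlMr ?mulr_gt0//.
      by rewrite ler_wpM2l.
    split => //; first by lra.
      by rewrite ler_pdivlMr//; lra.
    rewrite ler_pdivrMr// mulrC ler_pdivlMr//.
    have : (d x + C * s) * rho s <= d x.
      rewrite mulrDl [d x * _]mulrC; apply: (@le_trans _ _ (d x - C * s + C * s * 1)); last by lra.
      by apply: lerD => //; exact: ler_wpM2l.
    apply: le_trans; rewrite ler_pM2r//; lra.
  have CI : cont_supp M (fun x => `|u x| `^ p * radial (s ^+ 2) 2^-1 h x `^ (- m)).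
    by apply: cont_supp_weight => // x /uM0[].
  have CJ : cont_supp M (fun x => `|hgrad_norm u x| `^ p *
      radial (s ^+ 2) 2^-1 h x `^ (p - m)).
    apply: cont_supp_weight => //; first exact: cont_hgrad_norm.
    move=> x /uM0[_ pd0]; rewrite /hgrad_norm big1 ?sqrtr0// => j _.
    by rewrite /Xfield !pd0 mulr0 addr0 expr0n.
  have C00 := @cont_supp0 R n M.
  have sc (f : pt -> R) c : cont_supp M f ->
      (c * intH f)%:E = integral_H (fun x => (c * f x)%:E).
    move=> Cf; have -> : (fun x => (c * f x)%:E) = (fun x => (0 + c * f x)%:E).
      by apply/funext => x; rewrite add0r.
    rewrite (integral_HE M _ M0 (cont_suppD M _ _ c C00 Cf)) (intHD M _ _ _ M0 C00 Cf).
    by rewrite [intH (fun=> 0)]rint0 add0r.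
  split; first exact: rho0.
  - rewrite (sc _ _ CI); apply: le_iint => v; first by rewrite lee_fin divr_ge0 ?powR_ge0.
    set x := \row_(i < N) v i; rewrite lee_fin.
    have [sx|/notin_supp[-> _]] := pselect (supp u x); last first.
      by rewrite normr0 powR0 ?gt_eqF// mul0r mul0r mulr0.
    have [dx0 oc o1 o2] := closeP _ sx.
    set o := radial _ _ _ _ in oc o1 o2 *.
    have o0 : 0 < o by exact: lt_le_trans oc.
    have := powR_ratio (rho s) (o / d x) m rho0 rho1 o1 o2.
    rewrite powRM ?invr_ge0 ?(ltW o0) ?(ltW dx0)//.
    rewrite -(powR_inv1 (ltW dx0)) -powRrM mulN1r !powRN => H.
    rewrite mulrCA; apply: ler_wpM2l; first exact: powR_ge0.
    by rewrite -(ler_pM2l (powR_gt0 m o0)) [leRHS]mulrCA divff ?mulr1// gt_eqF// powR_gt0.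
  - rewrite (sc _ _ CJ); apply: le_iint => v; first by rewrite lee_fin !mulr_ge0 ?powR_ge0.
    set x := \row_(i < N) v i; rewrite lee_fin.
    have [sx|/notin_supp[_ pd0]] := pselect (supp u x); last first.
      have -> : hgrad_norm u x = 0.
        rewrite /hgrad_norm big1 ?sqrtr0// => j _.
        by rewrite /Xfield !pd0 mulr0 addr0 expr0n.
      by rewrite normr0 powR0 ?gt_eqF// mul0r mul0r mulr0.
    have [dx0 oc o1 o2] := closeP _ sx.
    set o := radial _ _ _ _ in oc o1 o2 *.
    have o0 : 0 < o by exact: lt_le_trans oc.
    have := powR_ratio (rho s) (o / d x) (p - m) rho0 rho1 o1 o2.
    rewrite powRM ?invr_ge0 ?(ltW o0) ?(ltW dx0)//.
    rewrite -(powR_inv1 (ltW dx0)) -powRrM mulN1r [rho s `^ _]powRN => H.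
    rewrite (ger0_norm (hgrad_norm_ge0 _ _)) mulrCA; apply: ler_wpM2l; first exact: powR_ge0.
    have -> : (d x `^ (p * (theta - 1)))^-1 = d x `^ (p - m).
      by rewrite -powRN; congr powR; rewrite /m; ring.
    rewrite powRN in H.
    rewrite mulrC -ler_pdivlMr ?powR_gt0// -ler_pdivrMl ?powR_gt0//.
    by rewrite mulrC.
  - have omc x : u x != 0 -> c0 <= radial (s ^+ 2) 2^-1 h x.
      move=> ux; have sx : supp u x by exact: subset_closure.
      by have [] := closeP x sx.
    have := hardy_regularized p m K L (s ^+ 2) M c0 h al dal be dbe u p1 (ltW K0) L0 e0 M0 c00
      n0 dal1 cdal dbe1 cdbe ch h0 id err bd cu du cpd uM0 omc.
    rewrite se -/(Ie _) -/(Je _).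
    move: (Ie (s ^+ 2)) (Je (s ^+ 2)) => Iv Jv H.
    have KL : 0 < L `^ (p - 1) / K by rewrite divr_gt0 ?powR_gt0.
    have QL : `|Q - m| = p * K * L by rewrite -LE mulrC divfK// gt_eqF ?mulr_gt0.
    have LL : L `^ p = L `^ (p - 1) * L by exact: powR_predM.
    have LV : L `^ (1 - p) * L `^ (p - 1) = 1.
      by rewrite -powRD ?(lt0r_neq0 L0) ?implybT// addrA subrK subrr powRr0.
    have := ler_wpM2l (ltW KL) H.
    have -> : L `^ (p - 1) / K * (K * L `^ (1 - p) * Jv) = Jv.
      transitivity (L `^ (1 - p) * L `^ (p - 1) * Jv).
        by field; rewrite gt_eqF.
      by rewrite LV mul1r.
    apply: le_trans; rewrite le_eqVlt; apply/orP; left; apply/eqP.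
    rewrite QL LL /kap; field.
    by rewrite !gt_eqF.
clearbody Jd Id Ie Je.
(* Comparison with the regularised integral at one fixed scale gives finiteness. *)
have Idfin : Id \is a fin_num.
  have C1 : 0 < C + 1 by rewrite ltr_wpDl.
  have [||_ Idle _ _] := main (c0 / (C + 1)).
  - by rewrite divr_gt0.
  - by rewrite mulrA ler_pdivrMr// mulrC ler_wpM2l ?(ltW c00)// lerDl.
  by rewrite ge0_fin_numE//; apply: le_lt_trans Idle _; exact: ltry.
have [->|Jdfin] := eqVneq Jd +oo%E; first exact: leey.
have {}Jdfin : Jd \is a fin_num by rewrite ge0_fin_numE// lt_neqAle Jdfin leey.
rewrite -(fineK Idfin) -(fineK Jdfin) -EFinM lee_fin.
set i := fine Id; set j := fine Jd.
have i0 : 0 <= i by exact: fine_ge0.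
rewrite leNgt; apply/negP => ji.
(* The estimates in [main] give [F s <= j] for small [s > 0], while [F] is continuous at 0 with
   value [L^p i]. If that value exceeded [j], a small [s] would be contradictory. *)
pose F (s : R) := (L `^ p - kap * s) * (rho s `^ r * i).
have c02 : 0 < 2 * c0 by rewrite mulr_gt0.
have crho : {for (0 : R), continuous rho}.
  apply: cB; first exact: ccst.
  by apply: cM; [apply: cM; [exact: ccst|move=> ?; exact: cvg_id]|exact: ccst].
have rho00 : rho 0 = 1 by rewrite /rho mulr0 mul0r subr0.
have cF : {for (0 : R), continuous F}.
  apply: (@continuousM _ _ (fun s => L `^ p - kap * s) (fun s => rho s `^ r * i)).
    apply: cB; first exact: ccst.
    by apply: cM; [exact: ccst|move=> ?; exact: cvg_id].
  apply: (@continuousM _ _ (fun s => rho s `^ r) (fun=> i)); last exact: cst_continuous.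
  apply: (@continuous_comp _ _ _ rho (fun t => t `^ r)); first exact: crho.
  by apply: derive_cont1; apply: dpow; rewrite ?rho00.
have F0 : F 0 = L `^ p * i by rewrite /F mulr0 subr0 rho00 powR1 mul1r.
have ji0 : 0 < L `^ p * i - j by rewrite subr_gt0.
move/cvgrPdist_lt : cF => /(_ _ ji0); rewrite F0 => /nbhs_ballP[d1 /= d10 Hd1].
have cG : {for (0 : R), continuous (fun s : R => L `^ p - kap * s)}.
  by apply: cB; [exact: ccst|apply: cM; [exact: ccst|move=> ?; exact: cvg_id]].
have Lp0 : 0 < L `^ p by exact: powR_gt0.
move/cvgrPdist_lt : cG => /(_ _ Lp0); rewrite mulr0 subr0 => /nbhs_ballP[d2 /= d20 Hd2].
pose s := Num.min (Num.min d1 d2 / 2) (c0 / (C + 1)).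
have C1 : 0 < C + 1 by rewrite ltr_wpDl.
have d12 : 0 < Num.min d1 d2 by rewrite lt_min d10.
have s0 : 0 < s by rewrite lt_min; apply/andP; split; exact: divr_gt0.
have sd : s < Num.min d1 d2.
  apply: (@le_lt_trans _ _ (Num.min d1 d2 / 2)); first by rewrite ge_min lexx.
  by rewrite ltr_pdivrMr// ltr_pMr// ltr1n.
have Cs : C * s <= c0.
  apply: (@le_trans _ _ (C * (c0 / (C + 1)))).
    by apply: ler_wpM2l => //; rewrite ge_min lexx orbT.
  by rewrite mulrA ler_pdivrMr// mulrC ler_wpM2l ?(ltW c00)// lerDl.
have [rho0 Ile Jle IJ] := main s s0 Cs.
have bs1 : ball (0 : R) d1 s.
  by rewrite /ball/= sub0r normrN gtr0_norm//; move: sd; rewrite lt_min => /andP[].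
have bs2 : ball (0 : R) d2 s.
  by rewrite /ball/= sub0r normrN gtr0_norm//; move: sd; rewrite lt_min => /andP[].
have pos : 0 < L `^ p - kap * s.
  by have := Hd2 _ bs2; move=> /= /(le_lt_trans (ler_norm _)); lra.
have Fj : j < F s.
  by have := Hd1 _ bs1; move=> /= /(le_lt_trans (ler_norm _)); lra.
move: Ile Jle; rewrite -(fineK Idfin) -(fineK Jdfin) !lee_fin -/i -/j => Ile Jle.
have : F s <= j.
  apply: le_trans Jle; rewrite /F /r powRD; last by apply/implyP => _; exact: lt0r_neq0.
  set a := rho s `^ `|m|; set b := rho s `^ `|p - m|.
  have a0 : 0 < a by exact: powR_gt0.
  have b0 : 0 < b by exact: powR_gt0.
  have ai : a * i <= Ie (s ^+ 2).
    by rewrite mulrC -ler_pdivlMr// mulrC -powRN.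
  apply: (@le_trans _ _ (b * ((L `^ p - kap * s) * Ie (s ^+ 2)))).
    rewrite (_ : (_ - _) * _ = b * ((L `^ p - kap * s) * (a * i))); last by ring.
    by apply: ler_wpM2l; [exact: ltW|apply: ler_wpM2l => //; exact: ltW].
  by apply: ler_wpM2l => //; exact: ltW.
by rewrite leNgt Fj.
Qed.

End HardyLimit.

(** * From a profile to a lower bound on the Hardy constant *)

Section HardyProfile.
Context {R : realType} {n : nat}.
Notation Q := (@Qdim R n).

(** The quantity [h - 2 y h'] is the derivative of [|z| h (t / |z|^2)] in [|z|]. Its bound by 1
    controls the regularisation error, because [al - (Q - m) h^(-m)] is [m h^(-m-1)] times it. *)
Lemma hardy_const_ge (d : @pt R n -> R) (p theta K C c1 : R) (h h1 h2 : R -> R) :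
  let m := p * theta in
  1 < p -> 0 < K -> 0 <= C -> 0 < c1 -> (0 < n)%N ->
  (forall y : R, is_derive y 1 h (h1 y)) ->
  (forall y : R, is_derive y 1 h1 (h2 y)) -> continuous h2 ->
  (forall y, 0 < h y) ->
  (forall y, `|h y - 2 * y * h1 y| <= 1) ->
  (forall y, (Q * h y - 2 * m * y * h1 y) ^+ 2 + (m * y * (h y - 2 * y * h1 y)) ^+ 2 <=
     (K * (Q - 2)) ^+ 2 * h y ^+ 4) ->
  (forall x e, 0 < e -> `|radial e 2^-1 h x - d x| <= C * Num.sqrt e) ->
  (forall x, c1 * koranyi x <= d x) ->
  (((`|Q - m| / (p * K)) `^ p)%:E <= hardy_const d p theta)%E.
Proof.
move=> m p1 K0 C0 c10 n0 dh dh1 ch2 h0 herr hbd dlim dkor.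
have ch := derive_cont _ _ dh; have ch1 := derive_cont _ _ dh1.
have cidm : continuous (fun y : R => y) by move=> y; exact: cvg_id.
have cc (c : R) : continuous (fun _ : R => c) by exact: ccst.
pose g (y : R) : R := h y `^ (- m - 1); pose g1 (y : R) : R := (- m - 1) * h y `^ (- m - 2) * h1 y.
have dg (y : R) : is_derive y 1 g (g1 y).
  apply: (dcomp (F := fun s => s `^ (- m - 1)) (dh y)).
    by apply: dpow => //; reflexivity.
  by rewrite /g1; congr (_ * _ `^ _ * _); ring.
have cg := derive_cont _ _ dg.
have cg1 : continuous g1 := cM (cM (cc _) (cpow _ _ ch h0)) ch1.
pose al (y : R) : R := g y * (Q * h y - 2 * m * y * h1 y).
pose dal (y : R) : R := g1 y * (Q * h y - 2 * m * y * h1 y) +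
  g y * (Q * h1 y - (2 * m * h1 y + 2 * m * y * h2 y)).
pose be (y : R) : R := m * y * (g y * (h y - 2 * y * h1 y)).
pose dbe (y : R) : R := m * (g y * (h y - 2 * y * h1 y)) +
  m * y * (g1 y * (h y - 2 * y * h1 y) + g y * (h1 y - (2 * h1 y + 2 * y * h2 y))).
have dsc (c y l : R) (f : R -> R) : is_derive y 1 f l ->
    is_derive y 1 (fun y => c * f y) (c * l).
  by move=> df; apply: (dM (dcst c y 1) df); rewrite mul0r add0r.
have dlin (c y : R) : is_derive y 1 (fun y => c * y) c.
  by apply: (dM (dcst c y 1) (is_derive_id y 1)); rewrite mul0r add0r mulr1.
have dal1 (y : R) : is_derive y 1 al (dal y).
  exact: (dM (dg y) (dB (dsc Q _ _ _ (dh y)) (dM (dlin _ _) (dh1 y) erefl) erefl) erefl).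
have dw (y : R) : is_derive y 1 (fun y => h y - 2 * y * h1 y)
    (h1 y - (2 * h1 y + 2 * y * h2 y)).
  exact: (dB (dh y) (dM (dlin _ _) (dh1 y) erefl) erefl).
have dbe1 (y : R) : is_derive y 1 be (dbe y).
  exact: (dM (dlin _ _) (dM (dg y) (dw y) erefl) erefl).
have c2y := cM (cc 2) cidm; have c2my := cM (cc (2 * m)) cidm.
have cw := cB ch (cM c2y ch1).
have cdal : continuous dal.
  apply: (cD (cM cg1 (cB (cM (cc Q) ch) (cM c2my ch1)))).
  exact: (cM cg (cB (cM (cc Q) ch1) (cD (cM (cc (2 * m)) ch1) (cM c2my ch2)))).
have cdbe : continuous dbe.
  apply: (cD (cM (cc m) (cM cg cw))).
  exact: (cM (cM (cc m) cidm) (cD (cM cg1 cw)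
    (cM cg (cB ch1 (cD (cM (cc 2) ch1) (cM c2y ch2)))))).
have gE y : g y = h y `^ (- m - 2) * h y by rewrite /g powR_pred.
have hE y : h y `^ (- m) = g y * h y by exact: powR_predM.
apply: (hardy_const_ge_field d p theta K C c1 h al dal be dbe) => // y.
- rewrite -/m hE /al /dal /be /dbe /g1 gE; ring.
- rewrite -/m hE /al -/(g y) (_ : _ - _ = m * (h y - 2 * y * h1 y) * g y); last by ring.
  rewrite normrM (ger0_norm (powR_ge0 _ _)); apply: ler_wpM2r; first exact: powR_ge0.
  by rewrite normrM ler_piMr.
- have -> : h y `^ (2 - 2 * m) = g y ^+ 2 * h y ^+ 4.
    have -> : g y ^+ 2 * h y ^+ 4 = (h y `^ (- m) * h y) ^+ 2 by rewrite hE; ring.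
    have -> : h y `^ (- m) * h y = h y `^ (1 - m).
      by rewrite [RHS]powR_predM//; congr (_ `^ _ * _); ring.
    by rewrite -powR_mulrn ?powR_ge0// -powRrM; congr powR; ring.
  have -> : al y ^+ 2 + be y ^+ 2 = g y ^+ 2 * ((Q * h y - 2 * m * y * h1 y) ^+ 2 +
      (m * y * (h y - 2 * y * h1 y)) ^+ 2) by rewrite /al /be; ring.
  rewrite [leRHS]mulrCA; apply: ler_wpM2l; first exact: sqr_ge0.
  exact: hbd.
Qed.

End HardyProfile.

(** * The Koranyi norm *)

Section Koranyi.
Context {R : realType} {n : nat}.
Notation pt := (@pt R n).
Notation Q := (@Qdim R n).
Implicit Types (x : pt) (y : R).

Lemma powR_quarter_sqr (s : R) : 0 <= s -> (s `^ 4^-1) ^+ 2 = Num.sqrt s.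
Proof.
move=> s0; rewrite -powR_mulrn ?powR_ge0// -powRrM -powR12_sqrt//.
by congr powR; field.
Qed.

Lemma Qdim_gt2 : (0 < n)%N -> 2 < Q.
Proof. by move=> n0; rewrite -subr_gt0 QdimE ltr0n double_gt0. Qed.

(** For [D >= d >= 0] one has [(D - d)^2 <= D^2 - d^2]. Here [D^2] and [d^2] are the Euclidean norms
    of two plane vectors at distance [e], so the right-hand side is at most [e]. *)
Lemma koranyi_regularized x e : 0 < e ->
  `|radial e 2^-1 (fun y => (1 + y ^+ 2) `^ 4^-1) x - koranyi x| <= 1 * Num.sqrt e.
Proof.
move=> e0; rewrite mul1r /radial /koranyi.
set z := zsq x; set t := tcoord x; set w := z + e.
have z0 : 0 <= z by exact: zsq_ge0.
have w0 : 0 < w by exact: zsqD_gt0.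
have -> : w `^ 2^-1 * (1 + (t / w) ^+ 2) `^ 4^-1 = (w ^+ 2 + t ^+ 2) `^ 4^-1.
  have -> : w `^ 2^-1 = (w ^+ 2) `^ 4^-1.
    by rewrite -powR_mulrn ?ltW// -powRrM; congr powR; field.
  rewrite -powRM ?sqr_ge0 ?addr_ge0 ?sqr_ge0//; congr powR; field.
  by rewrite gt_eqF.
set D := _ `^ _; set d := _ `^ _.
have d0 : 0 <= d by exact: powR_ge0.
have dD : d <= D.
  apply: ge0_ler_powR; rewrite ?nnegrE ?addr_ge0 ?sqr_ge0//.
  have zw : z <= w by rewrite lerDl ltW.
  by rewrite lerD2r ler_sqr// nnegrE ltW.
rewrite ger0_norm ?subr_ge0//.
rewrite -(@ler_pXn2r _ 2) ?nnegrE ?subr_ge0 ?sqrtr_ge0// (sqr_sqrtr (ltW e0)).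
have D2 : D ^+ 2 = Num.sqrt (w ^+ 2 + t ^+ 2) by rewrite powR_quarter_sqr// addr_ge0 ?sqr_ge0.
have d2 : d ^+ 2 = Num.sqrt (z ^+ 2 + t ^+ 2) by rewrite powR_quarter_sqr// addr_ge0 ?sqr_ge0.
apply: (@le_trans _ _ (D ^+ 2 - d ^+ 2)).
  by rewrite -subr_ge0 (_ : _ - _ = 2 * d * (D - d)); [rewrite !mulr_ge0 ?subr_ge0|ring].
rewrite D2 d2 lerBlDr; set b := Num.sqrt (z ^+ 2 + _).
have zb : z <= b by rewrite -[leLHS](ger0_norm z0) -sqrtr_sqr ler_wsqrtr// lerDl sqr_ge0.
have b2 : b ^+ 2 = z ^+ 2 + t ^+ 2 by rewrite sqr_sqrtr// addr_ge0 ?sqr_ge0.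
have eb : 0 <= e + b by rewrite addr_ge0 ?sqrtr_ge0// ltW.
rewrite -(ger0_norm eb) -sqrtr_sqr; apply: ler_wsqrtr; rewrite [(e + b) ^+ 2]sqrrD b2 /w.
rewrite -subr_ge0 (_ : _ - _ = 2 * e * (b - z)); last by ring.
by rewrite !mulr_ge0 ?subr_ge0// ltW.
Qed.

(** The variable [s] is [(1 + y^2)^(-1/2)], that is [|z|^2 / rho^2]; in terms of it the bound on the
    field is cubic. *)
Lemma hardy_const_koranyi_ge (p theta K : R) :
  let m := p * theta in
  1 < p -> 0 < K -> (0 < n)%N ->
  (forall s, 0 <= s -> s <= 1 ->
     s * (Q ^+ 2 * s ^+ 2 + (Q - m) ^+ 2 * (1 - s ^+ 2)) <= (K * (Q - 2)) ^+ 2) ->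
  (((`|Q - m| / (p * K)) `^ p)%:E <= hardy_const (@koranyi R n) p theta)%E.
Proof.
move=> m p1 K0 n0 bd.
have P0 y : 0 < 1 + y ^+ 2 by rewrite ltr_pwDl// sqr_ge0.
pose h y := (1 + y ^+ 2) `^ 4^-1.
pose b y := (1 + y ^+ 2) `^ (4^-1 - 1).
pose b1 y := (4^-1 - 1) * (1 + y ^+ 2) `^ (4^-1 - 1 - 1) * (2 * y).
have dP (y : R) : is_derive y 1 (fun y => 1 + y ^+ 2) (2 * y).
  apply: (dD (dcst 1 y 1) (dX 1 (is_derive_id y 1) erefl)).
  by rewrite expr1 mulr1 add0r.
have hb y : h y = b y * (1 + y ^+ 2) by exact: powR_predM.
have id1 y : h y - 2 * y * (y / 2 * b y) = b y by rewrite hb; field.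
have b0 y : 0 < b y by exact: powR_gt0.
apply: (hardy_const_ge _ p theta K 1 1 h (fun y => y / 2 * b y)
  (fun y => 2^-1 * b y + y / 2 * b1 y)) => //.
- move=> y; apply: (dcomp (F := fun s => s `^ 4^-1) (dP y)).
    by apply: dpow => //; reflexivity.
  by rewrite /b; field.
- move=> y; apply: (dM (df := 2^-1) (dg := b1 y)); last reflexivity.
    by apply: (dM (is_derive_id y 1) (dcst 2^-1 y 1)); rewrite mul1r mulr0 addr0.
  by apply: (dcomp (F := fun s => s `^ (4^-1 - 1)) (dP y) (dpow _ _ _ (P0 y) erefl)).
- have cidm : continuous (fun y : R => y) by move=> y; exact: cvg_id.
  have cc (c : R) : continuous (fun _ : R => c) by exact: ccst.
  have cP := cD (cc 1) (cX 2 cidm).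
  apply: (cD (cM (cc _) (cpow _ _ cP P0))).
  exact: (cM (cM cidm (cc _)) (cM (cM (cc _) (cpow _ _ cP P0)) (cM (cc 2) cidm))).
- by move=> y; exact: powR_gt0.
- move=> y; rewrite id1 gtr0_norm//.
  rewrite /b -[leRHS](powRr0 (1 + y ^+ 2)) ler_powR ?lerDl ?sqr_ge0//.
  by lra.
- move=> y; rewrite id1; set P := 1 + y ^+ 2.
  have PP : 0 < P by exact: P0.
  pose s := P `^ (- 2^-1).
  have s0 : 0 <= s by exact: powR_ge0.
  have s1 : s <= 1.
    by rewrite /s -[leRHS](powRr0 P) ler_powR ?lerDl ?sqr_ge0//; lra.
  have s2 : s ^+ 2 * P = 1.
    rewrite -powR_mulrn// -powRrM (_ : - 2^-1 * 2 = -1); last by field.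
    by rewrite powR_inv1 ?(ltW PP)// mulVf// gt_eqF.
  have bs : b y ^+ 2 = s ^+ 3.
    by rewrite -(powR_mulrn 2 (powR_ge0 _ _)) -(powR_mulrn 3 s0) -!powRrM; congr powR; field.
  have h4 : h y ^+ 4 = P.
    rewrite -powR_mulrn ?powR_ge0// -powRrM mulVf ?powRr1 ?(ltW PP)//.
  rewrite h4 hb -/P.
  have -> : (Q * (b y * P) - 2 * m * y * (y / 2 * b y)) ^+ 2 + (m * y * b y) ^+ 2 =
      b y ^+ 2 * ((Q * P - m * y ^+ 2) ^+ 2 + m ^+ 2 * y ^+ 2) by field.
  have y2 : y ^+ 2 = P - 1 by rewrite /P; ring.
  have -> : (Q * P - m * y ^+ 2) ^+ 2 + m ^+ 2 * y ^+ 2 =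
      P * (Q ^+ 2 + (Q - m) ^+ 2 * (P - 1)) by rewrite y2; ring.
  rewrite bs mulrCA [leRHS]mulrC; apply: ler_wpM2l; first exact: ltW.
  have -> : s ^+ 3 * (Q ^+ 2 + (Q - m) ^+ 2 * (P - 1)) =
      s * (Q ^+ 2 * s ^+ 2 + (Q - m) ^+ 2 * (s ^+ 2 * P - s ^+ 2)) by ring.
  by rewrite s2; exact: bd.
- by move=> x e; exact: koranyi_regularized.
- by move=> x; rewrite mul1r.
Qed.

End Koranyi.

(** With [a = (Q - m)^2] and [B = a - Q^2] the cubic is [a s - B s^3] on [[0, 1]]. For [B > 0] its
    critical point [sqrt (a / (3 B))] is at least 1 exactly when [a <= 3/2 Q^2], which is the range
    in the statement. There the maximum is [Q^2], at [s = 1]; otherwise it is the critical value. *)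
Lemma hardy_koranyi {R : realType} {n : nat} (p theta : R) : (0 < n)%N -> 2 <= p ->
  ((if (1 - Num.sqrt (3 / 2)) * @Qdim R n <= p * theta <= (1 + Num.sqrt (3 / 2)) * @Qdim R n
    then `|(@Qdim R n - p * theta) / p| `^ p * `|(@Qdim R n - 2) / @Qdim R n| `^ p
    else (3 / 2) `^ (p / 2) * (3 * p * theta * (p * theta - 2 * @Qdim R n)) `^ (p / 4)
         / `|p * theta - @Qdim R n| `^ (p / 2) * `|(@Qdim R n - 2) / p| `^ p)%:E
     <= hardy_const (@koranyi R n) p theta)%E.
Proof.
move=> n0 p2; set m := p * theta.
have p0 : 0 < p by lra.
have p1 : 1 < p by lra.
have := fun K K0 => @hardy_const_koranyi_ge R n p theta K p1 K0 n0.
have := @Qdim_gt2 R n n0; move: (@Qdim R n) => Q Q2 hk.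
have Q0 : 0 < Q by lra.
have Qm20 : 0 < Q - 2 by lra.
pose g := Num.sqrt (3 / 2 : R).
have g0 : 0 <= g by exact: sqrtr_ge0.
have g2 : g ^+ 2 = 3 / 2 by rewrite sqr_sqrtr; lra.
have rangeE : ((1 - g) * Q <= m <= (1 + g) * Q) = ((Q - m) ^+ 2 <= 3 / 2 * Q ^+ 2).
  rewrite -g2 -exprMn -(ger0_norm (mulr_ge0 g0 (ltW Q0))) -[(Q - m) ^+ 2]real_normK ?num_real//.
  rewrite ler_sqr ?nnegrE// (ger0_norm (mulr_ge0 g0 (ltW Q0))) ler_norml.
  by apply/andP/andP => -[H1 H2]; split; lra.
rewrite -/g rangeE; case: ifPn => [am|].
  have K0 : 0 < Q / (Q - 2) by rewrite divr_gt0.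
  have -> : `|(Q - m) / p| `^ p * `|(Q - 2) / Q| `^ p = (`|Q - m| / (p * (Q / (Q - 2)))) `^ p.
    rewrite -powRM//; congr (_ `^ _).
    rewrite !normrM !normfV (gtr0_norm p0) (gtr0_norm Q0) (gtr0_norm Qm20).
    by field; rewrite !gt_eqF.
  apply: hk => // s s0 s1; rewrite divfK ?gt_eqF//.
  rewrite -/m; set a := (Q - m) ^+ 2 in am *; set q := Q ^+ 2 in am *.
  have q0 : 0 <= q by exact: sqr_ge0.
  have ss : s ^+ 2 <= 1 by rewrite expr_le1.
  rewrite -subr_ge0 (_ : _ - _ = (1 - s) * ((3 / 2 * q - a) * (s * (1 + s)) +
     q * ((1 - s) / 2 + (1 - s ^+ 2) / 2))); last by field.
  apply: mulr_ge0; first by rewrite subr_ge0.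
  apply: addr_ge0; first by rewrite mulr_ge0 ?subr_ge0// mulr_ge0// addr_ge0.
  by apply: mulr_ge0 => //; lra.
rewrite -ltNge => am.
set a := (Q - m) ^+ 2 in am.
pose B := m * (m - 2 * Q).
have BE : B = a - Q ^+ 2 by rewrite /B /a; ring.
have q0 : 0 < Q ^+ 2 by rewrite exprn_gt0.
have B0 : 0 < B by rewrite BE; lra.
have -> : 3 * p * theta * (m - 2 * Q) = 3 * B by rewrite /B /m; ring.
pose A := `|m - Q|.
have A2 : A ^+ 2 = a by rewrite /A real_normK ?num_real// /a; ring.
have A0 : 0 < A by rewrite normr_gt0; apply: contraTneq am => mQ; rewrite /a
  -[Q - m]opprB mQ oppr0 expr0n/= -leNgt mulr_ge0// ltW.
pose X := (3 / 2) `^ 2^-1 * (3 * B) `^ 4^-1 / A `^ 2^-1 * ((Q - 2) / p).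
have X0 : 0 < X.
  apply: mulr_gt0; last by rewrite divr_gt0.
  apply: divr_gt0; last exact: powR_gt0.
  by apply: mulr_gt0; apply: powR_gt0; [lra|exact: mulr_gt0].
have -> : (3 / 2) `^ (p / 2) * (3 * B) `^ (p / 4) / `|m - Q| `^ (p / 2) * `|(Q - 2) / p| `^ p
   = X `^ p.
  have X1 : 0 <= (3 / 2) `^ 2^-1 * (3 * B) `^ 4^-1 by rewrite mulr_ge0 ?powR_ge0.
  have V0 : 0 <= (A `^ 2^-1)^-1 by rewrite invr_ge0 powR_ge0.
  have Z0 : 0 <= (Q - 2) / p by rewrite divr_ge0 ?ltW.
  rewrite /X (powRM _ (mulr_ge0 X1 V0) Z0) (powRM _ X1 V0).
  rewrite (powRM _ (powR_ge0 _ _) (powR_ge0 _ _)).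
  rewrite -(powR_inv1 (powR_ge0 A _)) -!powRrM -/A.
  rewrite ger0_norm ?divr_ge0 ?ltW// -powRN.
  by congr (_ `^ _ * _ `^ _ * _ `^ _ * _); ring.
(* [K] is read off from the claimed constant [X] by solving [X = |Q - m| / (p K)]; it remains to
   recognise it as the critical value. *)
have KE : X = `|Q - m| / (p * (A / (p * X))).
  by rewrite distrC -/A; field; rewrite !gt_eqF.
rewrite KE; apply: hk => //.
  by rewrite divr_gt0// mulr_gt0.
move=> s s0 s1; rewrite -/m -/a.
have -> : Q ^+ 2 * s ^+ 2 + a * (1 - s ^+ 2) = a - B * s ^+ 2 by rewrite BE; ring.
pose c := Num.sqrt (3 * B).
have c0 : 0 < c by rewrite sqrtr_gt0 mulr_gt0.
have c2 : c ^+ 2 = 3 * B by rewrite sqr_sqrtr// ltW// mulr_gt0.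
have X2 : (X * p / (Q - 2)) ^+ 2 = 3 / 2 * c / A.
  have -> : X * p / (Q - 2) = (3 / 2) `^ 2^-1 * (3 * B) `^ 4^-1 / A `^ 2^-1.
    by rewrite /X; field; rewrite !gt_eqF ?powR_gt0.
  rewrite exprMn exprMn exprVn powR_quarter_sqr ?(ltW (mulr_gt0 _ B0))//.
  by rewrite !powR12_sqrt ?sqr_sqrtr ?(ltW A0)//; lra.
have -> : (A / (p * X) * (Q - 2)) ^+ 2 = A ^+ 2 / (X * p / (Q - 2)) ^+ 2.
  by field; rewrite !gt_eqF.
rewrite X2.
(* [r] maximises [a s - B s^3] over [s >= 0]. *)
have [r r0 rA] : exists2 r, 0 < r & A = r * c.
  by exists (A / c); [rewrite divr_gt0|rewrite divfK// gt_eqF].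
have -> : A ^+ 2 / (3 / 2 * c / A) = 2 * B * r ^+ 3.
  have -> : B = c ^+ 2 / 3 by rewrite c2; field.
  by rewrite rA; field; rewrite !gt_eqF.
have -> : a = 3 * B * r ^+ 2 by rewrite -A2 rA exprMn c2; ring.
rewrite -subr_ge0 (_ : _ - _ = B * (s - r) ^+ 2 * (s + 2 * r)); last by ring.
apply: mulr_ge0; first by rewrite mulr_ge0 ?sqr_ge0// ltW.
by rewrite addr_ge0// mulr_ge0// ltW.
Qed.

(** * The Carnot-Caratheodory profile *)

Section TrigBounds.
Context {R : realType}.
Implicit Types x y c : R.

Lemma gt0_deriv (F dF : R -> R) x : (forall y : R, is_derive y 1 F (dF y)) ->
  F 0 = 0 -> 0 < x -> (forall y, 0 < y -> y < x -> 0 < dF y) -> 0 < F x.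
Proof.
move=> dF1 F0 x0 dF0.
have [|c] := MVT x0 (fun y _ => dF1 y).
  exact/continuous_subspaceT/(derive_cont _ _ dF1).
by rewrite in_itv/= subr0 F0 subr0 => /andP[c0 cx] ->; rewrite mulr_gt0// dF0.
Qed.

Lemma ge0_deriv (F dF : R -> R) x : (forall y : R, is_derive y 1 F (dF y)) ->
  F 0 = 0 -> 0 <= x -> (forall y, 0 <= y -> 0 <= dF y) -> 0 <= F x.
Proof.
move=> dF1 F0 x0 dF0.
have [|c] := MVT_segment x0 (fun y _ => dF1 y).
  exact/continuous_subspaceT/(derive_cont _ _ dF1).
by rewrite in_itv/= subr0 F0 subr0 => /andP[c0 cx] ->; rewrite mulr_ge0// dF0.
Qed.

(** Starting from [cos <= 1], the Taylor bounds for sine and cosine are integrated one from another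
    through [ge0_deriv]. *)
Lemma sin_le_id x : 0 <= x -> sin x <= x.
Proof.
move=> x0; rewrite -subr_ge0.
have D : forall y : R, is_derive y 1 (fun x => x - sin x) ((fun x => 1 - cos x) y).
  by move=> y; apply: is_derive_eq.
apply: (ge0_deriv _ _ _ D) => //.
by rewrite sin0 subr0.
Qed.

Lemma cos_ge2 x : 0 <= x -> 1 - x ^+ 2 / 2 <= cos x.
Proof.
move=> x0; rewrite -subr_ge0.
have D : forall y : R, is_derive y 1 (fun x => cos x - (1 - x ^+ 2 / 2))
    ((fun x => x - sin x) y).
  by move=> y; apply: is_derive_eq; rewrite /GRing.scale/=; field.
apply: (ge0_deriv _ _ _ D) => //.
- by rewrite cos0; field.
- by move=> y y0; rewrite subr_ge0 sin_le_id.
Qed.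

Lemma sin_ge3 x : 0 <= x -> x - x ^+ 3 / 6 <= sin x.
Proof.
move=> x0; rewrite -subr_ge0.
have D : forall y : R, is_derive y 1 (fun x => sin x - (x - x ^+ 3 / 6))
    ((fun x => cos x - (1 - x ^+ 2 / 2)) y).
  by move=> y; apply: is_derive_eq; rewrite /GRing.scale/=; field.
apply: (ge0_deriv _ _ _ D) => //.
- by rewrite sin0; field.
- by move=> y y0; rewrite subr_ge0 cos_ge2.
Qed.

Lemma cos_le4 x : 0 <= x -> cos x <= 1 - x ^+ 2 / 2 + x ^+ 4 / 24.
Proof.
move=> x0; rewrite -subr_ge0.
have D : forall y : R, is_derive y 1 (fun x => 1 - x ^+ 2 / 2 + x ^+ 4 / 24 - cos x)
    ((fun x => sin x - (x - x ^+ 3 / 6)) y).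
  by move=> y; apply: is_derive_eq; rewrite /GRing.scale/=; field.
apply: (ge0_deriv _ _ _ D) => //.
- by rewrite cos0; field.
- by move=> y y0; rewrite subr_ge0 sin_ge3.
Qed.

Lemma sin_le5 x : 0 <= x -> sin x <= x - x ^+ 3 / 6 + x ^+ 5 / 120.
Proof.
move=> x0; rewrite -subr_ge0.
have D : forall y : R, is_derive y 1 (fun x => x - x ^+ 3 / 6 + x ^+ 5 / 120 - sin x)
    ((fun x => 1 - x ^+ 2 / 2 + x ^+ 4 / 24 - cos x) y).
  by move=> y; apply: is_derive_eq; rewrite /GRing.scale/=; field.
apply: (ge0_deriv _ _ _ D) => //.
- by rewrite sin0; field.
- by move=> y y0; rewrite subr_ge0 cos_le4.
Qed.

Lemma sinc_defect_gt0 x : 0 < x -> x < pi -> 0 < sin x - x * cos x.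
Proof.
move=> x0 xpi.
have D : forall y : R, is_derive y 1 (fun x => sin x - x * cos x)
    ((fun x => x * sin x) y).
  by move=> y; apply: is_derive_eq; rewrite /GRing.scale/=; ring.
apply: (gt0_deriv _ _ _ D) => //.
- by rewrite sin0 mul0r subr0.
- by move=> y y0 yx; rewrite mulr_gt0// sin_gt0_pi// y0 (lt_trans yx).
Qed.

Lemma sinc_defect_bounds x : 0 <= x ->
  x ^+ 3 / 3 - x ^+ 5 / 30 <= sin x - x * cos x <= x ^+ 3 / 3.
Proof.
move=> x0; apply/andP; split; rewrite -subr_ge0.
- have D : forall y : R, is_derive y 1 (fun x => sin x - x * cos x - (x ^+ 3 / 3 - x ^+ 5 / 30))
      ((fun x => x * (sin x - (x - x ^+ 3 / 6))) y).
    by move=> y; apply: is_derive_eq; rewrite /GRing.scale/=; field.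
  apply: (ge0_deriv _ _ _ D) => //.
  + by rewrite sin0; field.
  + by move=> y y0; rewrite mulr_ge0// subr_ge0 sin_ge3.
- have D : forall y : R, is_derive y 1 (fun x => x ^+ 3 / 3 - (sin x - x * cos x))
      ((fun x => x * (x - sin x)) y).
    by move=> y; apply: is_derive_eq; rewrite /GRing.scale/=; field.
  apply: (ge0_deriv _ _ _ D) => //.
  + by rewrite sin0; field.
  + by move=> y y0; rewrite mulr_ge0// subr_ge0 sin_le_id.
Qed.

(** The expression is half of [2 x - sin (2 x)], so the Taylor bounds of sine at [2 x] apply. *)
Lemma segment_area_bounds x : 0 <= x ->
  2 / 3 * x ^+ 3 - 2 / 15 * x ^+ 5 <= x - sin x * cos x <= 2 / 3 * x ^+ 3.
Proof.
move=> x0; have x20 : 0 <= 2 * x by rewrite mulr_ge0.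
have := sin_ge3 _ x20; have := sin_le5 _ x20.
rewrite (_ : 2 * x = x + x) ?sinD; last by ring.
by move=> H1 H2; apply/andP; split; nra.
Qed.

(** Otherwise [sqrt 3 <= pi / 2] and [cos (sqrt 3) >= 0], whereas the Taylor bound of degree 4 gives
    at most [1 - 3/2 + 9/24 = - 1/8]. This makes the denominator [12 - pi^2] of the threshold
    positive. *)
Lemma pi_lt_sqrt12 : (pi : R) ^+ 2 < 12.
Proof.
pose x : R := pi / 2.
have x0 : 0 < x by rewrite divr_gt0 ?pi_gt0.
have cx : cos x = 0 by rewrite /x cos_pihalf.
rewrite ltNge; apply/negP => H.
have x2 : 3 <= x ^+ 2 by rewrite /x; lra.
pose s : R := Num.sqrt 3.
have s0 : 0 <= s by exact: sqrtr_ge0.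
have s2 : s ^+ 2 = 3 by rewrite sqr_sqrtr.
have sx : s <= x by rewrite -ler_sqr ?nnegrE ?(ltW x0)// s2.
have cs : 0 <= cos s.
  apply: cos_ge0_pihalf; rewrite sx andbT; apply: le_trans s0.
  by rewrite oppr_le0 ltW.
have s4 : s ^+ 4 = 9 by rewrite -[4%N]/(2 * 2)%N exprM s2; ring.
by have := cos_le4 s s0; rewrite s4 s2; lra.
Qed.

(** A smaller [pi] would give [cos (pi / 4) >= 1 - (61/80)^2 / 2 > 17/24], and [(17/24)^2] exceeds
    [cos^2 (pi / 4) = 1/2]. *)
Lemma pi_ge305 : 61 / 20 <= (pi : R).
Proof.
rewrite leNgt; apply/negP => H.
pose x : R := pi / 4.
have x0 : 0 <= x by rewrite divr_ge0 ?pi_ge0.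
have xx : x < 61 / 80 by rewrite /x; lra.
have c2 : cos x ^+ 2 = 1 / 2.
  have := cosD x x; rewrite (_ : x + x = pi / 2) ?cos_pihalf; last by rewrite /x; field.
  by have := sin2cos2 x; rewrite -!expr2 => ->; lra.
have := cos_ge2 x x0.
have x2 : x ^+ 2 <= (61 / 80) ^+ 2 by rewrite ler_sqr ?nnegrE//; lra.
move: (cos x) c2 => c c2 cx.
have c71 : 17 / 24 <= c by lra.
have : (17 / 24) ^+ 2 <= c ^+ 2 by rewrite ler_sqr ?nnegrE//; lra.
by rewrite c2; lra.
Qed.

End TrigBounds.

(** * Height of a circular arc as a function of its half-angle *)

Section ArcProfile.
Context {R : realType}.
Implicit Types c x y : R.

(* For a circular arc of angle [2 c], [mu c] is the ratio of the height [t] of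
   its horizontal lift to the square of its chord. *)
Definition mu c : R := if c == 0 then 0 else (c - sin c * cos c) / sin c ^+ 2.

Definition dmu c : R :=
  if c == 0 then 2 / 3 else 2 * (sin c - c * cos c) / sin c ^+ 3.

Lemma mu0 : mu 0 = 0.
Proof. by rewrite /mu eqxx. Qed.

Lemma muN c : mu (- c) = - mu c.
Proof.
rewrite /mu oppr_eq0; case: eqVneq => [_|c0]; first by rewrite oppr0.
by rewrite sinN cosN sqrrN -[RHS]mulNr; congr (_ * _); ring.
Qed.

Lemma dmuN c : dmu (- c) = dmu c.
Proof.
rewrite /dmu oppr_eq0; case: eqVneq => [//|c0]; rewrite sinN cosN.
by rewrite (_ : (- sin c) ^+ 3 = - sin c ^+ 3) ?invrN ?mulrN -?mulNr;
  [congr (_ * _); ring|ring].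
Qed.

Lemma sin_neq0 c : - pi < c -> c < pi -> c != 0 -> sin c != 0.
Proof.
move=> c1 c2 c0; have [cn|cp|] := ltgtP c 0; last by move/eqP: c0.
- rewrite -oppr_eq0 -sinN gt_eqF// sin_gt0_pi// oppr_gt0 cn/=; lra.
- by rewrite gt_eqF// sin_gt0_pi// cp.
Qed.

Lemma dmu_gt0 c : - pi < c -> c < pi -> 0 < dmu c.
Proof.
wlog c0 : c / 0 <= c => [H|_ cpi].
  have [/H//|c0 c1 c2] := leP 0 c; rewrite -dmuN; apply: H; lra.
rewrite /dmu; case: eqVneq => [_|cn0]; first by rewrite divr_gt0.
have cp : 0 < c by rewrite lt_def cn0.
rewrite divr_gt0 ?exprn_gt0 ?sin_gt0_pi ?cp// mulr_gt0//.
exact: sinc_defect_gt0.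
Qed.

Lemma sin_small_bounds c : 0 < c -> c <= 1 ->
  [/\ 0 < c * (1 - c ^+ 2 / 6), c * (1 - c ^+ 2 / 6) <= sin c & sin c <= c].
Proof.
move=> c0 c1; have c2 : c ^+ 2 <= 1 by rewrite expr_le1// ltW.
split; last by rewrite sin_le_id// ltW.
- by rewrite mulr_gt0//; lra.
- by have := sin_ge3 c (ltW c0); apply: le_trans; rewrite le_eqVlt; apply/orP; left;
    apply/eqP; field.
Qed.

(** The formula for [mu] is 0/0 at the origin; this expansion supplies the derivative there, and
    [dmu_near0] its continuity. *)
Lemma mu_near0 c : c != 0 -> `|c| <= 1 -> `|mu c / c - 2 / 3| <= c ^+ 2.
Proof.
wlog c0 : c / 0 < c => [H|cn0].
  move=> cn0 c1; have [/H//|] := ltP 0 c; first exact.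
  rewrite le_eqVlt (negbTE cn0)/= => c0.
  have := H (- c); rewrite muN invrN mulrNN sqrrN normrN oppr_gt0 oppr_eq0; exact.
rewrite gtr0_norm// => c1.
have [s0 s1 s2] := sin_small_bounds c c0 c1.
have sp : 0 < sin c by exact: lt_le_trans s1.
have /andP[N1 N2] := segment_area_bounds c (ltW c0).
rewrite /mu gt_eqF//.
set u := c ^+ 2 in s0 s1 *; have u0 : 0 <= u by exact: sqr_ge0.
have u1 : u <= 1 by rewrite expr_le1// ltW.
have N3 : (2 / 3 - 2 / 15 * u) * c * sin c ^+ 2 <= c - sin c * cos c.
  apply: le_trans N1.
  have -> : 2 / 3 * c ^+ 3 - 2 / 15 * c ^+ 5 = (2 / 3 - 2 / 15 * u) * c * c ^+ 2.
    by rewrite /u; ring.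
  apply: ler_wpM2l; first by rewrite mulr_ge0 ?(ltW c0)//; lra.
  by rewrite ler_sqr ?nnegrE ?(ltW sp) ?(ltW s0) ?(ltW c0).
have N4 : c - sin c * cos c <= (2 / 3 + u / 3) * c * sin c ^+ 2.
  apply: le_trans N2 _; apply: (@le_trans _ _ ((2 / 3 + u / 3) * c * (c * (1 - u / 6)) ^+ 2)).
    have -> : (2 / 3 + u / 3) * c * (c * (1 - u / 6)) ^+ 2 =
       ((2 / 3 + u / 3) * (1 - u / 6) ^+ 2) * c ^+ 3 by ring.
    rewrite ler_wpM2r ?exprn_ge0 ?(ltW c0)//.
    by nra.
  apply: ler_wpM2l; first by rewrite mulr_ge0 ?(ltW c0)//; lra.
  by rewrite ler_sqr ?nnegrE ?(ltW sp) ?(ltW s0) ?(ltW c0).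
have s20 : 0 < sin c ^+ 2 by rewrite exprn_gt0.
have A : (2 / 3 - 2 / 15 * u) <= (c - sin c * cos c) / sin c ^+ 2 / c.
  by rewrite ler_pdivlMr// ler_pdivlMr.
have B : (c - sin c * cos c) / sin c ^+ 2 / c <= 2 / 3 + u / 3.
  by rewrite ler_pdivrMr// ler_pdivrMr.
by rewrite ler_norml; apply/andP; split; lra.
Qed.

Lemma dmu_near0 c : `|c| <= 1 -> `|dmu c - 2 / 3| <= c ^+ 2.
Proof.
wlog c0 : c / 0 <= c => [H|].
  have [/H//|c0 c1] := leP 0 c.
  by have := H (- c); rewrite dmuN normrN sqrrN oppr_ge0 (ltW c0); exact.
rewrite ger0_norm// => c1; rewrite /dmu; case: eqVneq => [->|cn0].
  by rewrite subrr normr0 expr0n.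
have {}c0 : 0 < c by rewrite lt_def cn0.
have [s0 s1 s2] := sin_small_bounds c c0 c1.
have sp : 0 < sin c by exact: lt_le_trans s1.
have /andP[N1 N2] := sinc_defect_bounds c (ltW c0).
set u := c ^+ 2 in s0 s1 *; have u0 : 0 <= u by exact: sqr_ge0.
have u1 : u <= 1 by rewrite expr_le1// ltW.
have s30 : 0 < sin c ^+ 3 by rewrite exprn_gt0.
have N3 : (2 / 3 - u / 15) * sin c ^+ 3 <= 2 * (sin c - c * cos c).
  apply: (@le_trans _ _ ((2 / 3 - u / 15) * c ^+ 3)).
    apply: ler_wpM2l; first by lra.
    by rewrite lerXn2r ?nnegrE ?(ltW sp) ?(ltW s0) ?(ltW c0).
  apply: le_trans (ler_wpM2l _ N1) => //.
  by rewrite le_eqVlt; apply/orP; left; apply/eqP; rewrite /u; field.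
have N4 : 2 * (sin c - c * cos c) <= (2 / 3 + u) * sin c ^+ 3.
  apply: le_trans (ler_wpM2l _ N2) _ => //.
  apply: (@le_trans _ _ ((2 / 3 + u) * (c * (1 - u / 6)) ^+ 3)).
    have -> : (2 / 3 + u) * (c * (1 - u / 6)) ^+ 3 =
       ((2 / 3 + u) * (1 - u / 6) ^+ 3) * c ^+ 3 by ring.
    rewrite mulrCA mulrC ler_wpM2r ?exprn_ge0 ?(ltW c0)//.
    have b : 1 - u / 2 <= (1 - u / 6) ^+ 3.
      rewrite -subr_ge0 (_ : _ - _ = u ^+ 2 * (18 - u) / 216); last by field.
      by rewrite divr_ge0// mulr_ge0 ?sqr_ge0//; lra.
    have : (2 / 3 + u) * (1 - u / 2) <= (2 / 3 + u) * (1 - u / 6) ^+ 3.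
      by apply: ler_wpM2l => //; lra.
    by apply: le_trans; nra.
  apply: ler_wpM2l; first by lra.
  by rewrite lerXn2r ?nnegrE ?(ltW sp) ?(ltW s0) ?(ltW c0).
rewrite ler_norml; apply/andP; split.
- rewrite lerBrDr ler_pdivlMr//; apply: le_trans N3.
  by apply: ler_wpM2r; [exact: ltW|lra].
- by rewrite lerBlDr ler_pdivrMr// [u + _]addrC.
Qed.

Lemma nbhs_neq0 c : c != 0 -> \forall x \near c, x != 0.
Proof.
move=> c0; apply/nbhs_ballP; exists `|c|; first by rewrite /= normr_gt0.
by move=> x; rewrite /ball/=; apply: contraTneq => ->; rewrite subr0 ltxx.
Qed.

Lemma is_derive_mu c : - pi < c -> c < pi -> is_derive c 1 mu (dmu c).
Proof.
move=> c1 c2; have [->|c0] := eqVneq c 0.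
  have cvD : h^-1 *: (mu (h *: 1 + 0) - mu 0) @[h --> 0^'] --> (2 / 3 : R).
    apply/cvgrPdist_lt => e e0; near=> h.
    have h0 : h != 0 by near: h; exact: nbhs_dnbhs_neq.
    have h1 : `|h| < 1 by near: h; exact: dnbhs0_lt.
    have h2 : `|h| < e by near: h; exact: dnbhs0_lt.
    have -> : h *: 1 + 0 = h by rewrite addr0 /GRing.scale/= mulr1.
    rewrite mu0 subr0 /GRing.scale/= distrC [h^-1 * _]mulrC.
    apply: le_lt_trans (mu_near0 _ h0 (ltW h1)) _.
    rewrite -real_normK ?num_real// expr2; apply: le_lt_trans h2.
    by rewrite ler_piMl// ltW.
  rewrite /dmu eqxx.
  by apply: DeriveDef; [apply/cvg_ex; exists (2 / 3)|exact/cvg_lim].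
have s0 := sin_neq0 c c1 c2 c0.
have E : \forall x \near c, (x - sin x * cos x) / sin x ^+ 2 = mu x.
  have : \forall x \near c, x != 0 by exact: nbhs_neq0.
  by apply: filterS => x x0; rewrite /mu (negbTE x0).
apply: (near_eq_is_derive E).
have dN : is_derive c 1 (fun x => x - sin x * cos x) (2 * sin c ^+ 2).
  apply: is_derive_eq; rewrite /GRing.scale/=.
  by have := cos2Dsin2 c; move: (cos c) (sin c) => C S H;
    rewrite -[in X in X - _]H; ring.
have dS : is_derive c 1 (fun x => sin x ^+ 2) (2 * sin c * cos c).
  by apply: is_derive_eq; rewrite /GRing.scale/=; ring.
have s20 : sin c ^+ 2 != 0 by rewrite expf_neq0.
apply: (dM dN (dV (g := fun x => sin x ^+ 2) s20 dS erefl)); rewrite /dmu (negbTE c0).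
have H := cos2Dsin2 c; apply/eqP; rewrite -subr_eq0; apply/eqP.
set S := sin c in s0 H *; set C := cos c in H *.
transitivity (2 * (1 - (C ^+ 2 + S ^+ 2)) / S ^+ 2); last by rewrite H subrr mulr0 mul0r.
by field.
Unshelve. all: by end_near. Qed.

Lemma cont_dmu c : - pi < c -> c < pi -> {for c, continuous dmu}.
Proof.
move=> c1 c2; have [->|c0] := eqVneq c 0.
  apply/cvgrPdist_lt => e e0; near=> h.
  have h1 : `|h| < 1.
    by near: h; apply/nbhs_ballP; exists 1 => //= x; rewrite /ball/= sub0r normrN.
  have h2 : `|h| < e.
    by near: h; apply/nbhs_ballP; exists e => //= x; rewrite /ball/= sub0r normrN.
  rewrite {1}/dmu eqxx distrC.
  apply: le_lt_trans (dmu_near0 _ (ltW h1)) _.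
  rewrite -real_normK ?num_real// expr2; apply: le_lt_trans h2.
  by rewrite ler_piMl// ltW.
have s0 := sin_neq0 c c1 c2 c0.
pose F x : R := 2 * (sin x - x * cos x) / sin x ^+ 3.
have E : \forall x \near c, F x = dmu x.
  have : \forall x \near c, x != 0 by exact: nbhs_neq0.
  by apply: filterS => x x0; rewrite /dmu (negbTE x0).
have Fc : F c = dmu c by rewrite /dmu (negbTE c0).
rewrite /prop_for /continuous_at -Fc; apply: (cvg_trans (near_eq_cvg E)).
apply: (@continuousM _ _ (fun x => 2 * (sin x - x * cos x)) (fun x => (sin x ^+ 3)^-1)).
  apply: (derive_cont1 (fun x => 2 * (sin x - x * cos x)) c).
apply: (@continuousV _ _ (fun x => sin x ^+ 3)); first by rewrite expf_neq0.
apply: (derive_cont1 (fun x => sin x ^+ 3) c).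
Unshelve. all: by end_near. Qed.

End ArcProfile.

(** * The half-angle and the profile as functions of the height *)

Section ArcInverse.
Context {R : realType}.
Implicit Types c x y : R.

Lemma mu_surj y : exists c, [/\ - pi < c, c < pi & mu c = y].
Proof.
have pi0 := @pi_gt0 R.
wlog y0 : y / 0 <= y => [H|].
  have [/H//|y0] := leP 0 y.
  have [|c [c1 c2 cy]] := H (- y); first by rewrite oppr_ge0 ltW.
  exists (- c); rewrite muN cy opprK; split => //; lra.
have [->|yn0] := eqVneq y 0; first by exists 0; rewrite mu0; split => //; lra.
have {yn0}y0 : 0 < y by rewrite lt_def yn0.
(* A positive left endpoint keeps the root away from the trivial zero [c = 0]. At [c0] the function
   is at most 0 because [c - sin c cos c <= 2/3 c^3], while [sin c >= 5/6 c] and [c0 <= y] give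
   [y sin^2 c >= 25/36 c^3]. *)
pose c0 := Num.min 1 y.
have c00 : 0 < c0 by rewrite lt_min ltr01.
have c01 : c0 <= 1 by rewrite ge_min lexx.
have c0y : c0 <= y by rewrite ge_min lexx orbT.
have c0pi : c0 <= pi by have := @pi_ge2 R; lra.
pose F c : R := c - sin c * cos c - y * sin c ^+ 2.
have cF : continuous F.
  have cid' : continuous (fun c : R => c) by move=> x; exact: cvg_id.
  have cs := @continuous_sin R; have cc := @continuous_cos R.
  exact: (cB (cB cid' (cM cs cc)) (cM (ccst y) (cX 2 cs))).
have Fpi : F pi = pi by rewrite /F sinpi mul0r expr0n mulr0 !subr0.
have Fc0 : F c0 <= 0.
  have [s0 s1 s2] := sin_small_bounds c0 c00 c01.
  have /andP[_ N2] := segment_area_bounds c0 (ltW c00).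
  have u1 : c0 ^+ 2 <= 1 by rewrite expr_le1// ltW.
  have s3 : c0 * (5 / 6) <= sin c0.
    by apply: le_trans s1; rewrite ler_pM2l//; lra.
  have s4 : c0 ^+ 2 * (25 / 36) <= sin c0 ^+ 2.
    rewrite (_ : _ * _ = (c0 * (5 / 6)) ^+ 2); last by field.
    have p1 : 0 <= c0 * (5 / 6) by rewrite mulr_ge0// ltW.
    by rewrite ler_sqr ?nnegrE// (le_trans p1 s3).
  have s5 : c0 * (c0 ^+ 2 * (25 / 36)) <= y * sin c0 ^+ 2.
    by apply: ler_pM => //; [exact: ltW|rewrite mulr_ge0 ?sqr_ge0].
  have c3 : 0 < c0 ^+ 3 by rewrite exprn_gt0.
  have e3 : c0 * (c0 ^+ 2 * (25 / 36)) = c0 ^+ 3 * (25 / 36) by ring.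
  rewrite /F; lra.
have [||c] := @IVT R F c0 pi 0 c0pi; first exact: continuous_subspaceT.
  by rewrite Fpi ge_min Fc0/= le_max (ltW pi0) orbT.
rewrite in_itv/= => /andP[cc0 cpi] Fc.
have {}cpi : c < pi.
  rewrite lt_neqAle cpi andbT; apply/eqP => E.
  by move: Fc; rewrite E Fpi => /eqP; rewrite gt_eqF.
have cp : 0 < c by exact: lt_le_trans cc0.
have c1 : - pi < c by rewrite (lt_trans _ cp)// oppr_lt0.
exists c; split => //; rewrite /mu gt_eqF//.
have s0 : sin c != 0 by rewrite sin_neq0// gt_eqF.
move: Fc; rewrite /F => /eqP; rewrite subr_eq0 => /eqP ->.
by rewrite mulfK// expf_neq0.
Qed.

Lemma mu_lt (a b : R) : - pi < a -> a < b -> b < pi -> mu a < mu b.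
Proof.
move=> a1 ab b1.
have [c cab||c] := @MVT R mu dmu a b ab.
- by move: cab; rewrite in_itv/= => /andP[ac cb]; apply: is_derive_mu; lra.
- apply: continuous_in_subspaceT => c; rewrite inE/= in_itv/= => /andP[ac cb].
  by apply: derive_cont1; apply: is_derive_mu; lra.
rewrite in_itv/= => /andP[ac cb] E.
rewrite -subr_gt0 E mulr_gt0 ?subr_gt0//.
by apply: dmu_gt0; lra.
Qed.

Definition half_angle y : R := sval (cid (mu_surj y)).

Lemma half_angleP y :
  [/\ - pi < half_angle y, half_angle y < pi & mu (half_angle y) = y].
Proof. exact: (svalP (cid (mu_surj y))). Qed.

Lemma half_angleK c : - pi < c -> c < pi -> half_angle (mu c) = c.
Proof.
move=> c1 c2; have [h1 h2 h3] := half_angleP (mu c).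
have [hc|hc|//] := ltgtP (half_angle (mu c)) c.
- by have := mu_lt _ _ h1 hc c2; rewrite h3 ltxx.
- by have := mu_lt _ _ c1 hc h2; rewrite h3 ltxx.
Qed.

Lemma is_derive_half_angle y :
  is_derive y 1 half_angle (dmu (half_angle y))^-1.
Proof.
have [h1 h2 h3] := half_angleP y.
have nb : \forall c \near half_angle y, - pi < c /\ c < pi.
  near=> c; split; near: c; [exact: lt_nbhsr|exact: lt_nbhsl].
rewrite -{1}h3; apply: is_derive_inverse.
- by apply: filterS nb => c [c1 c2]; exact: half_angleK.
- by apply: filterS nb => c [c1 c2]; apply: derive_cont1; exact: is_derive_mu.
- exact: is_derive_mu.
- by rewrite gt_eqF// dmu_gt0.
Unshelve. all: by end_near. Qed.

Lemma cont_half_angle : continuous half_angle.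
Proof. exact: (derive_cont _ _ is_derive_half_angle). Qed.

Lemma cont_dhalf_angle : continuous (fun y => (dmu (half_angle y))^-1).
Proof.
move=> y; have [h1 h2 h3] := half_angleP y.
apply: (@continuousV _ _ (fun y => dmu (half_angle y))).
  by rewrite gt_eqF// dmu_gt0.
apply: (@continuous_comp _ _ _ half_angle dmu); first exact: cont_half_angle.
exact: cont_dmu.
Qed.

Lemma half_angle_eq y :
  y * sin (half_angle y) ^+ 2 = half_angle y - sin (half_angle y) * cos (half_angle y).
Proof.
have [h1 h2 h3] := half_angleP y; rewrite -{1}h3 /mu.
case: eqVneq => [->|c0]; first by rewrite sin0 !mul0r subr0.
by rewrite divfK// expf_neq0// sin_neq0.
Qed.

Lemma half_angle_eq0 y : half_angle y = 0 -> y = 0.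
Proof. by have [_ _] := half_angleP y; move=> + c0; rewrite c0 mu0. Qed.

(** The ratio [c / sin c] of arc to chord, in a form that makes sense at [c = 0]; see
    [profile_sin]. *)
Definition profile y : R := cos (half_angle y) + y * sin (half_angle y).

Lemma profile_sin y : profile y * sin (half_angle y) = half_angle y.
Proof. by rewrite /profile mulrDl -mulrA -expr2 half_angle_eq; ring. Qed.

Lemma profile_sqr y :
  profile y ^+ 2 = half_angle y * y + profile y * cos (half_angle y).
Proof.
rewrite -{1}(profile_sin y) expr2 {2}/profile.
by ring.
Qed.

Lemma profile0 y : half_angle y = 0 -> profile y = 1.
Proof. by move=> c0; rewrite /profile c0 cos0 sin0 mulr0 addr0. Qed.

Lemma profile_ge1 y : 1 <= profile y.
Proof.
have [h1 h2 _] := half_angleP y; have := profile_sin y.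
have [c0|c0|c0] := ltgtP (half_angle y) 0; last by rewrite profile0.
- have s0 : 0 < sin (- half_angle y) by apply: sin_gt0_pi; apply/andP; split; lra.
  have := sin_le_id (- half_angle y); rewrite sinN in s0 *.
  by move=> /(_ _) A E; rewrite -(ler_pM2r s0) mul1r mulrN E; apply: A; lra.
- have s0 : 0 < sin (half_angle y) by apply: sin_gt0_pi; rewrite c0.
  have := sin_le_id (half_angle y) (ltW c0).
  by move=> A E; rewrite -(ler_pM2r s0) mul1r E.
Qed.

Lemma profile_gt0 y : 0 < profile y.
Proof. exact: lt_le_trans (profile_ge1 y). Qed.

(** Differentiation gives [sin c + c' (y cos c - sin c)]. The equation for [c] turns the bracket
    into [(c cos c - sin c) / sin^2 c], and its product with [c' = 1 / dmu c] is [- sin c / 2]. *)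
Lemma is_derive_profile y : is_derive y 1 profile (sin (half_angle y) / 2).
Proof.
have [h1 h2 h3] := half_angleP y.
have dh := is_derive_half_angle y.
have dc := dcomp (F := cos) dh (is_derive_cos _) erefl.
have ds := dcomp (F := sin) dh (is_derive_sin _) erefl.
apply: (dD dc (dM (is_derive_id y 1) ds erefl)).
set c := half_angle y in h1 h2 h3 *.
have [c0|c0] := eqVneq c 0.
  have y0 : y = 0 by exact: half_angle_eq0.
  by rewrite c0 y0 sin0; field; rewrite gt_eqF// dmu_gt0 ?oppr_lt0 ?pi_gt0.
have s0 : sin c != 0 by exact: sin_neq0.
have yE : y = (c - sin c * cos c) / sin c ^+ 2.
  by rewrite -half_angle_eq mulfK// expf_neq0.
have M0 : sin c - c * cos c != 0.
  by have := dmu_gt0 c h1 h2; rewrite /dmu (negbTE c0); apply: contraTneq => ->;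
    rewrite mulr0 mul0r ltxx.
rewrite [in RHS]yE /dmu (negbTE c0).
have H := cos2Dsin2 c.
move: (sin c) (cos c) s0 M0 H => S C s0 M0 H.
apply/eqP; rewrite -subr_eq0; apply/eqP.
transitivity (S / 2 * (S * (C ^+ 2 + S ^+ 2 - 1)) / (S - c * C)); last first.
  by rewrite H subrr !mulr0 mul0r.
by field; rewrite s0 M0.
Qed.

Lemma is_derive_dprofile y : is_derive y 1 (fun y => sin (half_angle y) / 2)
  (cos (half_angle y) * (dmu (half_angle y))^-1 / 2).
Proof.
have ds := dcomp (F := sin) (is_derive_half_angle y) (is_derive_sin _) erefl.
by apply: (dM ds (dcst 2^-1 y 1)); rewrite mulr0 addr0.
Qed.

Lemma cont_d2profile :
  continuous (fun y => cos (half_angle y) * (dmu (half_angle y))^-1 / 2).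
Proof.
apply: (cM (cM (ccomp cont_half_angle (@continuous_cos R)) cont_dhalf_angle)).
exact: ccst.
Qed.

(** The derivative of [d] in [|z|] is thus [cos c], while [2 |z| d_t d = 2 h' = sin c]; together
    they say that the horizontal gradient of [d] has length 1. *)
Lemma profile_eikonal y :
  profile y - 2 * y * (sin (half_angle y) / 2) = cos (half_angle y).
Proof. by rewrite /profile; field. Qed.

End ArcInverse.

(** * Lengths of horizontal curves *)

Section AbsolutelyContinuousGrowth.
Context {R : realType}.
Notation leb := (@lebesgue_measure R).
Implicit Types (f g : R -> R) (l : seq (R * R)).

Lemma abs_cont01_seq g e : abs_cont01 g -> 0 < e -> exists2 d, 0 < d &
  forall l, all (fun p => (0 <= p.1) && (p.1 < p.2) && (p.2 <= 1)) l ->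
    pairwise (fun p r => p.2 <= r.1) l -> \sum_(p <- l) (p.2 - p.1) < d ->
    \sum_(p <- l) `|g p.2 - g p.1| < e.
Proof.
move=> ac e0; have [d d0 H] := ac e e0; exists d => // l /allP l01 lpw.
rewrite !(big_nth (0, 0)) !big_mkord => ld.
apply: (H (size l) (fun i => (nth (0, 0) l i).1) (fun i => (nth (0, 0) l i).2)) => //.
- by move=> i; have := l01 _ (mem_nth (0, 0) (ltn_ord i)) => /andP[/andP[]].
- move=> i j ij; have /(pairwiseP (0, 0)) pw := lpw.
  have [lt|lt|/val_inj E] := ltngtP (i : nat) j; last by rewrite E eqxx in ij.
  + by left; apply: pw => //; rewrite inE.
  + by right; apply: pw => //; rewrite inE.
Qed.

(* Cover [Bad] by an open set [U] of small measure; real induction on [s] bounds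
   the growth of [f] on [[0, s]], collecting finitely many disjoint intervals in
   [U], over which absolute continuity of the [q i] controls [f]. *)
Lemma ac_growth f (k : nat) (q : 'I_k -> R -> R) (B : R) (Bad : set R) :
  (forall i, abs_cont01 (q i)) -> 0 <= B ->
  (forall s s', 0 <= s -> s < s' -> s' <= 1 ->
     f s' - f s <= B * \sum_(i < k) `|q i s' - q i s|) ->
  leb.-negligible Bad ->
  (forall s, 0 < s -> s < 1 -> ~ Bad s -> exists2 a, a <= 0 & is_derive s 1 f a) ->
  f 1 <= f 0.
Proof.
move=> acq B0 fB negB dfB.
suff main e : 0 < e -> f 1 - f 0 <= e * (1 + B * k%:R).
  have C0 : 0 < 1 + B * k%:R by rewrite ltr_pwDl// mulr_ge0.
  rewrite leNgt; apply/negP => f01.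
  have := main ((f 1 - f 0) / 2 / (1 + B * k%:R)).
  rewrite divfK ?gt_eqF// => /(_ _).
  by rewrite !divr_gt0 ?subr_gt0// => /(_ isT); lra.
move=> e0.
have [d d0 dl] : exists2 d, 0 < d & forall i l,
    all (fun p => (0 <= p.1) && (p.1 < p.2) && (p.2 <= 1)) l ->
    pairwise (fun p r => p.2 <= r.1) l -> \sum_(p <- l) (p.2 - p.1) < d ->
    \sum_(p <- l) `|q i p.2 - q i p.1| < e.
  have : \forall d \near 0^'+, forall i l,
      all (fun p => (0 <= p.1) && (p.1 < p.2) && (p.2 <= 1)) l ->
      pairwise (fun p r => p.2 <= r.1) l -> \sum_(p <- l) (p.2 - p.1) < d ->
      \sum_(p <- l) `|q i p.2 - q i p.1| < e.
    apply: filter_forall => i; have [di di0 Hi] := abs_cont01_seq (q i) e (acq i) e0.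
    near=> d => l l1 l2 ld; apply: Hi => //; apply: lt_le_trans ld _.
    by near: d; exact: nbhs_right_le.
  move=> H; have [d [d0 Hd]] := filter_ex (filterI (nbhs_right_gt (0 : R)) H).
  by exists d.
(* The endpoints are covered as well, since the derivative is controlled only in the open
   interval. *)
have [U [oU BU Ud]] : exists U : set R, [/\ open U, Bad `|` [set 0; 1] `<=` U &
    (leb U < d%:E)%E].
  have : leb.-negligible (Bad `|` [set 0; 1]).
    apply: negligibleU => //; apply: negligibleU; apply/negligibleP => //;
      exact: lebesgue_measure_set1.
  move=> [A [mA A0 BA]].
  have Ay : (leb A < +oo)%E by rewrite A0 ltry.
  have [U [oU AU UA]] := lebesgue_regularity_outer mA Ay d0.
  exists U; split => //; first exact: subset_trans AU.
  have -> : U = A `|` (U `\` A) by rewrite setDUK.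
  apply: (@le_lt_trans _ _ (leb A + leb (U `\` A))%E); last by rewrite A0 add0e.
  by apply: measureU2 => //; apply: measurableD => //; exact: open_measurable.
have mU : measurable U by exact: open_measurable.
pose P x := exists l, [/\ all (fun p => (0 <= p.1) && (p.1 < p.2) && (p.2 <= x)) l,
  pairwise (fun p r => p.2 <= r.1) l,
  ((\sum_(p <- l) (p.2 - p.1))%:E <= leb (U `&` `[0%R, x]))%E &
  f x - f 0 <= e * x + B * \sum_(p <- l) \sum_(i < k) `|q i p.2 - q i p.1|].
(* Two ways to advance: where the derivative is controlled, the growth is charged to [e (y - x)];
   inside [U], the interval is appended to the list and its length is charged to the measure of
   [U]. *)
have ext x y : 0 <= x -> x < y -> y <= 1 -> P x ->
    f y - f x <= e * (y - x) \/ `]x, y[%classic `<=` U -> P y.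
  move=> x0 xy y1 [l [l1 l2 l3 l4]] [fxy|xyU].
    exists l; split => //.
    - apply: sub_all l1 => p /andP[-> /le_trans]; apply; exact: ltW.
    - apply: (le_trans l3); apply: le_measure; rewrite ?inE.
      + by apply: measurableI => //; exact: measurable_itv.
      + by apply: measurableI => //; exact: measurable_itv.
      + move=> z [Uz]; rewrite /= !in_itv/= => /andP[z0 zx]; split => //.
        by rewrite z0 (le_trans zx)// ltW.
    - lra.
  exists (rcons l (x, y)); split.
  - rewrite all_rcons/= x0 xy lexx/=.
    apply: sub_all l1 => p /andP[-> /le_trans]; apply; exact: ltW.
  - rewrite pairwise_rcons l2 andbT; apply: sub_all l1 => p /andP[_]; exact.
  - rewrite big_rcons/= EFinD.
    have -> : (y - x)%:E = leb (`]x, y[%classic : set R).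
      by rewrite lebesgue_measure_itv/= lte_fin xy EFinB.
    apply: (le_trans (leeD l3 (le_refl _))).
    rewrite -measureU//.
    + apply: le_measure; rewrite ?inE.
      * by apply: measurableU; [apply: measurableI => //|]; exact: measurable_itv.
      * by apply: measurableI => //; exact: measurable_itv.
      * move=> z [[Uz]|]; rewrite /= !in_itv/= => /andP[z0 zx]; split => //;
          rewrite ?in_itv/= ?z0 ?(le_trans zx (ltW xy))//.
          by apply: xyU; rewrite /= in_itv/= z0 zx.
        by rewrite (le_trans x0 (ltW z0)) ltW.
    + by apply: measurableI => //; exact: measurable_itv.
    + rewrite -subset0 => z [[_]]; rewrite /= !in_itv/= => /andP[_ zx] /andP[].
      by rewrite ltNge zx.
  - rewrite big_rcons/= mulrDr.
    have := fB x y x0 xy y1; have : 0 <= e * (y - x).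
      by rewrite mulr_ge0 ?subr_ge0// ltW.
    move: l4; lra.
have P1 : P 1.
  pose S := [set x : R | 0 <= x <= 1 /\ P x].
  have S0 : S 0.
    split; first by rewrite lexx ler01.
    exists [::]; split => //; first by rewrite big_nil measure_ge0.
    by rewrite big_nil subrr mulr0 mulr0 addr0.
  have supS : has_sup S.
    by split; [exists 0|exists 1 => x [/andP[]]].
  pose c := sup S.
  have c0 : 0 <= c by exact: (ub_le_sup supS.2 S0).
  have c1 : c <= 1 by apply: ge_sup; [exists 0|move=> x [/andP[]]].
  (* Around the supremum [c] one of the two extensions is available on both sides: by openness if
     [c] is in [U], and by the derivative at [c] otherwise. Reaching [c] from the left and then
     passing it contradicts [c < 1]. *)
  have [r r0 [Hl Hr]] : exists2 r, 0 < r &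
      (forall x, c - r < x -> x < c -> 0 <= x -> P x -> P c) /\
      (forall y, c < y -> y < c + r -> y <= 1 -> P c -> P y).
    have [Uc|nUc] := pselect (U c).
      have /nbhs_ballP[r /= r0 rU] : nbhs c U by exact: open_nbhs_nbhs.
      exists r => //; split.
      - move=> x cx xc x0 Px; apply: (ext x c) => //; right => z.
        rewrite /= in_itv/= => /andP[xz zc]; apply: rU.
        by rewrite /ball/= gtr0_norm; lra.
      - move=> y cy yc y1 Pc; apply: (ext c y) => //; right => z.
        rewrite /= in_itv/= => /andP[cz zy]; apply: rU.
        by rewrite /ball/= ltr0_norm; lra.
    have [nB nc0 nc1] : [/\ ~ Bad c, c != 0 & c != 1].
      split; first by move=> Bc; apply: nUc; apply: BU; left.
        by apply/eqP => E; apply: nUc; apply: BU; right; left.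
      by apply/eqP => E; apply: nUc; apply: BU; right; right.
    have cp : 0 < c by rewrite lt_def nc0.
    have cl : c < 1 by rewrite lt_neqAle nc1.
    have [a a0 [df1 df2]] := dfB c cp cl nB.
    move: df1; rewrite /derivable => df1.
    have cv : (fun h : R => h^-1 *: (f (h *: 1 + c) - f c)) h @[h --> 0^'] --> a.
      by rewrite -df2 /derive.
    move/cvgrPdist_lt : cv => /(_ _ e0); rewrite near_withinE => /nbhs_ballP[r /= r0 Hr].
    have Hq h : `|h| < r -> h != 0 -> `|a - h^-1 * (f (h + c) - f c)| < e.
      move=> hr h0; have := Hr h _ h0; rewrite /ball/= sub0r normrN => /(_ hr).
      by rewrite /GRing.scale/= mulr1.
    exists r => //; split.
    - move=> x cx xc x0 Px; apply: (ext x c) => //; left.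
      have xc0 : 0 < c - x by rewrite subr_gt0.
      have := Hq (x - c); rewrite ltr0_norm ?subr_lt0// subrK => H.
      have {}H := H ltac:(lra) ltac:(by rewrite subr_eq0 lt_eqF).
      have E : (x - c)^-1 * (f x - f c) = (f c - f x) / (c - x).
        by rewrite -opprB invrN mulNr -mulrN opprB mulrC.
      move: H; rewrite E distrC => /(le_lt_trans (ler_norm _)) H.
      by rewrite -ler_pdivrMr//; lra.
    - move=> y cy yc y1 Pc; apply: (ext c y) => //; left.
      have yc0 : 0 < y - c by rewrite subr_gt0.
      have := Hq (y - c); rewrite gtr0_norm// subrK => H.
      have {}H := H ltac:(lra) ltac:(by rewrite gt_eqF).
      move: H; rewrite mulrC distrC => /(le_lt_trans (ler_norm _)) H.
      by rewrite -ler_pdivrMr//; lra.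
  have Pc : P c.
    have [x [/andP[x0 x1] Px] cx] := sup_adherent r0 supS.
    have : x <= c by apply: (ub_le_sup supS.2); split => //; rewrite x0.
    by rewrite le_eqVlt => /predU1P[<-//|xc]; exact: (Hl x).
  have [cE|cn] := eqVneq c 1; first by rewrite -cE.
  have cl : c < 1 by rewrite lt_neqAle cn.
  pose y := Num.min (c + r / 2) 1.
  have cy : c < y by rewrite lt_min cl andbT; lra.
  have y1 : y <= 1 by rewrite ge_min lexx orbT.
  have yr : y < c + r by rewrite gt_min; apply/orP; left; lra.
  have : y <= c.
    apply: (ub_le_sup supS.2); split; first by rewrite y1 (le_trans c0 (ltW cy)).
    exact: Hr.
  by rewrite leNgt cy.
have [l [l1 l2 l3 l4]] := P1.
have ld : \sum_(p <- l) (p.2 - p.1) < d.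
  rewrite -lte_fin; apply: (le_lt_trans l3); apply: le_lt_trans Ud.
  apply: le_measure; rewrite ?inE//.
  by apply: measurableI => //; exact: measurable_itv.
apply: (le_trans l4); rewrite mulr1 mulrDr mulr1 lerD2l.
rewrite exchange_big/= mulrCA; apply: ler_wpM2l => //.
apply: (@le_trans _ _ (\sum_(i < k) e)).
  by apply: ler_sum => i _; apply/ltW/dl.
by rewrite sumr_const card_ord mulr_natr.
Unshelve. all: by end_near. Qed.

End AbsolutelyContinuousGrowth.

(** * Velocities of horizontal curves and the calibration inequality *)

Section CurveLength.
Context {R : realType} {n : nat}.
Notation leb := (@lebesgue_measure R).
Notation pt := (@pt R n).
Notation N := (n.*2.+1).
Notation coord := (@Defs.coord R n).
Implicit Types (x : pt) (g : R -> R).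

Lemma abs_cont01_dist1 g : abs_cont01 g -> exists2 d, 0 < d &
  forall s s', 0 <= s -> s < s' -> s' <= 1 -> s' - s < d -> `|g s' - g s| < 1.
Proof.
move=> /(_ 1 ltr01)[d d0 H]; exists d => // s s' s0 ss s1 sd.
have := H 1%N (fun=> s) (fun=> s').
rewrite !big_ord1; apply => //.
by move=> i j; rewrite !ord1 eqxx.
Qed.

Lemma abs_cont01_bounded g : abs_cont01 g ->
  exists M, forall s, 0 <= s -> s <= 1 -> `|g s| <= M.
Proof.
move=> /abs_cont01_dist1[d d0 H].
have claim j s : 0 <= s -> s <= 1 -> s <= j%:R * (d / 2) -> `|g s - g 0| <= j%:R.
  elim: j s => [|j IH] s s0 s1.
    rewrite mul0r => sle; have -> : s = 0 by apply/eqP; rewrite eq_le sle s0.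
    by rewrite subrr normr0.
  rewrite -natr1 mulrDl mul1r => sj.
  have [sd|sd] := leP s (d / 2).
    have [->|sn] := eqVneq s 0; first by rewrite subrr normr0 addr_ge0.
    have {sn}sp : 0 < s by rewrite lt_def sn.
    have := H 0 s (lexx _) sp s1; rewrite subr0 => /(_ ltac:(lra)) /ltW /le_trans; apply.
    by rewrite lerDr.
  have h1 : `|g s - g (s - d / 2)| < 1 by apply: H; lra.
  have h2 : `|g (s - d / 2) - g 0| <= j%:R by apply: IH; lra.
  have -> : g s - g 0 = (g s - g (s - d / 2)) + (g (s - d / 2) - g 0) by ring.
  by apply: le_trans (ler_normD _ _) _; lra.
have [j jd] : exists j : nat, 1 <= j%:R * (d / 2).
  exists (Num.truncn (2 / d)).+1.
  have := truncnS_gt (2 / d); rewrite ltr_pdivrMr// => h; lra.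
exists (j%:R + `|g 0|) => s s0 s1.
rewrite -[g s](subrK (g 0)); apply: le_trans (ler_normD _ _) _.
by rewrite lerD2r; apply: claim => //; lra.
Qed.

Lemma is_derive_row (gam : R -> pt) (s : R) (V : pt) : is_derive s 1 gam V ->
  forall k : 'I_N, is_derive s 1 (fun s => gam s ord0 k) (V ord0 k).
Proof.
move=> [dg <-] k; split; first by move/derivable_mxP : dg => /(_ ord0 k).
by rewrite derive_mx// mxE.
Qed.

Lemma velocity_coord (h : 'I_(n.*2) -> R) x (j : 'I_(n.*2)) :
  (\sum_(i < n.*2) h i *: Xvec i x) ord0 (inord j) = h j.
Proof.
rewrite summxE (bigD1 j)//= !mxE eqxx (inord_max j (ltn_ord j)) /= mulr0 addr0 mulr1.
rewrite big1 ?addr0// => i ij; rewrite !mxE/= (inord_max j (ltn_ord j)) mulr0 addr0.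
rewrite inord_eq ?ltN ?ltn_ord//.
by rewrite (_ : (j == i :> nat) = false) ?mulr0//; apply/negbTE; rewrite eq_sym.
Qed.

Lemma velocity_t (h : 'I_(n.*2) -> R) x :
  (\sum_(i < n.*2) h i *: Xvec i x) ord0 ord_max = \sum_(i < n.*2) h i * tcoef x i.
Proof.
rewrite summxE; apply: eq_bigr => i _; rewrite !mxE eqxx/= mulr1.
by rewrite [ord_max == _]eq_sym (inord_max i (ltn_ord i)) add0r.
Qed.

(* [W (l, x) = kap t + C(l) |z|^2 - l] satisfies
   [dW/dl + |grad_H W| <= 0] as soon as [C' = - (C^2 + kap^2)]. *)
Lemma length_calibration (kap l c v : R) x (h : 'I_(n.*2) -> R) :
  v = Num.sqrt (\sum_(i < n.*2) h i ^+ 2) ->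
  kap * (\sum_(i < n.*2) h i * tcoef x i) +
  (- (c ^+ 2 + kap ^+ 2) * v * zsq x + c * \sum_(i < n.*2) 2 * coord x i * h i) - v <= 0.
Proof.
move=> vE.
have v0 : 0 <= v by rewrite vE sqrtr_ge0.
have v2 : v ^+ 2 = \sum_(i < n.*2) h i ^+ 2.
  by rewrite vE sqr_sqrtr// sumr_ge0// => i _; exact: sqr_ge0.
pose rho := Num.sqrt ((c ^+ 2 + kap ^+ 2) * zsq x).
have rho2 : rho ^+ 2 = (c ^+ 2 + kap ^+ 2) * zsq x.
  by rewrite sqr_sqrtr// mulr_ge0 ?zsq_ge0// addr_ge0 ?sqr_ge0.
have rho0 : 0 <= rho by exact: sqrtr_ge0.
set T := \sum_(i < n.*2) h i * (c * coord x i + kap * zperp x i).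
have E : kap * (\sum_(i < n.*2) h i * tcoef x i) +
    c * (\sum_(i < n.*2) 2 * coord x i * h i) = 2 * T.
  rewrite !mulr_sumr -big_split/=; apply: eq_bigr => i _.
  by rewrite tcoefE; ring.
have Tle : T <= v * rho.
  apply: le_trans (ler_norm _) _.
  rewrite -(@ler_pXn2r _ 2) ?nnegrE ?mulr_ge0// real_normK ?num_real//.
  rewrite exprMn v2 rho2 -sum_field2.
  exact: cauchy_schwarz.
(* After Cauchy-Schwarz the left-hand side is at most [- v (rho - 1)^2], a complete square. *)
have := mulr_ge0 v0 (sqr_ge0 (rho - 1)).
rewrite (_ : v * _ = v * rho ^+ 2 - 2 * (v * rho) + v); last by ring.
rewrite rho2 => P.
rewrite (_ : _ - v = 2 * T - v * ((c ^+ 2 + kap ^+ 2) * zsq x) - v); first by lra.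
by rewrite -E; ring.
Qed.

End CurveLength.

Section LengthLowerBound.
Context {R : realType} {n : nat}.
Notation leb := (@lebesgue_measure R).
Notation pt := (@pt R n).
Notation N := (n.*2.+1).
Notation coord := (@Defs.coord R n).
Implicit Types (x : pt) (g : R -> R).

(** The indefinite integral of [v] extended by zero; Lebesgue's differentiation theorem gives its
    derivative off a null set. *)
Lemma arc_length (v : R -> R) (L : R) :
  measurable_fun (`[0%R, 1%R] : set R) v -> (forall s, 0 <= v s) ->
  (\int[leb]_(s in `[0%R, 1%R]) (v s)%:E)%E = L%:E ->
  exists l : R -> R, [/\ l 0 = 0, l 1 = L,
    forall s s', s <= s' -> l s <= l s' &
    {ae leb, forall s : R, 0 < s < 1 -> is_derive s 1 l (v s)}].
Proof.
move=> mv v0 vL.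
have iv : leb.-integrable (`[0%R, 1%R] : set R) (EFin \o v).
  apply/integrableP; split; first exact/measurable_EFinP.
  under eq_integral => s _ do rewrite /= ger0_norm//.
  by rewrite vL ltry.
pose vt := v \_ (`[0%R, 1%R] : set R).
have vt0 s : 0 <= vt s by rewrite /vt /patch; case: ifP.
have ivt : leb.-integrable setT (EFin \o vt).
  by rewrite /vt -restrict_EFin; apply/integrable_restrict => //=; rewrite setTI.
have ivtS (y : R) : leb.-integrable `]-oo, y] (EFin \o vt).
  by apply: integrableS ivt.
pose l (s : R) : R := (\int[leb]_(t in `]-oo, s]) vt t)%R.
exists l; split.
- rewrite /l /vt -Rintegral_mkcondr (_ : _ `&` _ = [set 0]) ?Rintegral_set1//.
  apply/seteqP; split=> s /=; rewrite !in_itv/=.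
    by move=> [s0 /andP[s1 s2]]; apply/eqP; rewrite eq_le s0.
  by move=> ->; rewrite lexx ler01.
- rewrite /l /vt -Rintegral_mkcondr (_ : _ `&` _ = `[0%R, 1%R]%classic).
    by rewrite /Rintegral vL.
  apply/seteqP; split=> s /=; rewrite !in_itv/=; first by move=> [].
  by move=> /andP[s1 s2]; rewrite s1 s2.
- move=> s s' ss'; rewrite /l /Rintegral; apply: fine_le.
  + exact: integrable_fin_num.
  + exact: integrable_fin_num.
  + apply: ge0_subset_integral => //.
    * by have /integrableP[] := ivtS s'.
    * by move=> t _ /=; rewrite lee_fin.
    * by move=> t /=; rewrite !in_itv/= => /le_trans; apply.
- have locv : locally_integrable setT vt by apply: open_integrable_locally => //; exact: openT.
  have := FTC1Ny ivtS locv; apply: filterS; first exact: (ae_filter_ringOfSetsType leb).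
  move=> s [dl l1] /andP[s0 s1].
  apply: DeriveDef; first exact: dl.
  rewrite -derive1E [LHS]l1 /vt /patch mem_set//= in_itv/= (ltW s0) (ltW s1).
  by [].
Qed.

(** The arc length [l] enters the growth bound through its monotonicity: [C] and [- l] both decrease
    along the curve, so their increments have the favourable sign, and the increments of the
    coordinates are controlled by absolute continuity. The shift [eta] keeps [C] away from its pole
    at 0. *)
Lemma curve_calibration x (gam : R -> pt) (h : 'I_(n.*2) -> R -> R) (L kap eta : R)
    (C : R -> R) :
  horizontal_curve x gam h -> control_length h = L%:E -> 0 < eta ->
  (forall l, eta <= l -> l <= L + eta ->
     is_derive l 1 C (- (C l ^+ 2 + kap ^+ 2))) ->
  kap * tcoord x + C (L + eta) * zsq x <= L + eta.
Proof.
move=> [g0 [g1 [gac [mh gder]]]] hL eta0 dC.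
pose v s := Num.sqrt (\sum_(i < n.*2) h i s ^+ 2).
have mv : measurable_fun (`[0%R, 1%R] : set R) v.
  rewrite (_ : v = Num.sqrt \o (fun s => \sum_(i < n.*2) h i s ^+ 2))//.
  apply: measurableT_comp.
    by apply: continuous_measurable_fun; exact: sqrt_continuous.
  apply: measurable_sum => i.
  by apply: measurable_funX; exact: mh.
have [l [l0 l1 lmono lder]] := arc_length v L mv (fun s => sqrtr_ge0 _) hL.
have lrange s : 0 <= s -> s <= 1 -> eta <= l s + eta /\ l s + eta <= L + eta.
  by move=> s0 s1; rewrite lerDr lerD2r -{1}l0 -l1; split; exact: lmono.
have L0 : 0 <= L by rewrite -l0 -l1; apply: lmono.
have Cmono a b : eta <= a -> a <= b -> b <= L + eta -> C b <= C a.
  move=> ea ab bL; rewrite -subr_le0.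
  have [||c] := @MVT_segment R C (fun l => - (C l ^+ 2 + kap ^+ 2)) a b ab.
  - by move=> c; rewrite in_itv/= => /andP[ac cb]; apply: dC; lra.
  - apply: continuous_in_subspaceT => c; rewrite inE/= in_itv/= => /andP[ac cb].
    by apply: derive_cont1; apply: dC; lra.
  rewrite in_itv/= => /andP[ac cb] ->.
  by rewrite mulNr oppr_le0 mulr_ge0 ?subr_ge0// addr_ge0 ?sqr_ge0.
pose B0 := `|C eta| + `|C (L + eta)|.
have Cbd a : eta <= a -> a <= L + eta -> `|C a| <= B0.
  move=> ea aL; have c1 := Cmono eta a (lexx _) ea aL.
  have c2 := Cmono a (L + eta) ea aL (lexx _).
  rewrite ler_norml /B0; apply/andP; split.
    by have := ler_norm (- C (L + eta)); rewrite normrN; have := normr_ge0 (C eta); lra.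
  by have := ler_norm (C eta); have := normr_ge0 (C (L + eta)); lra.
have [M M0 gM] : exists2 M, 0 <= M & forall s (k : 'I_N), 0 <= s -> s <= 1 ->
    `|gam s ord0 k| <= M.
  have [Mk HM] := choice (fun k => abs_cont01_bounded _ (gac k)).
  exists (\sum_k `|Mk k|); first exact: sumr_ge0.
  move=> s k s0 s1; apply: le_trans (HM k s s0 s1) _.
  rewrite (bigD1 k)//= (le_trans (ler_norm _))// lerDl.
  exact: sumr_ge0.
pose f s := kap * tcoord (gam s) + C (l s + eta) * zsq (gam s) - (l s + eta).
have fg : f 1 <= f 0.
  have nA := negligibleU gder lder.
  apply: (@ac_growth R f N (fun k s => gam s ord0 k) (`|kap| + B0 * (2 * M)) _ gac _ _ nA).
  - by rewrite addr_ge0// mulr_ge0 ?addr_ge0// mulr_ge0.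
  - move=> s s' s0 ss s1.
    have [e1 e2] := lrange s s0 (ltac:(lra)).
    have [e3 e4] := lrange s' (ltac:(lra)) s1.
    have ll := lmono s s' (ltW ss).
    have Cl : C (l s' + eta) * zsq (gam s') <= C (l s + eta) * zsq (gam s').
      by apply: ler_wpM2r; [exact: zsq_ge0|apply: Cmono => //; lra].
    rewrite big_ord_recr/=; set S := \sum_(i < n.*2) _.
    have Z : `|zsq (gam s') - zsq (gam s)| <= 2 * M * S.
      rewrite /zsq -sumrB mulr_sumr; apply: le_trans (ler_norm_sum _ _ _) _.
      apply: ler_sum => j _.
      have -> : widen_ord (leqnSn n.*2) j = inord j.
        by apply/val_inj; rewrite /= inordK// ltN.
      rewrite -/(coord (gam s') j) -/(coord (gam s) j) subr_sqr normrM mulrC.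
      apply: ler_wpM2r => //; apply: le_trans (ler_normD _ _) _.
      have := gM s' (inord j) (ltac:(lra)) s1; have := gM s (inord j) s0 (ltac:(lra)).
      by rewrite -/(coord (gam s') j) -/(coord (gam s) j); lra.
    have S0 : 0 <= S by apply: sumr_ge0.
    have CZ : C (l s + eta) * (zsq (gam s') - zsq (gam s)) <= B0 * (2 * M * S).
      apply: le_trans (ler_norm _) _; rewrite normrM; apply: ler_pM => //.
      by apply: Cbd.
    have KT : kap * (tcoord (gam s') - tcoord (gam s)) <=
        `|kap| * `|gam s' ord0 ord_max - gam s ord0 ord_max|.
      by apply: le_trans (ler_norm _) _; rewrite normrM.
    set T := `|gam s' ord0 ord_max - _| in KT *.
    have T0 : 0 <= T by exact: normr_ge0.
    have p1 : 0 <= `|kap| * S by rewrite mulr_ge0.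
    have p2 : 0 <= B0 * (2 * M) * T by rewrite mulr_ge0// mulr_ge0 ?addr_ge0// mulr_ge0.
    rewrite /f (_ : (`|kap| + B0 * (2 * M)) * (S + T) =
      `|kap| * S + B0 * (2 * M * S) + `|kap| * T + B0 * (2 * M) * T); last by ring.
    move: CZ KT; rewrite !mulrBr; lra.
  - move=> s s0 s1 /not_orP[/contrapT dg /contrapT dl].
    have s01 : 0 < s < 1 by rewrite s0.
    have {}dg := dg s01; have {}dl := dl s01.
    have dgk := is_derive_row gam s _ dg.
    have [e1 e2] := lrange s (ltW s0) (ltW s1).
    have dt : is_derive s 1 (fun s => tcoord (gam s)) (\sum_(i < n.*2) h i s * tcoef (gam s) i).
      by have := dgk ord_max; rewrite velocity_t.
    have dz : is_derive s 1 (fun s => zsq (gam s))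
        (\sum_(i < n.*2) 2 * coord (gam s) i * h i s).
      apply: dsum => i; apply: (dX 1 (df := h i s)); last by rewrite expr1.
      by have := dgk (inord i); rewrite velocity_coord.
    have dle : is_derive s 1 (fun s => l s + eta) (v s).
      by apply: (dD dl (dcst eta s 1)); rewrite addr0.
    have dCl := dcomp (F := C) dle (dC _ e1 e2) erefl.
    have df : is_derive s 1 f (kap * (\sum_(i < n.*2) h i s * tcoef (gam s) i) +
       (- (C (l s + eta) ^+ 2 + kap ^+ 2) * v s * zsq (gam s) +
        C (l s + eta) * \sum_(i < n.*2) 2 * coord (gam s) i * h i s) - v s).
      apply: (dB (dD (dM (dcst kap s 1) dt erefl) (dM dCl dz erefl) erefl) dle).
      by rewrite mul0r add0r.
    eexists; last exact: df.
    exact: length_calibration.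
move: fg; rewrite /f g1 g0 l0 l1 add0r.
have -> : tcoord (0 : pt) = 0 by rewrite /tcoord mxE.
have -> : zsq (0 : pt) = 0.
  by rewrite /zsq big1// => j _; rewrite /Defs.coord mxE expr0n.
by rewrite !mulr0; lra.
Qed.

End LengthLowerBound.

(** * Lower bounds for the length *)

Section LengthProfile.
Context {R : realType} {n : nat}.
Notation pt := (@pt R n).
Implicit Types (x : pt) (k l : R).

(** The solution of the Riccati equation [C' = - (C^2 + k^2)] with a pole at 0; it is regular up to
    [pi / k]. *)
Definition kcot k l : R := k * cos (k * l) / sin (k * l).

Lemma is_derive_kcot k l : 0 < k -> 0 < l -> k * l < pi ->
  is_derive l 1 (kcot k) (- (kcot k l ^+ 2 + k ^+ 2)).
Proof.
move=> k0 l0 kl.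
have s0 : 0 < sin (k * l) by rewrite sin_gt0_pi// mulr_gt0.
have sn : sin (k * l) != 0 by rewrite gt_eqF.
have dk : is_derive l 1 (fun l => k * l) k.
  by apply: (dM (dcst k l 1) (is_derive_id l 1)); rewrite mul0r add0r mulr1.
have dc := dcomp (F := cos) dk (is_derive_cos _) erefl.
have ds := dcomp (F := sin) dk (is_derive_sin _) erefl.
have dkc : is_derive l 1 (fun l => k * cos (k * l)) (k * (- sin (k * l) * k)).
  by apply: (dM (dcst k l 1) dc); rewrite mul0r add0r.
apply: (dM dkc (dV (g := fun l => sin (k * l)) sn ds erefl)).
rewrite /kcot; have H := cos2Dsin2 (k * l).
move: (sin (k * l)) (cos (k * l)) sn H => S C sn H.
by field.
Qed.

Lemma kcot_le k l l' : 0 < k -> 0 < l -> l <= l' -> k * l' < pi -> kcot k l' <= kcot k l.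
Proof.
move=> k0 l0 ll kl'.
have l'0 : 0 < l' by exact: lt_le_trans ll.
have kl : k * l <= k * l' by rewrite ler_pM2l.
have kl0 : 0 < k * l by rewrite mulr_gt0.
have s0 : 0 < sin (k * l) by rewrite sin_gt0_pi// kl0 (le_lt_trans kl).
have s'0 : 0 < sin (k * l') by rewrite sin_gt0_pi// kl' mulr_gt0.
rewrite -subr_ge0 /kcot.
rewrite (_ : _ - _ = k * sin (k * l' - k * l) / (sin (k * l) * sin (k * l'))).
  rewrite divr_ge0 ?mulr_ge0 ?(ltW k0) ?(ltW s0) ?(ltW s'0)//.
  by rewrite sin_ge0_pi// subr_ge0 kl/=; lra.
rewrite sinB; field; rewrite gt_eqF//= gt_eqF//.
Qed.

Lemma length_ge0 (h : 'I_(n.*2) -> R -> R) L : control_length h = L%:E -> 0 <= L.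
Proof.
by move=> hL; rewrite -lee_fin -hL; apply: integral_ge0 => s _; rewrite lee_fin sqrtr_ge0.
Qed.

Lemma length_ge_axis x gam (h : 'I_(n.*2) -> R -> R) L :
  horizontal_curve x gam h -> control_length h = L%:E ->
  zsq x = 0 -> Num.sqrt (pi * `|tcoord x|) <= L.
Proof.
move=> hc hL z0; have L0 := length_ge0 h L hL.
set D := Num.sqrt _; rewrite leNgt; apply/negP => LD.
have D0 : 0 < D by exact: le_lt_trans LD.
have D2 : D ^+ 2 = pi * `|tcoord x| by rewrite sqr_sqrtr// mulr_ge0// pi_ge0.
(* The next pole of [kcot k] is then at [D], beyond [L + eta], and [k |t| = D], which the
   calibration bounds by [L + eta < D]. *)
pose k := pi / D; have k0 : 0 < k by rewrite divr_gt0// pi_gt0.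
pose eta := (D - L) / 2; have eta0 : 0 < eta by rewrite divr_gt0// subr_gt0.
have LeD : L + eta < D by rewrite /eta; lra.
pose s := Num.sg (tcoord x).
have := curve_calibration x gam h L (s * k) eta (kcot k) hc hL eta0.
rewrite z0 mulr0 addr0 => H.
have {}H : s * k * tcoord x <= L + eta.
  have [t0|tn0] := eqVneq (tcoord x) 0.
    by rewrite t0 mulr0 addr_ge0// ltW.
  apply: H => l el lL.
  rewrite [(s * k) ^+ 2]exprMn sqr_sg tn0 mul1r.
  apply: is_derive_kcot => //; first by lra.
  by rewrite /k mulrAC ltr_pdivrMr// ltr_pM2l ?pi_gt0//; lra.
have E : s * k * tcoord x = D.
  rewrite mulrAC -normrEsg /k mulrCA mulrA -D2 expr2 mulfK// gt_eqF//.
by move: H; rewrite E leNgt LeD.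
Qed.

Lemma length_ge_profile x gam (h : 'I_(n.*2) -> R -> R) L :
  horizontal_curve x gam h -> control_length h = L%:E ->
  0 < zsq x -> Num.sqrt (zsq x) * profile (tcoord x / zsq x) <= L.
Proof.
move=> hc hL z0; have L0 := length_ge0 h L hL.
set z := zsq x in z0 *; set y := tcoord x / z.
have tE : tcoord x = y * z by rewrite /y divfK// gt_eqF.
set D := Num.sqrt z * profile y; rewrite leNgt; apply/negP => LD.
have D0 : 0 < D by exact: le_lt_trans LD.
have D2 : D ^+ 2 = z * profile y ^+ 2 by rewrite exprMn sqr_sqrtr// ltW.
have [c1 c2 _] := half_angleP y.
pose eta := (D - L) / 2; have eta0 : 0 < eta by rewrite divr_gt0// subr_gt0.
have LeD : L + eta < D by rewrite /eta; lra.
have Le0 : 0 < L + eta by rewrite ltr_wpDl.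
set c := half_angle y in c1 c2.
have [c0|c0] := eqVneq c 0.
  (* The limit of [kcot k] as [k] tends to 0, suited to a straight segment. *)
  have := curve_calibration x gam h L 0 eta (fun l => l^-1) hc hL eta0.
  rewrite mul0r add0r -/z => H.
  have {}H : (L + eta)^-1 * z <= L + eta.
    apply: H => l el lL; have l0 : l != 0 by rewrite gt_eqF//; lra.
    apply: (dV l0 (is_derive_id l 1)); field.
    by rewrite l0.
  move: H; rewrite mulrC ler_pdivrMr// -expr2.
  have -> : z = D ^+ 2 by rewrite D2 (profile0 _ c0) expr1n mulr1.
  by rewrite leNgt => /negP; apply; rewrite ltr_sqr ?nnegrE ?ltW.
(* An arc of angle [2 c] and length [D] has curvature [2 |c| / D], and [k] is half of it. With this
   choice the calibration is exact at [l = D], so monotonicity of [kcot k] excludes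
   [L + eta < D]. *)
pose k := `|c| / D; have k0 : 0 < k by rewrite divr_gt0// normr_gt0.
have kD : k * D = `|c| by rewrite divfK// gt_eqF.
have cpi : `|c| < pi by rewrite ltr_norml c1 c2.
have := curve_calibration x gam h L (c / D) eta (kcot k) hc hL eta0.
rewrite -/z => H.
have {}H : c / D * tcoord x + kcot k (L + eta) * z <= L + eta.
  apply: H => l el lL.
  have -> : (c / D) ^+ 2 = k ^+ 2 by rewrite /k !exprMn real_normK ?num_real.
  apply: is_derive_kcot => //; first by lra.
  by apply: le_lt_trans cpi; rewrite -kD ler_pM2l//; lra.
have s0 : sin c != 0 by exact: sin_neq0.
have kcotD : kcot k D = c / D * (cos c / sin c).
  rewrite /kcot kD /k; have [cp|cn] := leP 0 c.
    by rewrite ger0_norm// -mulrA mulrAC; field; rewrite s0 gt_eqF.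
  by rewrite ltr0_norm// cosN sinN; field; rewrite s0 gt_eqF.
have E : c / D * tcoord x + kcot k D * z = D.
  rewrite kcotD tE.
  have cs : cos c / sin c = profile y * cos c / c.
    have ps : profile y * sin c = c := profile_sin y.
    by rewrite -[X in _ = _ / X]ps; field; rewrite s0 gt_eqF ?profile_gt0.
  rewrite cs; apply/eqP; rewrite -(inj_eq (mulIf (lt0r_neq0 D0))) -expr2 D2 profile_sqr -/c.
  by apply/eqP; field; rewrite c0 gt_eqF.
have kk : kcot k D * z <= kcot k (L + eta) * z.
  by rewrite ler_pM2r//; apply: kcot_le => //; [exact: ltW|rewrite kD].
have : D <= L + eta by rewrite -[leLHS]E; apply: le_trans H; rewrite lerD2l.
by rewrite leNgt LeD.
Qed.

End LengthProfile.

(** * Explicit horizontal curves *)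

Section ExplicitCurves.
Context {R : realType} {n : nat}.
Notation leb := (@lebesgue_measure R).
Notation pt := (@pt R n).
Notation N := (n.*2.+1).
Notation coord := (@Defs.coord R n).
Implicit Types (x W : pt).

Lemma C1_abs_cont01 (g g1 : R -> R) : (forall s : R, is_derive s 1 g (g1 s)) ->
  continuous g1 -> abs_cont01 g.
Proof.
move=> dg cg1 e e0.
have cn : continuous (fun s => `|g1 s|).
  by apply: (ccomp (F := fun s => `|s|)) => // s; exact: norm_continuous.
have [c _ gM] := EVT_max (ler01 : 0 <= 1 :> R) (continuous_subspaceT cn).
pose M := `|g1 c| + 1; have M0 : 0 < M by rewrite ltr_wpDl.
exists (e / M); first by rewrite divr_gt0.
move=> k a b H01 _ Hs.
have lip i : `|g (b i) - g (a i)| <= M * (b i - a i).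
  have [a0 [ab b1]] := H01 i.
  have [|c'] := MVT_segment (ltW ab) (fun s _ => dg s).
    exact/continuous_subspaceT/(derive_cont _ _ dg).
  rewrite in_itv/= => /andP[ac cb] ->.
  rewrite normrM (gtr0_norm (_ : 0 < b i - a i)) ?subr_gt0//.
  apply: ler_wpM2r; first by rewrite subr_ge0 ltW.
  have : `|g1 c'| <= `|g1 c| by apply: gM; rewrite in_itv/=; apply/andP; split; lra.
  by rewrite /M; lra.
apply: (@le_lt_trans _ _ (\sum_(i < k) M * (b i - a i))); first by apply: ler_sum.
by rewrite -mulr_sumr mulrC -ltr_pdivlMr.
Qed.

Lemma is_derive_rowI (gam : R -> pt) (s : R) (V : pt) :
  (forall k : 'I_N, is_derive s 1 (fun s => gam s ord0 k) (V ord0 k)) ->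
  is_derive s 1 gam V.
Proof.
move=> dk; have dg : derivable gam s 1.
  by apply/derivable_mxP => i k; rewrite ord1; apply: ex_derive.
apply: DeriveDef => //; rewrite derive_mx//; apply/rowP => k; rewrite mxE.
exact: derive_val.
Qed.

Lemma coord_case (k : 'I_N) : k = ord_max \/ exists2 j, (j < n.*2)%N & k = inord j.
Proof.
have [kn|kn] := ltnP k n.*2; first by right; exists k; rewrite ?inord_val.
by left; apply/val_inj/eqP; rewrite /= eqn_leq kn -ltnS ltn_ord.
Qed.

(** The point with plane coordinates [(a, b)] in the basis [W], [JW], at height [tau]. *)
Definition lift_curve (a b tau : R) W : pt :=
  \row_(k < N) (if (k < n.*2)%N then a * coord W k + b * zperp W k else tau).

Lemma coord_lift a b tau W j : (j < n.*2)%N ->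
  coord (lift_curve a b tau W) j = a * coord W j + b * zperp W j.
Proof. by move=> jn; rewrite /Defs.coord mxE inordK ?ltN// jn. Qed.

Lemma tcoord_lift a b tau W : tcoord (lift_curve a b tau W) = tau.
Proof. by rewrite /tcoord mxE /= ltnn. Qed.

Lemma zperp_lift a b tau W j : (j < n.*2)%N ->
  zperp (lift_curve a b tau W) j = a * zperp W j - b * coord W j.
Proof.
move=> jn; rewrite {1}/zperp /tcoef; case: (boolP (odd j)) => jo.
  have j0 : (0 < j)%N by case: (j) jo.
  have jj : (j.-1 < n.*2)%N by apply: leq_ltn_trans jn; exact: leq_pred.
  have jo' : odd j.-1 = false by apply/negbTE; move: jo; rewrite -{1}(prednK j0) /=.
  rewrite coord_lift// [zperp W j]/zperp [zperp W j.-1]/zperp /tcoef jo jo' prednK//.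
  by field.
have j1 : (j.+1 < n.*2)%N.
  rewrite ltn_neqAle jn andbT; apply/eqP => E.
  by have := odd_double n; rewrite -E/= jo.
rewrite coord_lift// [zperp W j]/zperp [zperp W j.+1]/zperp /tcoef /= (negbTE jo) /=.
by field.
Qed.

(** The equation for [tau] is horizontality: the height is four times the signed area swept by the
    planar curve. The length is the Euclidean length of that curve, run at constant speed. *)
Lemma planar_curve W x (a b a1 b1 tau : R -> R) (v : R) :
  (forall s : R, is_derive s 1 a (a1 s)) -> (forall s : R, is_derive s 1 b (b1 s)) ->
  (forall s : R, is_derive s 1 tau (2 * (b1 s * a s - a1 s * b s) * zsq W)) ->
  continuous a1 -> continuous b1 ->
  a 0 = 0 -> b 0 = 0 -> tau 0 = 0 -> 0 <= v ->
  (forall s, a1 s ^+ 2 + b1 s ^+ 2 = v ^+ 2) ->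
  (forall j, (j < n.*2)%N -> coord x j = a 1 * coord W j + b 1 * zperp W j) ->
  tcoord x = tau 1 ->
  exists gam h, horizontal_curve x gam h /\
    control_length h = (v * Num.sqrt (zsq W))%:E.
Proof.
move=> da db dtau ca1 cb1 a0 b0 tau0 v0 ab xE tE.
pose gam s := lift_curve (a s) (b s) (tau s) W.
pose h (j : 'I_(n.*2)) s := a1 s * coord W j + b1 s * zperp W j.
have ch j : continuous (h j) := cD (cM ca1 (ccst _)) (cM cb1 (ccst _)).
have ca := derive_cont _ _ da; have cb := derive_cont _ _ db.
have dlin (k : nat) (s : R) : is_derive s 1 (fun s => a s * coord W k + b s * zperp W k)
    (a1 s * coord W k + b1 s * zperp W k).
  apply: (dD (dM (da s) (dcst (coord W k) s 1) erefl)
    (dM (db s) (dcst (zperp W k) s 1) erefl)); rewrite !mulr0 !addr0.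
  by [].
have gmax s : gam s ord0 ord_max = tau s by exact: tcoord_lift.
have gj j s : (j < n.*2)%N -> gam s ord0 (inord j) = a s * coord W j + b s * zperp W j.
  exact: coord_lift.
exists gam, h; split; [split; [|split; [|split; [|split]]]|].
- apply/rowP => k; rewrite [RHS]mxE; have [->|[j jn ->]] := coord_case k.
    by rewrite gmax.
  by rewrite gj// a0 b0 !mul0r addr0.
- apply/rowP => k; have [->|[j jn ->]] := coord_case k; first by rewrite gmax -tE.
  by rewrite gj// -xE.
- move=> k; have [->|[j jn ->]] := coord_case k.
    rewrite (_ : (fun s => _) = tau); last by apply/funext => s; exact: gmax.
    apply: (C1_abs_cont01 _ _ dtau).
    exact: (cM (cM (ccst 2) (cB (cM cb1 ca) (cM ca1 cb))) (ccst _)).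
  rewrite (_ : (fun s => _) = fun s => a s * coord W j + b s * zperp W j).
    by apply: (C1_abs_cont01 _ _ (dlin j)); exact: (cD (cM ca1 (ccst _)) (cM cb1 (ccst _))).
  by apply/funext => s; exact: gj.
- by move=> j; apply: measurable_funTS; exact: continuous_measurable_fun.
- apply: aeW => s _; apply: is_derive_rowI => k.
  have [->|[j jn ->]] := coord_case k.
    rewrite (_ : (fun s => _) = tau); last by apply/funext => s'; exact: gmax.
    rewrite velocity_t.
    have -> : \sum_(i < n.*2) h i s * tcoef (gam s) i =
        2 * (b1 s * a s - a1 s * b s) * zsq W; last exact: dtau.
      transitivity (\sum_(i < n.*2) ((2 * (a1 s * a s - b1 s * b s)) * (coord W i * zperp W i)
         + ((2 * b1 s * a s) * zperp W i ^+ 2 + (- 2 * a1 s * b s) * coord W i ^+ 2))).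
        by apply: eq_bigr => i _; rewrite tcoefE zperp_lift// /h; ring.
      rewrite !big_split/= -!mulr_sumr sum_coord_zperp sum_zperp2 -/(zsq W).
      by ring.
  rewrite (_ : (fun s => _) = fun s => a s * coord W j + b s * zperp W j); last first.
    by apply/funext => s'; exact: gj.
  have := velocity_coord (fun i => h i s) (gam s) (Ordinal jn).
  by rewrite /= => ->; exact: dlin.
- rewrite /control_length (_ : (fun s => _) = fun=> (v * Num.sqrt (zsq W))%:E).
    rewrite integral_cst//= lebesgue_measure_itv/= lte_fin ltr01.
    by rewrite oppr0 adde0 mule1.
  apply/funext => s; congr EFin; rewrite /h sum_field2 ab sqrtrM ?sqr_ge0//.
  by rewrite sqrtr_sqr ger0_norm.
Qed.

End ExplicitCurves.

(** * Evaluation of the distance *)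

Section CCDistance.
Context {R : realType} {n : nat}.
Notation pt := (@pt R n).
Notation N := (n.*2.+1).
Notation coord := (@Defs.coord R n).
Implicit Types (x W : pt).

Lemma cc_dist_eq x (D : R) :
  (forall gam (h : 'I_(n.*2) -> R -> R) L,
     horizontal_curve x gam h -> control_length h = L%:E -> D <= L) ->
  (exists gam (h : 'I_(n.*2) -> R -> R),
     horizontal_curve x gam h /\ control_length h = D%:E) ->
  cc_dist x = D.
Proof.
move=> lo [gam [h [hc hD]]].
rewrite /cc_dist (_ : ereal_inf _ = D%:E)//; apply/eqP; rewrite eq_le; apply/andP; split.
  by apply: ereal_inf_lbound; exists gam, h.
apply: le_ereal_inf_tmp => _ [gam' [h' [hc' ->]]].
have : (0 <= control_length h')%E.
  by apply: integral_ge0 => s _; rewrite lee_fin sqrtr_ge0.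
case E : (control_length h') => [L| |] //= _; last exact: leey.
by rewrite lee_fin; exact: (lo gam' h').
Qed.

Lemma arc_curve W x (c : R) :
  (forall j, (j < n.*2)%N -> coord x j = sin c * coord W j) ->
  tcoord x = zsq W * (c - sin c * cos c) ->
  exists gam (h : 'I_(n.*2) -> R -> R), horizontal_curve x gam h /\
    control_length h = (`|c| * Num.sqrt (zsq W))%:E.
Proof.
move=> xE tE.
(* In complex notation the planar curve is [sin (c s) e^(i c (s - 1))], an arc of angle [2 c] of a
   circle through the origin. Its velocity [c e^(i c (2 s - 1))] has constant modulus, and the phase
   makes the endpoint the real number [sin c]. *)
pose th (s : R) : R := c * (s - 1).
have du (s : R) : is_derive s 1 (fun s => c * s) c.
  by apply: (dM (dcst c s 1) (is_derive_id s 1)); rewrite mul0r add0r mulr1.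
have dth (s : R) : is_derive s 1 th c.
  apply: (dM (dcst c s 1) (dB (is_derive_id s 1) (dcst 1 s 1) erefl)).
  by rewrite mul0r add0r subr0 mulr1.
have dsu s := dcomp (F := sin) (du s) (is_derive_sin _) erefl.
have dcu s := dcomp (F := cos) (du s) (is_derive_cos _) erefl.
have dst s := dcomp (F := sin) (dth s) (is_derive_sin _) erefl.
have dct s := dcomp (F := cos) (dth s) (is_derive_cos _) erefl.
have dut (s : R) : is_derive s 1 (fun s => c * s + th s) (c + c).
  exact: (dD (du s) (dth s) erefl).
have cut := derive_cont _ _ dut.
apply: (planar_curve W x (fun s => sin (c * s) * cos (th s)) (fun s => sin (c * s) * sin (th s))
  (fun s => c * cos (c * s + th s)) (fun s => c * sin (c * s + th s))
  (fun s => zsq W * (c * s - sin (c * s) * cos (c * s)))).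
- by move=> s; apply: (dM (dsu s) (dct s)); rewrite cosD; ring.
- by move=> s; apply: (dM (dsu s) (dst s)); rewrite sinD; ring.
- move=> s; apply: (dM (dcst (zsq W) s 1) (dB (du s) (dM (dsu s) (dcu s) erefl) erefl)).
  rewrite cosD sinD.
  have H1 := cos2Dsin2 (c * s); have H2 := cos2Dsin2 (th s).
  move: (cos (c * s)) (sin (c * s)) (cos (th s)) (sin (th s)) H1 H2 => C S T U H1 H2.
  transitivity (2 * c * S ^+ 2 * (T ^+ 2 + U ^+ 2) * zsq W); first by ring.
  have C2 : C ^+ 2 = 1 - S ^+ 2 by rewrite -H1 addrK.
  by rewrite H2 mul0r add0r; transitivity (zsq W * (c - c * C ^+ 2 + c * S ^+ 2));
    [rewrite C2; ring|ring].
- by apply: (cM (ccst c)); apply: (ccomp (F := cos)) => //; exact: continuous_cos.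
- by apply: (cM (ccst c)); apply: (ccomp (F := sin)) => //; exact: continuous_sin.
- by rewrite mulr0 sin0 mul0r.
- by rewrite mulr0 sin0 mul0r.
- by rewrite mulr0 sin0 mul0r subr0 mulr0.
- exact: normr_ge0.
- move=> s; rewrite real_normK ?num_real// !exprMn -mulrDr cos2Dsin2 mulr1//.
- by move=> j jn; rewrite xE// /th subrr mulr0 cos0 sin0 !mulr1 mulr0 mul0r addr0.
- by rewrite mulr1 tE.
Qed.

Lemma zsqZ k x : zsq (k *: x) = k ^+ 2 * zsq x.
Proof.
rewrite /zsq mulr_sumr; apply: eq_bigr => j _.
by rewrite /Defs.coord mxE exprMn.
Qed.

(** For a nonzero height the optimal curve projects to a full circle, [c = pi] or [c = - pi]
    according to the sign of [t]. Its initial direction is free; [W] lies along the first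
    coordinate, and [|W|^2 = |t| / pi] gives the right height. *)
Lemma cc_dist_axis x : (0 < n)%N -> zsq x = 0 -> cc_dist x = Num.sqrt (pi * `|tcoord x|).
Proof.
move=> n0 z0; apply: cc_dist_eq.
  by move=> gam h L hc hL; exact: (length_ge_axis x gam h L hc hL z0).
have pi0 := @pi_gt0 R.
set t := tcoord x.
pose r := Num.sqrt (`|t| / pi).
have r2 : r ^+ 2 = `|t| / pi by rewrite sqr_sqrtr// divr_ge0// ltW.
pose W : pt := r *: delta_mx 0 (inord 0).
have zW : zsq W = `|t| / pi.
  rewrite zsqZ r2 (_ : zsq _ = 1) ?mulr1//.
  have n20 : (0 < n.*2)%N by rewrite double_gt0.
  rewrite /zsq (bigD1 (Ordinal n20))//= big1 ?addr0.
    by rewrite /Defs.coord mxE !eqxx expr1n.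
  move=> j j0; rewrite /Defs.coord mxE eqxx/= inord_eq ?ltN//.
  by rewrite -val_eqE/= in j0; rewrite (negbTE j0) expr0n.
have s0 : sin (Num.sg t * pi) = 0.
  by rewrite /Num.sg; case: ifP => _; [rewrite mul0r sin0|
    case: ifP => _; rewrite ?mulN1r ?sinN ?mul1r sinpi ?oppr0].
have [||gam [h [hc hL]]] := arc_curve W x (Num.sg t * pi).
- move=> j jn; rewrite s0 mul0r; apply/eqP; rewrite -sqrf_eq0.
  have := z0; rewrite /zsq => /eqP; rewrite psumr_eq0; last by move=> i _; exact: sqr_ge0.
  by move=> /allP /(_ (Ordinal jn) (mem_index_enum _)).
- rewrite s0 mul0r subr0 zW -/t {1}[t]numEsg.
  by rewrite mulrCA divfK// gt_eqF.
exists gam, h; split; first exact: hc.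
rewrite hL; congr EFin; rewrite zW.
have [t0|t0] := eqVneq t 0; first by rewrite t0 sgr0 !(mul0r, normr0, mulr0) sqrtr0.
rewrite normrM normr_sg t0 mul1r (gtr0_norm pi0).
rewrite -{1}(ger0_norm (ltW pi0)) -sqrtr_sqr -sqrtrM ?sqr_ge0//; congr Num.sqrt.
by rewrite expr2 -mulrA [pi * (_ / _)]mulrC divfK// gt_eqF.
Qed.

Lemma cc_dist_profile x : 0 < zsq x ->
  cc_dist x = Num.sqrt (zsq x) * profile (tcoord x / zsq x).
Proof.
move=> z0; apply: cc_dist_eq.
  by move=> gam h L hc hL; exact: (length_ge_profile x gam h L hc hL z0).
set z := zsq x in z0 *; set t := tcoord x; set y := t / z.
have tE : t = y * z by rewrite /y divfK// gt_eqF.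
have [c1 c2 _] := half_angleP y.
have [c0|c0] := eqVneq (half_angle y) 0.
  have y0 := half_angle_eq0 _ c0.
  rewrite (profile0 _ c0) mulr1 -[Num.sqrt z]mul1r.
  have d1 (s : R) : is_derive s 1 (fun s => s) 1 by exact: is_derive_id.
  apply: (planar_curve x x (fun s => s) (fun=> 0) (fun=> 1) (fun=> 0) (fun=> 0)) => //.
  - move=> s; rewrite mul0r mulr0 subr0 mulr0 mul0r; exact: dcst.
  - exact: ccst.
  - exact: ccst.
  - by move=> s; rewrite expr1n expr0n addr0.
  - by move=> j _; rewrite mul1r mul0r addr0.
  - by rewrite -/t tE y0 mul0r.
set c := half_angle y in c1 c2 c0.
have s0 : sin c != 0 by exact: sin_neq0.
have [||gam [h [hc hL]]] := arc_curve ((sin c)^-1 *: x) x c.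
- by move=> j jn; rewrite /Defs.coord mxE mulrA divff// mul1r.
- rewrite zsqZ -/t tE -half_angle_eq -/c -/z; field.
  by rewrite s0.
exists gam, h; split; first exact: hc.
rewrite hL; congr EFin; rewrite zsqZ sqrtrM ?sqr_ge0// sqrtr_sqr mulrA mulrC; congr (_ * _).
have ps : profile y * sin c = c := profile_sin y.
rewrite -normrM -{1}ps mulfK//.
by rewrite gtr0_norm// profile_gt0.
Qed.

End CCDistance.

(** * The Carnot-Caratheodory distance *)

Section ProfileEstimates.
Context {R : realType}.
Implicit Types c y : R.

Lemma half_angleN y : half_angle (- y) = - half_angle y.
Proof.
have [h1 h2 h3] := half_angleP y.
by rewrite -{1}h3 -muN half_angleK//; lra.
Qed.

Lemma half_angle_ge0 y : 0 <= y -> 0 <= half_angle y.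
Proof.
have [h1 h2 h3] := half_angleP y; rewrite leNgt => y0; rewrite leNgt; apply/negP => c0.
have := mu_lt (half_angle y) 0 h1 c0 (@pi_gt0 R).
by rewrite h3 mu0 (negbTE y0).
Qed.

Lemma profileN y : profile (- y) = profile y.
Proof. by rewrite /profile half_angleN cosN sinN mulrNN. Qed.

Lemma sin_ge_half c : 0 <= c -> c ^+ 2 <= 3 -> c / 2 <= sin c.
Proof.
move=> c0 c3; apply: le_trans (sin_ge3 c c0).
rewrite (_ : c - _ = c * (1 - c ^+ 2 / 6)); last by field.
by apply: ler_wpM2l => //; lra.
Qed.

Lemma profile_sqr_ge y : `|y| <= 2 * profile y ^+ 2.
Proof.
wlog y0 : y / 0 <= y => [H|].
  have [/H//|y0] := leP 0 y.
  by rewrite -normrN -(profileN y); apply: H; rewrite oppr_ge0 ltW.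
rewrite ger0_norm//; have h1 := profile_ge1 y; have c0 := half_angle_ge0 y y0.
have hs := profile_sqr y; have [_ _ cy] := half_angleP y.
have hh : profile y <= profile y ^+ 2 by rewrite expr2 ler_peMl// (le_trans ler01).
have [c1|c1] := leP 1 (half_angle y).
  have : y <= half_angle y * y by rewrite ler_peMl.
  have : - profile y <= profile y * cos (half_angle y).
    rewrite -[- _]mulrN1; apply: ler_wpM2l; first exact: (le_trans ler01).
    exact: cos_geN1.
  lra.
have [cn|cn] := eqVneq (half_angle y) 0.
  by rewrite (half_angle_eq0 y cn) mulr_ge0 ?sqr_ge0.
have cp : 0 < half_angle y by rewrite lt_def cn.
have := mu_near0 (half_angle y) cn; rewrite gtr0_norm// => /(_ (ltW c1)).
rewrite cy => /ler_normlP[_]; rewrite lerBlDr ler_pdivrMr// => yc.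
have c2 : half_angle y ^+ 2 <= 1 by rewrite expr_le1// ltW.
have : (half_angle y ^+ 2 + 2 / 3) * half_angle y <= (1 + 2 / 3) * 1.
  by apply: ler_pM => //; [rewrite addr_ge0 ?sqr_ge0|lra|exact: ltW].
lra.
Qed.

Lemma pi_lt72 : (pi : R) < 7 / 2.
Proof.
rewrite ltNge; apply/negP => H.
have : (7 / 2) ^+ 2 <= (pi : R) ^+ 2 by rewrite ler_sqr ?nnegrE ?pi_ge0.
by have := @pi_lt_sqrt12 R; lra.
Qed.

(** On the axis the regularised weight is [sqrt e] times [profile (t / e)] and has to approach
    [sqrt (pi |t|)] at rate [sqrt e]. As [profile^2 = c y + profile cos c], it is enough that
    [(pi - c) y] be bounded by a multiple of the profile. *)
Lemma profile_asymptotic y : `|profile y - Num.sqrt (pi * `|y|)| <= 15.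
Proof.
wlog y0 : y / 0 <= y => [H|].
  have [/H//|y0] := leP 0 y.
  by rewrite -[`|y|]normrN -(profileN y); apply: H; rewrite oppr_ge0 ltW.
rewrite (ger0_norm y0); have h1 := profile_ge1 y; have c0 := half_angle_ge0 y y0.
have pi0 := @pi_gt0 R; have pi72 := pi_lt72.
have y2 := profile_sqr_ge y; rewrite (ger0_norm y0) in y2.
have hs := profile_sqr y; have [_ cpi _] := half_angleP y.
have hsin := profile_sin y.
have h0 : 0 <= profile y by lra.
have cle : profile y * cos (half_angle y) <= profile y.
  by rewrite ler_piMr// cos_le1.
have cge : - profile y <= profile y * cos (half_angle y).
  by rewrite -[- _]mulrN1; apply: ler_wpM2l => //; exact: cos_geN1.
set P := Num.sqrt _; have P0 : 0 <= P by exact: sqrtr_ge0.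
have P2 : P ^+ 2 = pi * y by rewrite sqr_sqrtr// mulr_ge0// ltW.
have cy : half_angle y * y <= pi * y by apply: ler_wpM2r => //; exact: ltW.
have up : profile y - 1 <= P.
  rewrite -ler_sqr ?nnegrE//; last by lra.
  by rewrite P2; move: hs; rewrite !expr2; lra.
(* For [c <= pi / 2] the profile is at most 2. Beyond, [x = pi - c] satisfies
   [x / 2 <= sin x = sin c], so [x / 2] times the profile is at most [c < pi]; combine with
   [y <= 2 profile^2]. *)
have defect : (pi - half_angle y) * y <= 8 * pi * profile y.
  have [cl|cl] := leP (half_angle y) (pi / 2).
    have c23 : half_angle y ^+ 2 <= 3.
      apply: (@le_trans _ _ ((pi / 2) ^+ 2)).
        by rewrite ler_sqr ?nnegrE// divr_ge0// ltW.
      by have := @pi_lt_sqrt12 R; lra.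
    have hle2 : profile y <= 2.
      have [cn|cn] := eqVneq (half_angle y) 0; first by rewrite (profile0 y cn) ler1n.
      have cp : 0 < half_angle y by rewrite lt_def cn.
      rewrite -(ler_pM2r cp); have := sin_ge_half (half_angle y) c0 c23 => sc.
      by have := ler_wpM2l h0 sc; rewrite hsin; lra.
    have : (pi - half_angle y) * y <= pi * (2 * (2 * profile y)).
      apply: ler_pM => //; [by lra|by lra|].
      apply: le_trans y2 _; rewrite ler_pM2l// expr2.
      exact: ler_wpM2r.
    by lra.
  set x := pi - half_angle y.
  have x0 : 0 <= x by rewrite /x; lra.
  have x2 : x ^+ 2 <= 3.
    apply: (@le_trans _ _ ((pi / 2) ^+ 2)).
      by rewrite ler_sqr ?nnegrE ?divr_ge0 ?(ltW pi0)//; rewrite /x; lra.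
    by have := @pi_lt_sqrt12 R; lra.
  have := sin_ge_half x x0 x2.
  have -> : sin x = sin (half_angle y) by rewrite /x sinB sinpi cospi mul0r mulN1r sub0r opprK.
  move=> sx; have := ler_wpM2l h0 sx; rewrite hsin => hx.
  have : x * y <= x * (2 * profile y ^+ 2) by exact: ler_wpM2l.
  have -> : x * (2 * profile y ^+ 2) = 4 * profile y * (profile y * (x / 2)) by field.
  have : 4 * profile y * (profile y * (x / 2)) <= 4 * profile y * pi.
    by apply: ler_wpM2l; lra.
  have : 0 <= profile y * pi by rewrite mulr_ge0// ltW.
  by lra.
(* Since [8 pi < 28], one gets [pi y <= profile^2 + 29 profile], below [(profile + 15)^2]. *)
have lo : P <= profile y + 15.
  rewrite -ler_sqr ?nnegrE//; last by lra.
  rewrite P2.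
  have : 8 * pi * profile y <= 28 * profile y by apply: ler_wpM2r => //; lra.
  move: defect hs; rewrite mulrBl (sqrrD (profile y) 15).
  by lra.
by rewrite ler_norml; apply/andP; split; lra.
Qed.

(** This is [profile_defect] multiplied by [sin^4 c], with [y] and the profile expressed through
    [c]. *)
Lemma defect_bound c : 0 < c -> c < pi ->
  (c - sin c * cos c) ^+ 2 <= 2 * (c ^+ 2 * (c ^+ 2 - sin c ^+ 2)).
Proof.
move=> c0 cpi.
have s0 : 0 < sin c by rewrite sin_gt0_pi// c0.
have /andP[_ N2] := segment_area_bounds c (ltW c0).
have sc : sin c * cos c <= sin c by rewrite ler_piMr ?cos_le1// ltW.
have sle := sin_le_id c (ltW c0).
have N0 : 0 <= c - sin c * cos c by lra.
set u := c ^+ 2; have u0 : 0 <= u by exact: sqr_ge0.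
(* Taylor bounds work for [c^2 <= 5/2]. For larger [c] crude estimates do: the left-hand side is at
   most [(c + 1)^2] and the right-hand side at least [3 c^2]. *)
have [u52|u52] := leP u (5 / 2).
  apply: (@le_trans _ _ ((2 / 3 * c ^+ 3) ^+ 2)).
    by rewrite ler_sqr ?nnegrE// mulr_ge0// exprn_ge0// ltW.
  have S5 := sin_le5 c (ltW c0).
  have [q uq] : exists q, u = 120 * q by exists (u / 120); rewrite mulrC divfK// pnatr_eq0.
  have q0 : 0 <= q by lra.
  pose w := 1 - u / 6 + u * q.
  have S52 : sin c ^+ 2 <= u * w ^+ 2.
    have -> : u * w ^+ 2 = (c * w) ^+ 2 by rewrite /u; ring.
    rewrite (_ : c - _ + _ = c * w) in S5; last first.
      have -> : c * w = c - c * u / 6 + c * u * q by rewrite /w; field.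
      have -> : q = u / 120 by rewrite uq mulrC mulKf// pnatr_eq0.
      by rewrite /u !exprS; congr (_ - _ / _ + _); rewrite expr0 !mulr1 !mulrA.
    by rewrite ler_sqr ?nnegrE ?(ltW s0)//; apply: le_trans S5; exact: ltW.
  have -> : (2 / 3 * c ^+ 3) ^+ 2 = 4 / 9 * u ^+ 3 by rewrite /u; field.
  have main : 2 / 9 * u ^+ 2 <= u - u * w ^+ 2.
    rewrite -subr_ge0 (_ : _ - _ = u ^+ 2 * ((1 / 6 - q) * (1 + w) - 2 / 9)); last first.
      by rewrite /w; field.
    rewrite mulr_ge0 ?sqr_ge0// subr_ge0.
    have w1 : 2 - 20 * q <= 1 + w by have := mulr_ge0 u0 q0; rewrite /w; lra.
    have q1 : 0 <= 1 / 6 - q by lra.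
    apply: le_trans (ler_wpM2l q1 w1).
    rewrite -subr_ge0 (_ : _ - _ = 1 / 9 - 16 / 3 * q + 20 * q ^+ 2); last by field.
    by have := sqr_ge0 q; lra.
  have : u * (2 / 9 * u ^+ 2) <= u * (u - sin c ^+ 2) by apply: ler_wpM2l => //; lra.
  rewrite (_ : u * (2 / 9 * u ^+ 2) = 2 / 9 * u ^+ 3); last by ring.
  by lra.
have s1 : sin c ^+ 2 <= 1 by rewrite expr_le1 ?sin_le1// ltW.
have sc1 : - 1 <= sin c * cos c.
  by have := cos2Dsin2 c; have := sqr_ge0 (sin c + cos c); rewrite sqrrD; lra.
have c32 : 3 / 2 <= c.
  by rewrite -ler_sqr ?nnegrE ?(ltW c0)//; rewrite -/u; lra.
apply: (@le_trans _ _ ((c + 1) ^+ 2)).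
  by rewrite ler_sqr ?nnegrE//; lra.
have cu : 3 / 2 * c <= u by rewrite /u expr2 ler_pM2r.
have : u * (3 / 2) <= u * (u - sin c ^+ 2) by apply: ler_wpM2l => //; lra.
by rewrite sqrrD expr1n -/u; lra.
Qed.

(** When [2 m^2 <= Q^2], this absorbs [m^2 y^2] into [Q^2 (h^4 - h^2)]; it is what yields
    [K = Q / (Q - 2)] in the first case. *)
Lemma profile_defect y : y ^+ 2 <= 2 * (profile y ^+ 4 - profile y ^+ 2).
Proof.
wlog y0 : y / 0 <= y => [H|].
  have [/H//|y0] := leP 0 y.
  by have := H (- y); rewrite profileN sqrrN; apply; rewrite oppr_ge0 ltW.
have [cn|cn] := eqVneq (half_angle y) 0.
  by rewrite (profile0 y cn) (half_angle_eq0 y cn) expr0n !expr1n subrr mulr0.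
have [c1 c2 _] := half_angleP y.
have cp : 0 < half_angle y by rewrite lt_def cn half_angle_ge0.
have := defect_bound (half_angle y) cp c2.
have s0 : 0 < sin (half_angle y) by rewrite sin_gt0_pi// cp.
rewrite -half_angle_eq.
have -> : half_angle y ^+ 2 = profile y ^+ 2 * sin (half_angle y) ^+ 2.
  by rewrite -exprMn profile_sin.
move=> H.
have s4 : 0 < sin (half_angle y) ^+ 4 by rewrite exprn_gt0.
rewrite -(ler_pM2r s4); apply: le_trans (le_trans H _); rewrite le_eqVlt; apply/orP; left;
  apply/eqP; ring.
Qed.

End ProfileEstimates.

Section CarnotCaratheodory.
Context {R : realType} {n : nat}.
Notation pt := (@pt R n).
Notation Q := (@Qdim R n).
Implicit Types (x : pt) (y : R).

(** The derivative in [r] of [r profile (t / r^2)] is [cos c], of modulus at most 1. Off the axis,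
    regularising amounts to moving [r] from [|z|] to [sqrt (|z|^2 + e)]. *)
Lemma profile_scaled_dist (t a b : R) : 0 < a -> a <= b ->
  `|b * profile (t / b ^+ 2) - a * profile (t / a ^+ 2)| <= b - a.
Proof.
move=> a0 ab; pose F (r : R) : R := r * profile (t / r ^+ 2).
pose dF (r : R) : R := cos (half_angle (t / r ^+ 2)).
have dF1 (r : R) : 0 < r -> is_derive r 1 F (dF r).
  move=> r0; have rn0 : r != 0 by rewrite gt_eqF.
  have r20 : r ^+ 2 != 0 by rewrite expf_neq0.
  have d2 : is_derive r 1 (fun r : R => r ^+ 2) (2 * r).
    by apply: (dX 1 (is_derive_id r 1)); rewrite expr1 mulr1.
  have d3 := dM (dcst t r 1) (dV (g := fun r : R => r ^+ 2) r20 d2 erefl) erefl.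
  have d4 := dcomp (F := profile) d3 (is_derive_profile _) erefl.
  apply: (dM (is_derive_id r 1) d4).
  rewrite /dF -profile_eikonal.
  move: (profile _) (sin _) => P S; field.
  by rewrite rn0.
have dFab r : r \in `]a, b[ -> is_derive r 1 F (dF r).
  by rewrite in_itv/= => /andP[ar _]; apply: dF1; exact: lt_trans ar.
have cF : {within `[a, b]%classic, continuous F}.
  apply: derivable_within_continuous => r; rewrite in_itv/= => /andP[ar _].
  have := dF1 r (lt_le_trans a0 ar) => ?; exact: ex_derive.
have [c _ E] := MVT_segment ab dFab cF.
rewrite -/(F b) -/(F a) E normrM [`|b - a|]ger0_norm ?subr_ge0//.
rewrite ler_piMl ?subr_ge0// ler_norml.
by rewrite cos_geN1 cos_le1.
Qed.

Lemma cc_dist_regularized x e : (0 < n)%N -> 0 < e ->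
  `|radial e 2^-1 profile x - cc_dist x| <= 15 * Num.sqrt e.
Proof.
move=> n0 e0; have w0 := zsqD_gt0 x e e0.
have se0 : 0 <= Num.sqrt e := sqrtr_ge0 e.
rewrite /radial powR12_sqrt ?(ltW w0)//.
have [z0|z0] := ltP 0 (zsq x); last first.
  have zx : zsq x = 0 by apply/le_anti; rewrite z0 zsq_ge0.
  rewrite cc_dist_axis// zx add0r.
  have -> : Num.sqrt (pi * `|tcoord x|) =
      Num.sqrt e * Num.sqrt (pi * `|tcoord x / e|).
    rewrite -sqrtrM ?ltW//; congr Num.sqrt.
    by rewrite normrM normfV (gtr0_norm e0) mulrCA [e * _]mulrC divfK// gt_eqF.
  rewrite -mulrBr normrM (ger0_norm se0) mulrC ler_wpM2r//.
  exact: profile_asymptotic.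
rewrite cc_dist_profile//.
have sz0 : 0 < Num.sqrt (zsq x) by rewrite sqrtr_gt0.
have zw : Num.sqrt (zsq x) <= Num.sqrt (zsq x + e) by rewrite ler_wsqrtr// lerDl ltW.
have := profile_scaled_dist (tcoord x) _ _ sz0 zw.
rewrite !sqr_sqrtr ?(ltW z0) ?(ltW w0)// => H; apply: le_trans H _.
have s1 := sqr_sqrtr (ltW z0); have s2 := sqr_sqrtr (ltW w0); have s3 := sqr_sqrtr (ltW e0).
have sb : Num.sqrt (zsq x + e) <= Num.sqrt (zsq x) + Num.sqrt e.
  have ab : 0 <= Num.sqrt (zsq x) * Num.sqrt e by rewrite mulr_ge0// ltW.
  rewrite -ler_sqr ?nnegrE ?addr_ge0 ?sqrtr_ge0//.
  by rewrite s2 sqrrD s1 s3; lra.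
by lra.
Qed.

Lemma koranyi_le_cc_dist x : (0 < n)%N -> 2^-1 * koranyi x <= cc_dist x.
Proof.
move=> n0.
(* The fourth power of the Koranyi norm is then at most [d^4 + 4 d^4], below [(2 d)^4]. *)
have main d : 0 <= d -> zsq x <= d ^+ 2 -> `|tcoord x| <= 2 * d ^+ 2 ->
    2^-1 * koranyi x <= d.
  move=> d0 zd td; have z0 := zsq_ge0 x.
  rewrite mulrC ler_pdivrMr// mulrC /koranyi.
  have d4 : ((2 * d) ^+ 4) `^ 4^-1 = 2 * d.
    by rewrite -powR_mulrn ?mulr_ge0// -powRrM mulfV ?powRr1 ?mulr_ge0// pnatr_eq0.
  rewrite -[leRHS]d4; apply: ge0_ler_powR;
    rewrite ?nnegrE ?addr_ge0 ?sqr_ge0 ?exprn_ge0 ?mulr_ge0//.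
  have d20 : 0 <= d ^+ 2 by exact: sqr_ge0.
  have : zsq x ^+ 2 <= (d ^+ 2) ^+ 2 by rewrite ler_sqr.
  have : `|tcoord x| ^+ 2 <= (2 * d ^+ 2) ^+ 2 by rewrite ler_sqr ?nnegrE ?mulr_ge0.
  have := sqr_ge0 (d ^+ 2).
  have -> : (2 * d) ^+ 4 = 16 * (d ^+ 2) ^+ 2 by ring.
  have -> : (2 * d ^+ 2) ^+ 2 = 4 * (d ^+ 2) ^+ 2 by ring.
  rewrite real_normK ?num_real//.
  by lra.
have [z0|z0] := ltP 0 (zsq x); last first.
  have zx : zsq x = 0 by apply/le_anti; rewrite z0 zsq_ge0.
  rewrite cc_dist_axis//; apply: main; first exact: sqrtr_ge0.
    by rewrite zx sqr_ge0.
  rewrite sqr_sqrtr ?mulr_ge0 ?pi_ge0// mulrA.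
  by apply: ler_peMl => //; have := @pi_ge2 R; lra.
rewrite cc_dist_profile//; have h1 := @profile_ge1 R (tcoord x / zsq x).
apply: main; first by rewrite mulr_ge0 ?sqrtr_ge0// ltW ?profile_gt0.
  by rewrite exprMn sqr_sqrtr ?(ltW z0)// ler_peMr ?(ltW z0)// exprn_ege1.
rewrite exprMn sqr_sqrtr ?(ltW z0)// mulrCA mulrC -ler_pdivrMr//.
have := @profile_sqr_ge R (tcoord x / zsq x).
by rewrite normrM normfV (gtr0_norm z0).
Qed.

Lemma profile_energy (m y : R) :
  (Q * profile y - 2 * m * y * (sin (half_angle y) / 2)) ^+ 2 +
    (m * y * (profile y - 2 * y * (sin (half_angle y) / 2))) ^+ 2 =
  Q ^+ 2 * profile y ^+ 2 - 2 * Q * m * y * half_angle y + m ^+ 2 * y ^+ 2.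
Proof.
rewrite profile_eikonal.
have := profile_sin y; have := cos2Dsin2 (half_angle y).
move: (@Qdim R n) (profile y) (sin _) (cos _) => q h S C E <-.
have -> : m ^+ 2 * y ^+ 2 = m ^+ 2 * y ^+ 2 * (C ^+ 2 + S ^+ 2) by rewrite E mulr1.
by field.
Qed.

Lemma gfun_profile (p theta y : R) : (0 < n)%N ->
  (Q - 2) ^+ 2 * @gfun R n p theta (2 * half_angle y) * profile y ^+ 4 =
  Q ^+ 2 * profile y ^+ 2 - 2 * Q * (p * theta) * y * half_angle y +
    (p * theta) ^+ 2 * y ^+ 2.
Proof.
move=> n0; have Q2 := @Qdim_gt2 R n n0; rewrite /gfun.
have hE := profile_sin y; have yE := half_angle_eq y; have [c1 c2 _] := half_angleP y.
have [cn|cn] := eqVneq (half_angle y) 0.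
  rewrite cn mulr0 eqxx (profile0 y cn) (half_angle_eq0 y cn) !expr1n.
  move: (@Qdim R n) Q2 => q Q2; field; lra.
rewrite mulf_eq0 pnatr_eq0/= (negbTE cn).
have s0 : sin (half_angle y) != 0 by exact: sin_neq0.
have cosE : cos (2 * half_angle y) = 1 - 2 * sin (half_angle y) ^+ 2.
  by rewrite mulr_natl cos_mulr2n; have := cos2Dsin2 (half_angle y); lra.
have sinE : sin (2 * half_angle y) = 2 * sin (half_angle y) * cos (half_angle y).
  by rewrite mulr_natl sin_mulr2n; ring.
rewrite cosE sinE.
have yS : y = (profile y - cos (half_angle y)) / sin (half_angle y).
  by apply: (mulIf (expf_neq0 2 s0)); rewrite yE -[X in X - _]hE; field.
have h0 : profile y != 0 by rewrite gt_eqF// profile_gt0.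
move: hE yS s0 h0; clear yE sinE cosE.
move: (half_angle y) cn (profile y) (sin _) (cos _) => c cn h S C cE yE s0 h0.
rewrite yE -cE; move: (@Qdim R n) Q2 => q Q2.
have q2 : q - 2 != 0 by rewrite subr_eq0 gt_eqF.
by field; rewrite q2 s0 h0.
Qed.

Lemma gfun_le_gsup (p theta y : R) : (0 < n)%N ->
  @gfun R n p theta (2 * half_angle y) <= @gsup R n p theta.
Proof.
move=> n0; have Q2 := @Qdim_gt2 R n n0; have pi0 := @pi_gt0 R.
apply: ub_le_sup; last first.
  have [c1 c2 _] := half_angleP y; exists (2 * half_angle y) => //=.
  by rewrite in_itv/=; apply/andP; split; lra.
(* The supremum of an unbounded set of reals is a default value, so a bound on [g] has to be
   exhibited. [B] serves the interior, where [nu = 2 c] for a half-angle [c] and [y^2 <= 4 h^4]; the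
   endpoints are not of this form and their values are added by hand. *)
pose B := (2 * Q ^+ 2 + 8 * (p * theta) ^+ 2) / (Q - 2) ^+ 2.
have B0 : 0 <= B by apply: divr_ge0; [apply: addr_ge0; apply: mulr_ge0|]; rewrite ?sqr_ge0.
exists (B + `|@gfun R n p theta (2 * pi)| + `|@gfun R n p theta (- (2 * pi))|).
move=> _ [nu /= + <-]; rewrite in_itv/= => /andP[n1 n2].
have g0 (z : R) := normr_ge0 z.
have [->|nn1] := eqVneq nu (2 * pi).
  by apply: le_trans (ler_norm _) _; rewrite -addrA addrCA lerDl addr_ge0.
have [->|nn2] := eqVneq nu (- (2 * pi)).
  by apply: le_trans (ler_norm _) _; rewrite addrC lerDl addr_ge0.
have {}n1 : - (2 * pi) < nu by rewrite lt_def nn2.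
have {}n2 : nu < 2 * pi by rewrite lt_def eq_sym nn1.
rewrite -addrA; apply: ler_wpDr; first by rewrite addr_ge0.
have nuE : nu = 2 * half_angle (mu (nu / 2)).
  by rewrite half_angleK; [field|lra|lra].
rewrite nuE; set z := mu _.
have h1 := profile_ge1 z.
rewrite /B ler_pdivlMr ?exprn_gt0 ?subr_gt0// mulrC.
have h4 : 0 < profile z ^+ 4 by rewrite exprn_gt0// profile_gt0.
rewrite -(ler_pM2r h4) gfun_profile// -profile_energy.
set S := sin _ / 2; set m := p * theta.
have : (m * z * (profile z - 2 * z * S)) ^+ 2 <= (m * z) ^+ 2 * (1 - sin (half_angle z) ^+ 2).
  by rewrite profile_eikonal exprMn -(cos2Dsin2 (half_angle z)) addrK.
have := sqr_ge0 (Q * profile z + 2 * m * z * S).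
have E : (Q * profile z + 2 * m * z * S) ^+ 2 + (Q * profile z - 2 * m * z * S) ^+ 2 =
   2 * Q ^+ 2 * profile z ^+ 2 + 2 * ((m * z) ^+ 2 * sin (half_angle z) ^+ 2).
  by rewrite /S; move: (@Qdim R n) => q; field.
have := mulr_ge0 (sqr_ge0 (m * z)) (sqr_ge0 (sin (half_angle z))).
have : (m * z) ^+ 2 * sin (half_angle z) ^+ 2 <= (m * z) ^+ 2.
  by rewrite ler_piMr ?sqr_ge0// sqr_sin_le1.
have : z ^+ 2 <= 4 * profile z ^+ 4.
  rewrite -real_normK ?num_real// (_ : 4 * _ = (2 * profile z ^+ 2) ^+ 2); last by ring.
  have b0 : 0 <= 2 * profile z ^+ 2 by apply: mulr_ge0 => //; exact: sqr_ge0.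
  by rewrite ler_sqr ?nnegrE//; exact: profile_sqr_ge.
move=> /(ler_wpM2l (sqr_ge0 m)); rewrite -exprMn.
have : Q ^+ 2 * profile z ^+ 2 <= Q ^+ 2 * profile z ^+ 4.
  by apply: ler_wpM2l; [exact: sqr_ge0|exact: ler_weXn2l].
by lra.
Qed.

End CarnotCaratheodory.

Section HardyCarnotCaratheodory.
Context {R : realType} {n : nat}.
Notation Q := (@Qdim R n).

Lemma hardy_const_cc_ge (p theta K : R) :
  let m := p * theta in
  1 < p -> 0 < K -> (0 < n)%N ->
  (forall y, Q ^+ 2 * profile y ^+ 2 - 2 * Q * m * y * half_angle y + m ^+ 2 * y ^+ 2 <=
     (K * (Q - 2)) ^+ 2 * profile y ^+ 4) ->
  (((`|Q - m| / (p * K)) `^ p)%:E <= hardy_const (@cc_dist R n) p theta)%E.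
Proof.
move=> m p1 K0 n0 bd.
apply: (hardy_const_ge _ p theta K 15 2^-1 profile (fun y => sin (half_angle y) / 2)
  (fun y => cos (half_angle y) * (dmu (half_angle y))^-1 / 2)) => //.
- exact: is_derive_profile.
- exact: is_derive_dprofile.
- exact: cont_d2profile.
- exact: profile_gt0.
- by move=> y; rewrite profile_eikonal ler_norml cos_geN1 cos_le1.
- by move=> y; rewrite profile_energy; exact: bd.
- by move=> x e e0; exact: cc_dist_regularized.
- by move=> x; exact: koranyi_le_cc_dist.
Qed.

Lemma half_angleM_ge0 (y : R) : 0 <= y * half_angle y.
Proof.
wlog y0 : y / 0 <= y => [H|].
  have [/H//|y0] := leP 0 y.
  by have := H (- y); rewrite half_angleN mulrNN; apply; rewrite oppr_ge0 ltW.
by rewrite mulr_ge0// half_angle_ge0.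
Qed.

Lemma hardy_cc (p theta : R) : (0 < n)%N -> 2 <= p ->
  ((if (0 <= theta) && (4 * p * theta / (12 - pi ^+ 2) <= @Qdim R n)
    then ((@Qdim R n - 2) / @Qdim R n) `^ p * `|(@Qdim R n - p * theta) / p| `^ p
    else 1 / (@gsup R n p theta) `^ (p / 2) * `|(@Qdim R n - p * theta) / p| `^ p)%:E
     <= hardy_const (@cc_dist R n) p theta)%E.
Proof.
move=> n0 p2; have Q2 := @Qdim_gt2 R n n0.
have p0 : 0 < p by lra.
have p1 : 1 < p by lra.
have Q0 : 0 < Q by lra.
have Q20 : 0 < Q - 2 by lra.
set m := p * theta.
have constE K : 0 < K -> K^-1 `^ p * `|(Q - m) / p| `^ p = (`|Q - m| / (p * K)) `^ p.
  move=> K0; rewrite -powRM ?invr_ge0 ?(ltW K0)//; congr (_ `^ _).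
  rewrite normrM normfV (gtr0_norm p0) invfM.
  by rewrite mulrC -mulrA.
case: ifP => [/andP[th0 mQ]|_].
  rewrite -[(Q - 2) / Q]invf_div constE ?divr_gt0//.
  apply: hardy_const_cc_ge => //; first exact: divr_gt0.
  rewrite divfK ?gt_eqF// -/m => y.
  have m0 : 0 <= m by rewrite mulr_ge0// ltW.
  have pi12 : 0 < 12 - (pi : R) ^+ 2 by have := @pi_lt_sqrt12 R; lra.
  (* From [pi >= 61/20] follows [12 - pi^2 <= 14/5], so the threshold gives [m <= 7/10 Q], and
     [2 (7/10)^2 < 1]. *)
  have m1 : m <= Q * (7 / 10).
    move: mQ; rewrite ler_pdivrMr// -mulrA -/m => mQ.
    have : Q * (12 - pi ^+ 2) <= Q * (14 / 5).
      rewrite ler_pM2l//.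
      have : (61 / 20) ^+ 2 <= (pi : R) ^+ 2.
        by rewrite ler_sqr ?nnegrE ?pi_ge0// pi_ge305.
      by lra.
    by lra.
  have m2 : 2 * m ^+ 2 <= Q ^+ 2.
    have : m ^+ 2 <= (Q * (7 / 10)) ^+ 2.
      by rewrite ler_sqr ?nnegrE// mulr_ge0// ltW.
    by rewrite exprMn; have := sqr_ge0 Q; lra.
  have := ler_wpM2l (sqr_ge0 m) (profile_defect y).
  have A0 : 0 <= profile y ^+ 4 - profile y ^+ 2.
    by have := profile_defect y; have := sqr_ge0 y; lra.
  have := ler_wpM2r A0 m2.
  have : 0 <= 2 * Q * m * y * half_angle y.
    rewrite -mulrA; apply: mulr_ge0; last exact: half_angleM_ge0.
    by rewrite mulr_ge0// mulr_ge0// ltW.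
  by lra.
have g0 : 0 < @gsup R n p theta.
  apply: lt_le_trans (gfun_le_gsup p theta 0 n0).
  have h0 : half_angle (0 : R) = 0.
    by have := half_angleK (0 : R); rewrite mu0; apply; rewrite ?oppr_lt0 pi_gt0.
  by rewrite h0 mulr0 /gfun eqxx exprn_gt0// divr_gt0.
set K := Num.sqrt (@gsup R n p theta).
have K0 : 0 < K by rewrite sqrtr_gt0.
have -> : 1 / @gsup R n p theta `^ (p / 2) = K^-1 `^ p.
  rewrite div1r -[K^-1]powR_inv1 ?ltW// -powRrM mulN1r powRN; congr (_^-1).
  by rewrite /K -powR12_sqrt ?ltW// -powRrM mulrC.
rewrite constE//; apply: hardy_const_cc_ge => // y.
rewrite -gfun_profile// exprMn (sqr_sqrtr (ltW g0)) [_ * (Q - 2) ^+ 2]mulrC.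
rewrite (ler_pM2r (exprn_gt0 4 (profile_gt0 y))).
by rewrite ler_pM2l ?exprn_gt0// gfun_le_gsup.
Qed.

End HardyCarnotCaratheodory.

Theorem theorem1p6 (R : realType) (n : nat) (p theta : R) :
  (0 < n)%N -> 2 <= p ->
  ((if (1 - Num.sqrt (3 / 2)) * @Qdim R n <= p * theta <= (1 + Num.sqrt (3 / 2)) * @Qdim R n
    then `|(@Qdim R n - p * theta) / p| `^ p * `|(@Qdim R n - 2) / @Qdim R n| `^ p
    else (3 / 2) `^ (p / 2) * (3 * p * theta * (p * theta - 2 * @Qdim R n)) `^ (p / 4)
         / `|p * theta - @Qdim R n| `^ (p / 2) * `|(@Qdim R n - 2) / p| `^ p)%:E
     <= hardy_const (@koranyi R n) p theta)%E
  /\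
  ((if (0 <= theta) && (4 * p * theta / (12 - pi ^+ 2) <= @Qdim R n)
    then ((@Qdim R n - 2) / @Qdim R n) `^ p * `|(@Qdim R n - p * theta) / p| `^ p
    else 1 / (@gsup R n p theta) `^ (p / 2) * `|(@Qdim R n - p * theta) / p| `^ p)%:E
     <= hardy_const (@cc_dist R n) p theta)%E.
Proof. by move=> n0 p2; split; [exact: hardy_koranyi|exact: hardy_cc]. Qed.
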